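(* Let a Jordan arc $\gamma\subset\mathbb R^2$ with endpoints $a_0,a_1$ be the attractor of a system $\mathcal S=\{S_1,\dots,S_m\}$ of non-degenerate contracting affine maps of $\mathbb R^2$, and let $\mathcal F(\mathcal S)$ be the associated family of $\mathcal S$. If there is a sequence $f_n\in\mathcal F(\mathcal S)\setminus\{\mathrm{Id}\}$ such that $f_n\to\mathrm{Id}$ and $f_n(\gamma)\cap\gamma\neq\varnothing$ for all $n$, then $\gamma$ is a parabolic segment.
   Context: The attractor of $\mathcal S=\{S_1,\dots,S_m\}$ is the unique nonempty compact set $K$ with $K=\bigcup_{i=1}^m S_i(K)$. Let $I=\{1,\dots,m\}$, let $I^*=\bigcup_{n\ge1}I^n$ be the set of all finite multiindices, and for $\mathbf i=i_1i_2\dots i_n\in I^*$ put $S_{\mathbf i}=S_{i_1}S_{i_2}\cdots S_{i_n}$. The associated family $\mathcal F(\mathcal S)$ is the set of all compositions $S_{\mathbf j}^{-1}S_{\mathbf i}$ with $\mathbf i,\mathbf j\in I^*$ and $i_1\ne j_1$. An affine map is non-degenerate if its linear part is invertible. A parabolic segment is a subarc of a parabola or a straight line segment (straight line segments being regarded as degenerate parabolic segments). *)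

(* Defs.v *)
From HB Require Import structures.
From mathcomp Require Import all_boot all_order all_algebra.
From mathcomp Require Import boolp classical_sets functions set_interval reals.
From mathcomp Require Import topology normedtype.

Set Implicit Arguments.
Unset Strict Implicit.
Unset Printing Implicit Defensive.

Import Order.TTheory GRing.Theory Num.Theory.
Import numFieldNormedType.Exports.

Local Open Scope classical_set_scope.
Local Open Scope ring_scope.

Definition dot2 (R : realType) (x y : 'cV[R]_2) : R :=
  \sum_(i < 2) x i 0 * y i 0.

(* The library norm on matrices is the sup norm. *)
Definition norm2 (R : realType) (x : 'cV[R]_2) : R := Num.sqrt (dot2 x x).

(* The pair (A, b) stands for the affine map x |-> A x + b of the plane.
   Convergence of affine maps is convergence in the product topology of the
   linear and translation parts. *)
Definition affine (R : realType) : Type := ('M[R]_2 * 'cV[R]_2)%type.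

Definition aff_app (R : realType) (f : affine R) (x : 'cV[R]_2) : 'cV[R]_2 :=
  f.1 *m x + f.2.

Definition aff_id (R : realType) : affine R := (1%:M, 0).

Definition aff_comp (R : realType) (f g : affine R) : affine R :=
  (f.1 *m g.1, f.1 *m g.2 + f.2).

Definition aff_nondegenerate (R : realType) (f : affine R) : Prop :=
  f.1 \in unitmx.

(* The inverse map when f is non-degenerate. *)
Definition aff_inv (R : realType) (f : affine R) : affine R :=
  (invmx f.1, - (invmx f.1 *m f.2)).

Lemma aff_app_inj (R : realType) : injective (@aff_app R).
Proof.
move=> [A b] [A' b'] /= e.
have eb : b = b'.
  by have /(congr1 (fun h => h 0)) := e; rewrite /aff_app /= !mulmx0 !add0r.
congr pair => //; apply/matrixP => i j.
have /(congr1 (fun h => h (delta_mx j 0))) := e.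
rewrite /aff_app /= eb => /addIr; rewrite -!colE => /matrixP /(_ i 0).
by rewrite !mxE.
Qed.

Lemma aff_id_app (R : realType) (x : 'cV[R]_2) : aff_app (aff_id R) x = x.
Proof. by rewrite /aff_app /= mul1mx addr0. Qed.

Lemma aff_comp_app (R : realType) (f g : affine R) (x : 'cV[R]_2) :
  aff_app (aff_comp f g) x = aff_app f (aff_app g x).
Proof. by rewrite /aff_app /= mulmxDr mulmxA addrA. Qed.

Lemma aff_invK (R : realType) (f : affine R) :
  aff_nondegenerate f ->
  cancel (aff_app f) (aff_app (aff_inv f)) /\
  cancel (aff_app (aff_inv f)) (aff_app f).
Proof.
move=> uf; split=> x; rewrite /aff_app /=.
- by rewrite mulmxDr mulmxA mulVmx // mul1mx addrK.
- by rewrite mulmxDr mulmxN !mulmxA mulmxV // !mul1mx subrK.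
Qed.

Definition aff_contracting (R : realType) (f : affine R) : Prop :=
  exists2 q : R, 0 <= q < 1 &
    forall x y, norm2 (aff_app f x - aff_app f y) <= q * norm2 (x - y).

(* For a system of contractions there is exactly one such K, by Hutchinson's
   theorem; uniqueness is therefore not part of the predicate. *)
Definition is_attractor (R : realType) (m : nat) (S : 'I_m -> affine R)
    (K : set 'cV[R]_2) : Prop :=
  [/\ K !=set0, compact K &
      K = \bigcup_(i in [set: 'I_m]) (aff_app (S i) @` K)].

Definition word_map (R : realType) (m : nat) (S : 'I_m -> affine R)
    (w : seq 'I_m) : affine R :=
  foldr (fun i f => aff_comp (S i) f) (aff_id R) w.

(* Nonempty words are written as head :: tail, so i and j are the first
   letters. *)
Definition assoc_family (R : realType) (m : nat) (S : 'I_m -> affine R) :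
    set (affine R) :=
  [set f | exists (i j : 'I_m) (u v : seq 'I_m),
     i <> j /\
     f = aff_comp (aff_inv (word_map S (j :: v))) (word_map S (i :: u))].

Definition jordan_arc (R : realType) (C : set 'cV[R]_2) (a0 a1 : 'cV[R]_2) :
    Prop :=
  exists phi : R -> 'cV[R]_2,
    [/\ {within `[0, 1], continuous phi},
        {in `[0, 1] &, injective phi},
        C = phi @` `[0, 1],
        phi 0 = a0 & phi 1 = a1].

(* Points equidistant from the focus F and the directrix <u, x> = c, which has
   unit normal u and does not pass through F. *)
Definition is_parabola (R : realType) (P : set 'cV[R]_2) : Prop :=
  exists (F u : 'cV[R]_2) (c : R),
    [/\ norm2 u = 1, dot2 u F <> c &
        P = [set x | norm2 (x - F) = `|dot2 u x - c|]].

Definition is_line_segment (R : realType) (C : set 'cV[R]_2) : Prop :=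
  exists a b : 'cV[R]_2,
    a <> b /\ C = [set (1 - t) *: a + t *: b | t in `[0, 1]].

Definition parabolic_segment (R : realType) (C : set 'cV[R]_2) : Prop :=
  (exists2 P, is_parabola P & C `<=` P /\ exists a b, jordan_arc C a b) \/
  is_line_segment C.

(* Main.v *)
Require Import Defs.
From mathcomp Require Import all_boot all_order all_algebra.
From mathcomp Require Import boolp classical_sets functions set_interval reals.
From mathcomp Require Import topology normedtype.
From mathcomp Require Import prodnormedzmodule sequences realfun derive ring lra.
Import Order.TTheory GRing.Theory Num.Theory.
Import numFieldNormedType.Exports.
Local Open Scope classical_set_scope.
Local Open Scope ring_scope.

(** Let [phi] parametrize the arc by the unit interval and write
    [f_n = id + Z_n] with [Z_n] an affine vector field tending to zero. Since
    [S_j f_n = S_i] for two words [i] and [j], the arc and its image under [f_n]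
    are, after composition with [S_j], two subarcs of the arc itself. Their
    parameter maps are strictly monotone, and there are two cases
    ([displacement_trichotomy]).

    If infinitely often both maps have the same direction, then [f_n] slides
    the arc along itself. Its iterates travel along the arc in steps nearly
    parallel to [Z_n], so that a limit [X] of the normalised [Z_n] is tangent to
    the arc ([tangent_field_of_slides]).

    Otherwise the two directions are opposite: the arc and its image form a
    turn, on either side of which they are disjoint. Conjugation by the pieces
    [S_w] containing an end point of the arc yields maps of controlled size that
    move the whole arc off itself. Such a map cannot push a cap of the arc
    along the level line on which the cap stands ([cap_crossing]), so that a
    limit field crosses the arc in one direction only and its Hamiltonian [H] is
    monotone along the arc ([displaced_ham_monotone]). But then [H o S_j]
    increases along the arc and decreases along its image under [f_n], or
    conversely. These merge as [n] grows, and in the limit the Hamiltonian is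
    constant on the arc ([turning_displacement_parabolic]).

    Both cases rest on the same blow-up. The pull-back [L^-1 Z (L x + s)] of
    [Z] by [x |-> L x + s] has a linear part with the trace and determinant of
    that of [Z], while its norm is unbounded along the pieces [S_w] around a
    point where [Z] does not vanish. Hence normalised pull-backs of one field,
    or pull-backs of fixed size of fields tending to zero, converge to fields
    with nilpotent linear part. Those have explicit quadratic Hamiltonians,
    invariant under their flow, and the level sets are parabolas, lines and
    pairs of parallel lines ([nilpotent_level_arc]). In the first case the
    blow-up of [X] is still tangent, so that the Hamiltonian is constant along
    an open piece of the arc ([tangent_field_ham_const]), and the arc is an
    affine copy of a part of that piece. *)

Set Implicit Arguments.
Unset Strict Implicit.
Unset Printing Implicit Defensive.

(** * Compactness *)


(** Affine vector fields and affine maps are the same pairs; the expanded type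
    gives access to the norm of the product space. *)
Notation field R := ('M[R]_2 * 'cV[R]_2)%type.

Section Compactness.
Variable R : realType.

(** A decreasing family of non-empty conditions on a compact set has a common
    limit point; this replaces the extraction of subsequences. *)
Lemma compact_cluster_approx (V : normedModType R) (A : set V)
    (Q : R -> V -> Prop) :
  compact A ->
  (forall e, 0 < e -> exists v, A v /\ Q e v) ->
  (forall e e' v, e <= e' -> Q e v -> Q e' v) ->
  exists2 x, A x & forall e, 0 < e -> exists v, [/\ A v, Q e v & `|v - x| < e].
Proof.
move=> cA exQ Qmono.
pose F := filter_from [set e : R | 0 < e] (fun e => [set v | A v /\ Q e v]).
have FF : ProperFilter F.
  apply: filter_from_proper; last by move=> e e0; exact: exQ.
  apply: filter_from_filter; first by exists 1 => /=.
  move=> e e' /= e0 e'0; exists (Num.min e e') => /=; first by rewrite lt_min e0.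
  move=> v [Av Qv]; split; split => //; apply: Qmono Qv;
    by rewrite ge_min lexx ?orbT.
have FA : F A by exists 1 => //= v [].
have [x [Ax clx]] := cA F FF FA.
exists x => // e e0.
have Fe : F [set v | A v /\ Q e v] by exists e.
have [v [[Av Qv] xv]] := clx _ _ Fe (nbhsx_ballx x e e0).
exists v; split=> //.
by move: xv; rewrite -ball_normE /= distrC.
Qed.

Lemma mx_norm_leP (m n : nat) (M : 'M[R]_(m, n)) (e : R) : 0 <= e ->
  (forall i j, `|M i j| <= e) -> `|M| <= e.
Proof.
move=> e0 H; rewrite [leLHS]/Num.norm /= mx_normrE.
by apply/bigmax_leP; split=> // -[i j] _ /=.
Qed.

Lemma mx_norm_ge (m n : nat) (M : 'M[R]_(m, n)) i j : `|M i j| <= `|M|.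
Proof.
rewrite [leRHS]/Num.norm /= mx_normrE.
by apply/bigmax_geP; right => /=; exists (i, j).
Qed.

(** Fields are encoded as row vectors, whose bounded closed sets are compact. *)
Definition field_of_row (v : 'rV[R]_(2 * 2 + 2)) : field R :=
  (vec_mx (lsubmx v), (rsubmx v)^T).

Definition row_of_field (Z : field R) : 'rV[R]_(2 * 2 + 2) :=
  row_mx (mxvec Z.1) Z.2^T.

Lemma row_of_fieldK : cancel row_of_field field_of_row.
Proof.
by case=> M b; rewrite /field_of_row /row_of_field row_mxKl row_mxKr mxvecK trmxK.
Qed.

Lemma aff_norm_le (Z : field R) (e : R) :
  (`|Z| <= e) = (`|Z.1| <= e) && (`|Z.2| <= e).
Proof. by case: Z => M b; rewrite prod_normE /= ge_max. Qed.

Lemma field_of_row_norm v : `|field_of_row v| <= `|v|.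
Proof.
rewrite aff_norm_le; apply/andP; split; apply: mx_norm_leP => // i j /=;
  by rewrite !mxE mx_norm_ge.
Qed.

Lemma row_of_field_norm (Z : field R) : `|row_of_field Z| <= `|Z|.
Proof.
have /andP[n1 n2] : (`|Z.1| <= `|Z|) && (`|Z.2| <= `|Z|) by rewrite -aff_norm_le.
apply: mx_norm_leP => // i j; rewrite ord1 /row_of_field.
case: (split_ordP j) => k ->.
- rewrite row_mxEl; case/mxvec_indexP: k => a b; rewrite mxvecE.
  exact: le_trans (mx_norm_ge _ _ _) n1.
- by rewrite row_mxEr mxE; exact: le_trans (mx_norm_ge _ _ _) n2.
Qed.

Lemma field_of_rowB v w : field_of_row v - field_of_row w = field_of_row (v - w).
Proof.
by rewrite /field_of_row /= !linearB.
Qed.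

Lemma field_cluster (Q : R -> field R -> Prop) (B : R) :
  (forall e, 0 < e -> exists2 Z, `|Z| <= B & Q e Z) ->
  (forall e e' Z, e <= e' -> Q e Z -> Q e' Z) ->
  exists X : field R, forall e, 0 < e ->
    exists Z, [/\ `|Z| <= B, Q e Z & `|Z - X| < e].
Proof.
move=> exQ Qm.
have cA : compact [set v : 'rV[R]_(2 * 2 + 2) | `|v| <= B].
  apply: bounded_closed_compact.
    by exists B; split; rewrite ?num_real // => x Bx v /= /le_trans -> //; exact: ltW.
  rewrite (_ : [set _ | _] = Num.norm @^-1` [set x : R | x <= B]) //.
  apply: preimage_closed; last exact: closed_le.
  by move=> x _; exact: norm_continuous.
have [||v _ Hv] := @compact_cluster_approx _ _
    (fun e v => `|field_of_row v| <= B /\ Q e (field_of_row v)) cA.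
- move=> e /exQ[Z ZB QZ]; exists (row_of_field Z); split=> /=.
    exact: le_trans (row_of_field_norm Z) ZB.
  by rewrite row_of_fieldK.
- by move=> e e' w ee' [wB /(Qm _ _ _ ee')].
exists (field_of_row v) => e /Hv[w [_ [wB Qw] wv]].
exists (field_of_row w); split=> //.
by rewrite field_of_rowB; apply: le_lt_trans (field_of_row_norm _) wv.
Qed.

End Compactness.

(** * Affine fields and their Hamiltonians *)


Section Plane.
Variable R : realType.
Implicit Types (x y u v : 'cV[R]_2) (M : 'M[R]_2) (Z : field R) (S : affine R).

Lemma sum_ord2 (V : nmodType) (F : 'I_2 -> V) : \sum_(i < 2) F i = F 0 + F 1.
Proof.
by rewrite big_ord_recl big_ord1; congr (_ + F _); apply: val_inj.
Qed.

Lemma mulmx2E (m n : nat) (A : 'M[R]_(m, 2)) (B : 'M[R]_(2, n)) i j :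
  (A *m B) i j = A i 0 * B 0 j + A i 1 * B 1 j.
Proof. by rewrite mxE sum_ord2. Qed.

Lemma dot2E u v : dot2 u v = u 0 0 * v 0 0 + u 1 0 * v 1 0.
Proof. by rewrite /dot2 sum_ord2. Qed.

Lemma det2E M : \det M = M 0 0 * M 1 1 - M 0 1 * M 1 0.
Proof.
rewrite (expand_det_row _ 0) sum_ord2 /cofactor !det_mx11 !mxE /=.
rewrite (_ : lift 0 0 = 1 :> 'I_2); last exact: val_inj.
rewrite (_ : lift 1 0 = 0 :> 'I_2); last exact: val_inj.
by rewrite expr0 expr1; ring.
Qed.

Lemma trace2E M : \tr M = M 0 0 + M 1 1.
Proof. by rewrite /mxtrace sum_ord2. Qed.

Lemma col2P u v : u 0 0 = v 0 0 -> u 1 0 = v 1 0 -> u = v.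
Proof.
move=> e0 e1; apply/matrixP => i j; rewrite ord1.
have [->|->] : i = 0 \/ i = 1 by case: i => -[|[|]] // ?; [left|right]; apply: val_inj.
  exact: e0.
exact: e1.
Qed.

Lemma mx2P M M' : M 0 0 = M' 0 0 -> M 0 1 = M' 0 1 ->
  M 1 0 = M' 1 0 -> M 1 1 = M' 1 1 -> M = M'.
Proof.
move=> e00 e01 e10 e11; apply/matrixP => i j.
have c (k : 'I_2) : k = 0 \/ k = 1.
  by case: k => -[|[|]] // ?; [left|right]; apply: val_inj.
by case: (c i) => ->; case: (c j) => ->.
Qed.

Definition cross u v : R := u 0 0 * v 1 0 - u 1 0 * v 0 0.

Lemma crossDr u v x : cross x (u + v) = cross x u + cross x v.
Proof. by rewrite /cross !mxE; ring. Qed.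
Lemma crossBl u v x : cross (u - v) x = cross u x - cross v x.
Proof. by rewrite /cross !mxE; ring. Qed.
Lemma crossBr u v x : cross x (u - v) = cross x u - cross x v.
Proof. by rewrite /cross !mxE; ring. Qed.
Lemma crossZl a u x : cross (a *: u) x = a * cross u x.
Proof. by rewrite /cross !mxE; ring. Qed.
Lemma crossZr a u x : cross x (a *: u) = a * cross x u.
Proof. by rewrite /cross !mxE; ring. Qed.
Lemma crossvv u : cross u u = 0.
Proof. by rewrite /cross; ring. Qed.

Lemma cross_mul M u v : cross (M *m u) (M *m v) = \det M * cross u v.
Proof. by rewrite /cross det2E !mulmx2E; ring. Qed.

(** The Hamiltonian of [Z]: its symplectic gradient is [Z] when [Z] has trace
    zero. *)
Definition ham Z x : R := cross Z.2 x + 2^-1 * cross (Z.1 *m x) x.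

(** By Cayley-Hamilton the linear part squares to zero. Trace and determinant
    are invariant under conjugation and continuous, which is all that the
    blow-up argument needs. *)
Definition nilpotent_field Z : Prop := \tr Z.1 = 0 /\ \det Z.1 = 0.

(** If [g = id + Z] then [S^-1 g S = id + pull S Z]. *)
Definition pull S Z : field R :=
  (invmx S.1 *m Z.1 *m S.1, invmx S.1 *m (Z.1 *m S.2 + Z.2)).

Lemma pull_app S Z x :
  aff_app (pull S Z) x = invmx S.1 *m aff_app Z (aff_app S x).
Proof.
by rewrite /aff_app /pull /= !mulmxDr -!mulmxA addrA -mulmxDr.
Qed.

Lemma pull_trace S Z : aff_nondegenerate S -> \tr (pull S Z).1 = \tr Z.1.
Proof. by move=> uS; rewrite /pull /= -mulmxA mxtrace_mulC -mulmxA mulmxV // mulmx1. Qed.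

Lemma pull_det S Z : aff_nondegenerate S -> \det (pull S Z).1 = \det Z.1.
Proof.
move=> uS; rewrite /pull /= !det_mulmx mulrAC -det_mulmx mulVmx //.
by rewrite det1 mul1r.
Qed.

Lemma pull_nilpotent S Z :
  aff_nondegenerate S -> nilpotent_field Z -> nilpotent_field (pull S Z).
Proof. by move=> uS [tZ dZ]; split; rewrite ?pull_trace ?pull_det. Qed.

Lemma pull_comp S T Z : aff_nondegenerate S -> aff_nondegenerate T ->
  pull (aff_comp S T) Z = pull T (pull S Z).
Proof.
rewrite /aff_nondegenerate => uS uT.
rewrite /pull /aff_comp /=.
have -> : invmx (S.1 *m T.1) = invmx T.1 *m invmx S.1.
  have [uS' uT'] : \det S.1 \is a GRing.unit /\ \det T.1 \is a GRing.unit.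
    by move: uS uT; rewrite !unitmxE.
  have uST : S.1 *m T.1 \in unitmx by rewrite unitmx_mul uS.
  apply: (can_inj (mulKmx uST)); rewrite mulmxV //.
  by rewrite -mulmxA (mulmxA T.1) mulmxV // mul1mx mulmxV.
by congr pair; rewrite ?mulmxA // !mulmxDr !mulmxA -!addrA.
Qed.

Lemma pull_eq0 S Z : aff_nondegenerate S -> pull S Z = 0 -> Z = 0.
Proof.
move=> uS Z0.
have H x : aff_app Z x = 0.
  have [_ Sk] := aff_invK uS.
  have /(congr1 (mulmx S.1)) := pull_app S Z (aff_app (aff_inv S) x).
  rewrite Sk mulmxA mulmxV // mul1mx => <-.
  by rewrite Z0 /aff_app /= mul0mx addr0 mulmx0.
apply: (@aff_app_inj R); apply/funext => x; rewrite H.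
by rewrite /aff_app /= mul0mx addr0.
Qed.

Lemma ham_diff Z x y : \tr Z.1 = 0 ->
  ham Z y - ham Z x =
  cross (aff_app Z x) (y - x) + 2^-1 * cross (Z.1 *m (y - x)) (y - x).
Proof.
rewrite trace2E => t0; have e : Z.1 1 1 = - Z.1 0 0 by rewrite -[LHS]subr0 -t0; ring.
by rewrite /ham /aff_app /cross !(mulmx2E, mxE) e; field.
Qed.

(** The linear part of [S] multiplies areas by its determinant. *)
Lemma ham_pull S Z x y : aff_nondegenerate S -> \tr Z.1 = 0 ->
  ham Z (aff_app S y) - ham Z (aff_app S x) =
  \det S.1 * (ham (pull S Z) y - ham (pull S Z) x).
Proof.
move=> uS t0; rewrite !ham_diff ?pull_trace //.
have -> : aff_app S y - aff_app S x = S.1 *m (y - x).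
  by rewrite /aff_app opprD addrACA subrr addr0 mulmxBr.
have -> : aff_app Z (aff_app S x) = S.1 *m aff_app (pull S Z) x.
  by rewrite pull_app mulmxA mulmxV // mul1mx.
have -> : Z.1 *m (S.1 *m (y - x)) = S.1 *m ((pull S Z).1 *m (y - x)).
  by rewrite /pull /= -!mulmxA (mulmxA S.1 (invmx _)) mulmxV // mul1mx.
by rewrite !cross_mul; ring.
Qed.

(** When the linear part of [Z] is nilpotent, [id + Z] is the time-one map of
    the flow of this field, because the exponential series stops after its
    quadratic term. *)
Definition flow_generator Z : field R := (Z.1, Z.2 - 2^-1 *: (Z.1 *m Z.2)).

Lemma ham_flow_invariant Z x : nilpotent_field Z ->
  ham (flow_generator Z) (x + aff_app Z x) = ham (flow_generator Z) x.
Proof.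
case=> t0 d0; apply/eqP; rewrite -subr_eq0; apply/eqP.
rewrite ham_diff //= (addrC x) addrK.
move: t0 d0; rewrite trace2E det2E => t0 d0.
have e : Z.1 1 1 = - Z.1 0 0 by rewrite -[LHS]subr0 -t0; ring.
rewrite /aff_app /cross /= !(mulmx2E, mxE).
move: d0; rewrite e.
set a := Z.1 0 0; set b := Z.1 0 1; set c := Z.1 1 0.
set p := Z.2 0 0; set q := Z.2 1 0; set s := x 0 0; set t := x 1 0 => d0.
transitivity (- 2^-1 * (a * - a - b * c) *
  (s * (c * s - a * t + q) - t * (a * s + b * t + p))).
  by field.
by rewrite d0 mulr0 mul0r.
Qed.

End Plane.

(** * Level sets of nilpotent fields *)


Section LevelSets.
Variable R : realType.
Implicit Types (x y u v b : 'cV[R]_2) (Z : field R).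

Lemma sum_sqr_eq0 (a b : R) : a * a + b * b = 0 -> a = 0 /\ b = 0.
Proof.
move/eqP; rewrite -!expr2 paddr_eq0 ?sqr_ge0 // !sqrf_eq0.
by case/andP => /eqP -> /eqP ->.
Qed.

Lemma dot_cross_sqr u v :
  dot2 u v ^+ 2 + cross u v ^+ 2 = dot2 u u * dot2 v v.
Proof. by rewrite !dot2E /cross; ring. Qed.

Lemma dot_crossP u x y : u <> 0 ->
  dot2 u x = dot2 u y -> cross u x = cross u y -> x = y.
Proof.
move=> u0 ed ec.
have e1 : dot2 u (x - y) = 0.
  by move: ed; rewrite !dot2E !mxE => /eqP; rewrite -subr_eq0 => /eqP <-; ring.
have e2 : cross u (x - y) = 0 by rewrite crossBr ec subrr.
have e3 : dot2 u u * dot2 (x - y) (x - y) = 0.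
  by rewrite -dot_cross_sqr e1 e2 expr0n addr0.
have uu : dot2 u u != 0.
  apply/eqP => e; apply: u0; move: e; rewrite dot2E => /sum_sqr_eq0[e1' e2'].
  by apply: col2P; rewrite mxE.
move/eqP: e3; rewrite mulf_eq0 (negbTE uu) /= dot2E => /eqP/sum_sqr_eq0[].
rewrite !mxE => /eqP; rewrite subr_eq0 => /eqP e0' /eqP; rewrite subr_eq0 => /eqP e1'.
exact: col2P.
Qed.

Section ArcInLevelSet.
Variable phi : R -> 'cV[R]_2.
Hypothesis cphi : continuous phi.
Hypothesis iphi : {in `[0, 1] &, injective phi}.
Let gamma := phi @` `[0, 1]%classic.

Lemma coord_phi_continuous i : continuous (fun t => phi t i 0).
Proof. move=> t.
exact: (continuous_comp (cphi (x := t)) (@coord_continuous R 2 1 i 0 (phi t))). Qed.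

Lemma dot_phi_continuous u : continuous (fun t => dot2 u (phi t)).
Proof.
rewrite (_ : (fun t => _) = (fun t => u 0 0 * phi t 0 0 + u 1 0 * phi t 1 0)).
  by move=> t; apply: cvgD; apply: cvgM; (try exact: cvg_cst); exact: coord_phi_continuous.
by apply/funext => t; rewrite dot2E.
Qed.

Lemma cross_phi_continuous u : continuous (fun t => cross u (phi t)).
Proof.
by move=> t; apply: cvgB; apply: cvgM; (try exact: cvg_cst); exact: coord_phi_continuous.
Qed.

Lemma line_arc_segment u c : u <> 0 ->
  (forall t, t \in `[0, 1] -> cross u (phi t) = c) -> is_line_segment gamma.
Proof.
move=> u0 Hc.
pose K t := dot2 u (phi t).
have cK : {within `[0, 1], continuous K}.
  by apply: continuous_subspaceT; exact: dot_phi_continuous.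
have in0 : 0 \in `[0, 1 : R] by rewrite in_itv /= lexx ler01.
have in1 : 1 \in `[0, 1 : R] by rewrite in_itv /= lexx ler01.
have iK : {in `[0, 1] &, injective K}.
  move=> s t sI tI e; apply: iphi => //.
  by apply: (dot_crossP u0) => //; rewrite !Hc.
have K01 : K 0 != K 1.
  by apply/eqP => /(iK _ _ in0 in1)/eqP; rewrite eq_sym oner_eq0.
have Kconv a b s : dot2 u ((1 - s) *: a + s *: b) =
    (1 - s) * dot2 u a + s * dot2 u b.
  by rewrite !dot2E !mxE; ring.
have Cconv s : cross u ((1 - s) *: phi 0 + s *: phi 1) = c.
  by rewrite crossDr !crossZr !Hc //; ring.
exists (phi 0), (phi 1); split.
  by move/(iphi in0 in1)/eqP; rewrite eq_sym oner_eq0.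
rewrite predeqE => x; split.
- case=> t tI <-.
  have tI' : t \in `[0, 1] by [].
  pose s := (K t - K 0) / (K 1 - K 0).
  have K10 : K 1 - K 0 != 0 by rewrite subr_eq0 eq_sym.
  exists s.
  + rewrite /= in_itv /=.
    have t01 : 0 <= t <= 1 by move: tI'; rewrite in_itv.
    case/andP: t01 => t0 t1.
    case: (itv_continuous_inj_mono cK iK) => [/le_mono_in mK|/le_nmono_in mK].
    * have h0 : K 0 <= K t by rewrite mK.
      have h1 : K t <= K 1 by rewrite mK.
      have h : 0 < K 1 - K 0 by rewrite subr_gt0 lt_neqAle K01 (le_trans h0).
      by rewrite /s ler_pdivlMr // mul0r ler_pdivrMr // mul1r !lerD2r subr_ge0 h0 h1.
    * have h0 : K t <= K 0 by rewrite mK.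
      have h1 : K 1 <= K t by rewrite mK.
      have h : K 1 - K 0 < 0 by rewrite subr_lt0 lt_neqAle eq_sym K01 (le_trans h1).
      by rewrite /s ler_ndivlMr // mul0r ler_ndivrMr // mul1r !lerD2r subr_le0 h0 h1.
  + apply: (dot_crossP u0); last by rewrite Cconv Hc.
    rewrite Kconv -/(K 0) -/(K 1) -/(K t) /s; field.
    by rewrite subr_eq0 eq_sym.
- case=> s sI <-.
  have s01 : 0 <= s <= 1 by move: sI; rewrite /= in_itv.
  have [|t tI Kt] := @IVT R K 0 1 ((1 - s) * K 0 + s * K 1) ler01 cK.
    by rewrite ge_min le_max; case/andP: s01 => s0 s1; case: (leP (K 0) (K 1)) => h;
      apply/andP; split; apply/orP; (try by left; nra); (try by right; nra).
  exists t => //; apply: (dot_crossP u0); first by rewrite Kconv -Kt.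
  by rewrite Cconv Hc.
Qed.

Lemma parabola_equation u (p y0 z0 : R) : dot2 u u = 1 -> p != 0 ->
  is_parabola [set x | (cross u x - y0) ^+ 2 = 4 * p * (dot2 u x - z0)].
Proof.
move=> uu p0.
pose n : 'cV[R]_2 := \col_i (if i == 0 then - u 1 0 else u 0 0).
have n0 : n 0 0 = - u 1 0 by rewrite mxE.
have n1 : n 1 0 = u 0 0 by rewrite mxE.
(* In the frame (n, u) the vertex is (y0, z0), with the focus at distance p
   from it and the directrix at distance p on the other side. *)
pose F := y0 *: n + (z0 + p) *: u.
move: uu; rewrite dot2E => uu.
have uF : dot2 u F = z0 + p.
  rewrite dot2E !mxE /=; transitivity ((z0 + p) * (u 0 0 * u 0 0 + u 1 0 * u 1 0)).
    by ring.
  by rewrite uu mulr1.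
exists F, u, (z0 - p); split.
- by rewrite /norm2 dot2E uu sqrtr1.
- by rewrite uF => /eqP; rewrite (inj_eq (addrI z0)) -subr_eq0 opprK => /eqP e; move/eqP: p0; lra.
rewrite predeqE => x.
have key : dot2 (x - F) (x - F) =
    (cross u x - y0) ^+ 2 + (dot2 u x - (z0 + p)) ^+ 2.
  have -> : cross u x - y0 = cross u (x - F).
    rewrite /cross !mxE /=.
    transitivity (u 0 0 * x 1 0 - u 1 0 * x 0 0 - y0 * (u 0 0 * u 0 0 + u 1 0 * u 1 0)).
      by rewrite uu mulr1.
    by ring.
  have -> : dot2 u x - (z0 + p) = dot2 u (x - F).
    by rewrite -uF !dot2E !mxE; ring.
  by rewrite [RHS]addrC dot_cross_sqr (dot2E u u) uu mul1r.
have dge0 : 0 <= dot2 (x - F) (x - F) by rewrite dot2E; nra.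
have step : (norm2 (x - F) = `|dot2 u x - (z0 - p)|) <->
    dot2 (x - F) (x - F) = (dot2 u x - (z0 - p)) ^+ 2.
  split=> [e|e]; last by rewrite /norm2 e sqrtr_sqr.
  by rewrite -(sqr_sqrtr dge0) -/(norm2 _) e real_normK ?num_real.
rewrite /=; split=> h.
  by apply/step; rewrite key h; ring.
by move/step: h; rewrite key => h; rewrite -[LHS](addrK ((dot2 u x - (z0 + p)) ^+ 2)) h; ring.
Qed.

(** A quadratic form of rank one is a multiple of the square of a linear form,
    here written with a unit vector [u] spanning its kernel. *)
Lemma nilpotent_quadratic_form (M : 'M[R]_2) :
  \tr M = 0 -> \det M = 0 -> M <> 0 ->
  exists (u : 'cV[R]_2) (A : R), [/\ dot2 u u = 1, A != 0 &
    forall x, 2^-1 * cross (M *m x) x = A * cross u x ^+ 2].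
Proof.
rewrite trace2E det2E => t0 d0 M0.
have e11 : M 1 1 = - M 0 0 by rewrite -[LHS]subr0 -t0; ring.
move: d0; rewrite e11 => d0.
have [c0|c0] := eqVneq (M 1 0) 0.
  have a0 : M 0 0 = 0 by move: d0; rewrite c0; nra.
  exists (\col_i (if i == 0 then 1 else 0)), (2^-1 * M 0 1); split.
  - by rewrite dot2E !mxE /=; ring.
  - rewrite mulf_neq0 ?invr_eq0 ?pnatr_eq0 //; apply/eqP => b0; apply: M0.
    by apply: mx2P; rewrite ?e11 mxE // a0 oppr0.
  - by move=> x; rewrite /cross !mulmx2E !mxE /= e11 a0 c0; ring.
pose r := M 0 0 ^+ 2 + M 1 0 ^+ 2.
have r0 : 0 < r by rewrite /r ltr_wpDl ?sqr_ge0 // exprn_even_gt0.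
pose w := Num.sqrt r.
have w0 : w != 0 by rewrite gt_eqF // sqrtr_gt0.
have ww : w ^+ 2 = r by rewrite sqr_sqrtr // ltW.
exists (\col_i (if i == 0 then M 0 0 / w else M 1 0 / w)), (- (2^-1 * (r / M 1 0))); split.
- rewrite dot2E !mxE /=; transitivity (r / w ^+ 2); first by rewrite /r; field.
  by rewrite ww divff // gt_eqF.
- by rewrite oppr_eq0 !mulf_neq0 ?invr_eq0 ?pnatr_eq0 // gt_eqF.
- move=> x; rewrite /cross !mulmx2E !mxE /= e11.
  transitivity (- (2^-1 * (w ^+ 2 / M 1 0)) *
      (M 0 0 / w * x 1 0 - M 1 0 / w * x 0 0) ^+ 2); last by rewrite ww.
  have -> : M 0 1 = - (M 0 0 * M 0 0) / M 1 0.
    apply: (mulIf c0); rewrite divfK //.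
    by rewrite -[RHS]subr0 -d0; ring.
  by field; rewrite c0 w0.
Qed.

Lemma cross_frame u b x : dot2 u u = 1 ->
  cross b x = dot2 u b * cross u x + cross b u * dot2 u x.
Proof.
rewrite !dot2E => uu.
transitivity ((u 0 0 * u 0 0 + u 1 0 * u 1 0) * cross b x).
  by rewrite uu mul1r.
by rewrite /cross; ring.
Qed.

(** The level sets of the Hamiltonian of a nilpotent field are parabolas,
    lines and pairs of parallel lines. *)
Lemma nilpotent_level_arc Z c a0 a1 : jordan_arc gamma a0 a1 ->
  nilpotent_field Z -> Z <> 0 ->
  (forall t, t \in `[0, 1] -> ham Z (phi t) = c) -> parabolic_segment gamma.
Proof.
move=> arc [t0 d0] Z0 Hc.
have [M0|M0] := pselect (Z.1 = 0).
  right; apply: (@line_arc_segment Z.2 c).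
    by move=> b0; apply: Z0; case: Z M0 b0 {t0 d0 Hc} => M b /= -> ->.
  move=> t tI; rewrite -(Hc t tI) /ham M0 mul0mx.
  by rewrite /cross !mxE; ring.
have [u [A [uu A0 HA]]] := nilpotent_quadratic_form t0 d0 M0.
have u0 : u <> 0 by move=> e; move: uu; rewrite e dot2E !mxE; lra.
pose B := dot2 u Z.2; pose C := cross Z.2 u.
have eqn t : t \in `[0, 1] ->
    A * cross u (phi t) ^+ 2 + B * cross u (phi t) + C * dot2 u (phi t) = c.
  by move=> tI; rewrite -(Hc t tI) /ham HA (cross_frame Z.2 _ uu) -/B -/C; ring.
have [C0|C0] := eqVneq C 0; last first.
  left; exists [set x | (cross u x - (- B / (2 * A))) ^+ 2 =
      4 * (- C / (4 * A)) * (dot2 u x - (c / C + B ^+ 2 / (4 * A * C)))].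
    apply: parabola_equation => //.
    by rewrite mulf_neq0 ?oppr_eq0 // invr_eq0 mulf_neq0 // pnatr_eq0.
  split; last by exists a0, a1.
  move=> _ [t tI <-] /=; rewrite -(eqn t tI); field.
  by rewrite C0 A0.
right.
pose y t := cross u (phi t).
have cy : {within `[0, 1], continuous y}.
  by apply: continuous_subspaceT; exact: cross_phi_continuous.
have eqy t : t \in `[0, 1] -> A * y t ^+ 2 + B * y t = c.
  by move=> tI; rewrite -(eqn t tI) C0 mul0r addr0.
have in0 : 0 \in `[0, 1 : R] by rewrite in_itv /= lexx ler01.
apply: (@line_arc_segment u (y 0)) => // t tI; rewrite -/(y t).
apply: contrapT => /eqP ty.
have t01 : 0 <= t <= 1 by move: tI; rewrite in_itv.
case/andP: t01 => tge0 tle1.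
have sub : {subset `[0, t] <= `[0, 1 : R]}.
  by move=> s; rewrite !in_itv /= => /andP[-> /le_trans ->].
have cyt : {within `[0, t], continuous y}.
  by apply: continuous_subspaceT; exact: cross_phi_continuous.
have [|s sI ys] := @IVT R y 0 t ((y 0 + y t) / 2) tge0 cyt.
  by rewrite ge_min le_max; case: (leP (y 0) (y t)) => h;
    apply/andP; split; apply/orP; (try by left; lra); (try by right; lra).
have q0 := eqy 0 in0; have q1 := eqy t tI; have q2 := eqy s (sub _ sI).
move: q2; rewrite ys => q2.
(* A polynomial of degree two takes no value three times. *)
have nz : (y t - y 0) ^+ 2 != 0 by rewrite expf_neq0 // subr_eq0.
have : A * (y t - y 0) ^+ 2 = 0.
  transitivity (2 * ((A * y 0 ^+ 2 + B * y 0) + (A * y t ^+ 2 + B * y t)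
    - 2 * (A * ((y 0 + y t) / 2) ^+ 2 + B * ((y 0 + y t) / 2)))); first by field.
  by rewrite q0 q1 q2; ring.
by move/eqP; rewrite mulf_eq0 (negbTE A0) (negbTE nz).
Qed.

End ArcInLevelSet.
End LevelSets.

(** * A parity argument in the square *)


Section Parity.

Lemma xor_telescope (h : nat -> bool) N :
  \big[addb/false]_(j < N) (h j (+) h j.+1) = h 0%N (+) h N.
Proof.
elim: N => [|N IH]; first by rewrite big_ord0 addbb.
by rewrite big_ord_recr /= IH addbA; congr (_ (+) _); rewrite -addbA addbb addbF.
Qed.

(** The parity of a winding number. An edge is crossed when [A] changes along
    it while [B] holds. A cell on which one of the two is constant has an even
    number of crossed edges, and summing over all cells leaves the boundary. *)
Lemma sign_grid_parity (N : nat) (A B : nat -> nat -> bool) :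
  (forall i j, (i < N)%N -> (j < N)%N ->
     [/\ A i.+1 j = A i j, A i j.+1 = A i j & A i.+1 j.+1 = A i j] \/
     [/\ B i.+1 j = B i j, B i j.+1 = B i j & B i.+1 j.+1 = B i j]) ->
  (forall j, (j < N)%N -> A 0%N j != A 0%N j.+1 -> B 0%N j) ->
  (forall j, (j < N)%N -> A N j != A N j.+1 -> B N j) ->
  (forall i, (i < N)%N -> A i 0%N != A i.+1 0%N -> ~~ B i 0%N) ->
  (forall i, (i < N)%N -> A i N != A i.+1 N -> ~~ B i N) ->
  (A 0%N 0%N (+) A 0%N N) (+) (A N 0%N (+) A N N) = false.
Proof.
move=> cell left right bot top.
pose hx i j := (A i j (+) A i.+1 j) && B i j.
pose vy i j := (A i j (+) A i j.+1) && B i j.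
have cell0 i j : (i < N)%N -> (j < N)%N ->
    (hx i j (+) hx i j.+1) (+) (vy i j (+) vy i.+1 j) = false.
  move=> iN jN; rewrite /hx /vy.
  by case: (cell i j iN jN) => -[e1 e2 e3]; rewrite ?e1 ?e2 ?e3;
    case: (A i j); case: (A i.+1 j); case: (A i j.+1); case: (A i.+1 j.+1);
    case: (B i j); case: (B i.+1 j); case: (B i j.+1).
have : \big[addb/false]_(i < N) \big[addb/false]_(j < N)
    ((hx i j (+) hx i j.+1) (+) (vy i j (+) vy i.+1 j)) = false.
  by apply: big1 => i _; apply: big1 => j _; exact: cell0.
under eq_bigr do rewrite big_split /= (xor_telescope (hx _)).
rewrite big_split /= [X in _ (+) X](exchange_big_dep xpredT) //=.
under [X in _ (+) X]eq_bigr => j _ do rewrite (xor_telescope (vy^~ j)).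
rewrite [X in X (+) _]big1; last first.
  have xorF (x y z : bool) : (x != y -> ~~ z) -> (x (+) y) && z = false.
    by case: x y z => -[] [] //= /(_ isT).
  by move=> i _; rewrite /hx !xorF //; [exact: top|exact: bot].
rewrite addFb => <-.
transitivity (\big[addb/false]_(j < N)
    ((A 0%N j (+) A 0%N j.+1) (+) (A N j (+) A N j.+1))).
  by rewrite big_split /= !xor_telescope.
have xorT (x y z : bool) : (x != y -> z) -> (x (+) y) && z = x (+) y.
  by case: x y z => -[] [] //= /(_ isT).
by apply: eq_bigr => j _; rewrite /vy !xorT //; [exact: right|exact: left].
Qed.

Variable R : realType.

Lemma small_alternative (c mu u : R) (P : Prop) :
  c < mu -> `|u| < c -> mu <= `|u| \/ P -> P.
Proof.
move=> cmu uc [muu|//].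
by have := lt_trans (le_lt_trans muu uc) cmu; rewrite ltxx.
Qed.

Lemma sign_change_small (c u v : R) :
  (0 < u) != (0 < v) -> `|u - v| < c -> `|u| < c.
Proof.
rewrite !ltr_norml.
by case: (ltP 0 u) => u0; case: (ltP 0 v) => v0 // _ /andP[h1 h2]; apply/andP; split; lra.
Qed.

(** On a fine grid the sign changes of [F] at places where [G] is positive are
    counted modulo two. If the map stayed away from zero the count around every
    cell would be even; the boundary conditions make the count along the
    boundary odd. *)
Lemma odd_boundary_zero (a b : R) (F G : R -> R -> R) (mu : R) :
  a < b -> 0 < mu ->
  (forall e, 0 < e -> exists2 d, 0 < d & forall p p' q q',
     a <= p <= b -> a <= p' <= b -> a <= q <= b -> a <= q' <= b ->
     `|p - p'| < d -> `|q - q'| < d ->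
     `|F p q - F p' q'| < e /\ `|G p q - G p' q'| < e) ->
  (forall p q, (p = a \/ p = b) -> a <= q <= b -> mu <= `|F p q| \/ mu <= G p q) ->
  (forall p q, (q = a \/ q = b) -> a <= p <= b -> mu <= `|F p q| \/ G p q <= - mu) ->
  F a a < 0 -> F b b < 0 -> F a b * F b a < 0 ->
  forall e, 0 < e -> exists p q,
    [/\ a <= p <= b, a <= q <= b, `|F p q| < e & `|G p q| < e].
Proof.
move=> ab mu0 uc edgeU edgeL Faa Fbb Fab e e0; apply: contrapT => noz.
have noz' p q : a <= p <= b -> a <= q <= b -> `|F p q| < e -> e <= `|G p q|.
  by move=> pI qI Fe; rewrite leNgt; apply/negP => Ge; apply: noz; exists p, q.
pose c := Num.min e mu / 2.
have c0 : 0 < c by rewrite divr_gt0 // lt_min e0.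
have ce : c < e.
  by rewrite /c; case: (leP e mu) => h; rewrite ltr_pdivrMr //; lra.
have cmu : c < mu.
  by rewrite /c; case: (leP e mu) => h; rewrite ltr_pdivrMr //; lra.
have [d d0 dP] := uc c c0.
have ba0 : 0 < b - a by rewrite subr_gt0.
pose N := (Num.truncn ((b - a) / d)).+1.
have Nd : (b - a) / N%:R < d.
  by rewrite ltr_pdivrMr // mulrC -ltr_pdivrMr // truncnS_gt.
have N0 : 0 < N%:R :> R by rewrite ltr0n.
pose h := (b - a) / N%:R.
have h0 : 0 < h by rewrite divr_gt0.
pose x (i : nat) : R := a + i%:R * h.
have xI i : (i <= N)%N -> a <= x i <= b.
  move=> iN; have ih0 : 0 <= i%:R * h by rewrite mulr_ge0 ?ler0n ?(ltW h0).
  have ihb : i%:R * h <= b - a.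
    rewrite /h mulrCA -[leRHS]mulr1 ler_pM2l //.
    by rewrite ler_pdivrMr // mul1r ler_nat.
  by rewrite /x lerDl ih0 -lerBrDl.
have xS i : `|x i - x i.+1| < d.
  have -> : x i - x i.+1 = - h by rewrite /x -natr1; ring.
  by rewrite normrN gtr0_norm.
have xS' i : `|x i.+1 - x i| < d by rewrite distrC.
have x0 i : `|x i - x i| < d by rewrite subrr normr0.
have x0a : x 0%N = a by rewrite /x mul0r addr0.
have xNb : x N = b by rewrite /x /h mulrC divfK ?gt_eqF // addrC subrK.
have signch := @sign_change_small c.
have samesign (u v : R) : e <= `|u| -> `|u - v| < c -> (0 < v) = (0 < u).
  move=> eu uv; apply/eqP; rewrite eq_sym; apply: contraT => ne.
  by have := signch _ _ ne uv => /(le_lt_trans eu)/(lt_trans ce); rewrite ltxx.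
pose A i j := 0 < F (x i) (x j); pose B i j := 0 < G (x i) (x j).
have /negP[] : ~~ ((A 0%N 0%N (+) A 0%N N) (+) (A N 0%N (+) A N N)).
  rewrite (@sign_grid_parity N A B) //.
  - move=> i j iN jN.
    have [iI iI'] : a <= x i <= b /\ a <= x i.+1 <= b.
      by split; apply: xI => //; exact: ltnW.
    have [jI jI'] : a <= x j <= b /\ a <= x j.+1 <= b.
      by split; apply: xI => //; exact: ltnW.
    have [F1 G1] := dP _ _ _ _ iI iI' jI jI (xS i) (x0 j).
    have [F2 G2] := dP _ _ _ _ iI iI jI jI' (x0 i) (xS j).
    have [F3 G3] := dP _ _ _ _ iI iI' jI jI' (xS i) (xS j).
    have [Fs|Fl] := ltP `|F (x i) (x j)| e.
      by right; have Ge := noz' _ _ iI jI Fs; split; apply: samesign Ge _.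
    by left; split; apply: samesign Fl _.
  - move=> j jN ne; rewrite /B.
    have jI : a <= x j <= b by apply: xI; exact: ltnW.
    have jI' : a <= x j.+1 <= b by apply: xI.
    have [aI bI] : a <= a <= b /\ a <= b <= b by rewrite !lexx ltW.
    move: ne; rewrite /A x0a => ne.
    have aa : `|a - a| < d by rewrite subrr normr0.
    have [F1 _] := dP _ _ _ _ aI aI jI jI' aa (xS j).
    have := edgeU a (x j) (or_introl erefl) jI.
    by move=> /(small_alternative cmu (signch _ _ ne F1)); exact: lt_le_trans.
  - move=> j jN ne; rewrite /B.
    have jI : a <= x j <= b by apply: xI; exact: ltnW.
    have jI' : a <= x j.+1 <= b by apply: xI.
    have [aI bI] : a <= a <= b /\ a <= b <= b by rewrite !lexx ltW.
    move: ne; rewrite /A xNb => ne.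
    have aa : `|b - b| < d by rewrite subrr normr0.
    have [F1 _] := dP _ _ _ _ bI bI jI jI' aa (xS j).
    have := edgeU b (x j) (or_intror erefl) jI.
    by move=> /(small_alternative cmu (signch _ _ ne F1)); exact: lt_le_trans.
  - move=> j jN ne; rewrite /B -leNgt.
    have jI : a <= x j <= b by apply: xI; exact: ltnW.
    have jI' : a <= x j.+1 <= b by apply: xI.
    have [aI bI] : a <= a <= b /\ a <= b <= b by rewrite !lexx ltW.
    move: ne; rewrite /A x0a => ne.
    have aa : `|a - a| < d by rewrite subrr normr0.
    have [F1 _] := dP _ _ _ _ jI jI' aI aI (xS j) aa.
    have := edgeL (x j) a (or_introl erefl) jI.
    move=> /(small_alternative cmu (signch _ _ ne F1))/le_trans; apply.
    by rewrite oppr_le0 ltW.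
  - move=> j jN ne; rewrite /B -leNgt.
    have jI : a <= x j <= b by apply: xI; exact: ltnW.
    have jI' : a <= x j.+1 <= b by apply: xI.
    have [aI bI] : a <= a <= b /\ a <= b <= b by rewrite !lexx ltW.
    move: ne; rewrite /A xNb => ne.
    have aa : `|b - b| < d by rewrite subrr normr0.
    have [F1 _] := dP _ _ _ _ jI jI' bI bI (xS j) aa.
    have := edgeL (x j) b (or_intror erefl) jI.
    move=> /(small_alternative cmu (signch _ _ ne F1))/le_trans; apply.
    by rewrite oppr_le0 ltW.
rewrite /A x0a xNb !(ltNge 0) (ltW Faa) (ltW Fbb) /= -!ltNge.
case: (ltP 0 (F a b)) => h1; case: (ltP 0 (F b a)) => h2 //=;
  exfalso; move: Fab; apply/negP; rewrite -leNgt.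
  by rewrite ltW // mulr_gt0.
by rewrite mulr_le0.
Qed.

End Parity.

(** * Affine self-maps of an arc *)


Section Estimates.
Variable R : realType.
Implicit Types (x y u v : 'cV[R]_2) (Z : field R).

Lemma cross_le u v : `|cross u v| <= 2 * (`|u| * `|v|).
Proof.
rewrite /cross (le_trans (ler_normB _ _)) // !normrM.
have -> : 2 * (`|u| * `|v|) = `|u| * `|v| + `|u| * `|v| by ring.
by apply: lerD; apply: ler_pM; rewrite ?mx_norm_ge.
Qed.

Lemma mulmx_le (m n : nat) (A : 'M[R]_(m, 2)) (B : 'M[R]_(2, n)) :
  `|A *m B| <= 2 * (`|A| * `|B|).
Proof.
apply: mx_norm_leP; first by rewrite !mulr_ge0.
move=> i j; rewrite mulmx2E (le_trans (ler_normD _ _)) // !normrM.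
have -> : 2 * (`|A| * `|B|) = `|A| * `|B| + `|A| * `|B| by ring.
by apply: lerD; apply: ler_pM; rewrite ?mx_norm_ge.
Qed.

Lemma field_norm1 Z : `|Z.1| <= `|Z|.
Proof. by have := lexx `|Z|; rewrite aff_norm_le => /andP[]. Qed.

Lemma field_norm2 Z : `|Z.2| <= `|Z|.
Proof. by have := lexx `|Z|; rewrite aff_norm_le => /andP[]. Qed.

Lemma aff_app_le Z x : `|aff_app Z x| <= `|Z| * (2 * `|x| + 1).
Proof.
rewrite /aff_app (le_trans (ler_normD _ _)) // mulrDr mulr1.
apply: lerD; last exact: field_norm2.
rewrite (le_trans (mulmx_le _ _)) // mulrCA.
by rewrite ler_wpM2r ?field_norm1 // mulr_ge0.
Qed.

Lemma aff_appB Z x y : aff_app Z x - aff_app Z y = Z.1 *m (x - y).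
Proof. by rewrite /aff_app opprD addrACA subrr addr0 mulmxBr. Qed.

Lemma aff_app_lip Z x y : `|aff_app Z x - aff_app Z y| <= 2 * `|Z| * `|x - y|.
Proof.
rewrite aff_appB (le_trans (mulmx_le _ _)) // -mulrA ler_pM2l //.
by rewrite ler_wpM2r // field_norm1.
Qed.

Lemma aff_appBf (Z Z' : field R) x : aff_app Z x - aff_app Z' x = aff_app (Z - Z') x.
Proof. by rewrite /aff_app /= mulmxBl opprD addrACA. Qed.

Lemma aff_appZf a Z x : aff_app (a *: Z) x = a *: aff_app Z x.
Proof. by rewrite /aff_app /= -scalemxAl -scalerDr. Qed.

Lemma aff_app_inj2 (S : affine R) : aff_nondegenerate S -> injective (aff_app S).
Proof. by move=> /aff_invK[/can_inj]. Qed.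

End Estimates.

Section Arc.
Variable R : realType.
Variable phi : R -> 'cV[R]_2.
Hypothesis cphi : continuous phi.
Hypothesis iphi : {in `[0, 1] &, injective phi}.
Hypothesis phiT : forall t, exists2 s, 0 <= s <= 1 & phi s = phi t.

Lemma phi_inj s t : 0 <= s <= 1 -> 0 <= t <= 1 -> phi s = phi t -> s = t.
Proof. by move=> sI tI; apply: iphi; rewrite in_itv. Qed.

(** Compactness of the square of parameters, from which all the uniform
    estimates on the arc follow. *)
Lemma pair_cluster (Q : R -> R -> R -> Prop) :
  (forall e, 0 < e -> exists s t, [/\ 0 <= s <= 1, 0 <= t <= 1 & Q e s t]) ->
  (forall e e' s t, e <= e' -> Q e s t -> Q e' s t) ->
  exists s0 t0, [/\ 0 <= s0 <= 1, 0 <= t0 <= 1 & forall e, 0 < e ->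
    exists s t, [/\ 0 <= s <= 1, 0 <= t <= 1, Q e s t, `|s - s0| < e & `|t - t0| < e]].
Proof.
move=> exQ Qm.
pose A : set (R^o * R^o) := `[0, 1]%classic `*` `[0, 1]%classic.
have AP (v : R^o * R^o) : A v <-> 0 <= v.1 <= 1 /\ 0 <= v.2 <= 1.
  by rewrite /A /= !in_itv.
have cA : compact A by apply: compact_setX; exact: segment_compact.
have [||[s0 t0] Ast H] := @compact_cluster_approx _ _ A (fun e v => Q e v.1 v.2) cA.
- by move=> e /exQ[s [t [sI tI q]]]; exists (s, t); split => //; apply/AP.
- by move=> e e' v; exact: Qm.
exists s0, t0; have [sI tI] := (AP (s0, t0)).1 Ast; split=> // e /H[[s t]].
case=> /AP/=[sI' tI'] q; rewrite prod_normE /= gt_max => /andP[h1 h2].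
by exists s, t.
Qed.

Lemma phi_cvg t e : 0 < e -> exists2 d, 0 < d & forall s, `|s - t| < d -> `|phi s - phi t| < e.
Proof.
move=> e0; have /cvgrPdist_lt/(_ e e0)/nbhs_ballP[d d0 H] := cphi (x := t).
exists d => // s st; rewrite distrC; apply: H.
by rewrite -ball_normE /= distrC.
Qed.

Lemma phi_uc e : 0 < e -> exists2 d, 0 < d & forall s t, 0 <= s <= 1 -> 0 <= t <= 1 ->
  `|s - t| < d -> `|phi s - phi t| < e.
Proof.
move=> e0; apply: contrapT => no.
have [||s0 [t0 [s0I t0I H]]] := @pair_cluster (fun d s t => `|s - t| < d /\ e <= `|phi s - phi t|).
- move=> d d0; apply: contrapT => nod; apply: no; exists d => // s t sI tI st.
  by rewrite ltNge; apply/negP => h; apply: nod; exists s, t.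
- by move=> d d' s t dd' [h1 h2]; split=> //; exact: lt_le_trans dd'.
have st0 : s0 = t0.
  apply/eqP; rewrite -subr_eq0 -normr_le0; apply/ler_addgt0Pl => d d0; rewrite addr0.
  have [s [t [_ _ [h1 _] h2 h3]]] := H (d / 3) (divr_gt0 d0 (ltr0Sn _ _)).
  have -> : s0 - t0 = - (s - s0) + ((s - t) + (t - t0)) by ring.
  rewrite (le_trans (ler_normD _ _)) // normrN.
  have := ler_normD (s - t) (t - t0); move: h1 h2 h3.
  lra.
have [d d0 Hd] := phi_cvg s0 (divr_gt0 e0 (ltr0Sn R 1)).
have [s [t [_ _ [_ h1] h2 h3]]] := H d d0.
rewrite -st0 in h3.
have := ler_distD (phi s0) (phi s) (phi t).
have := Hd _ h2; have := Hd _ h3; rewrite (distrC (phi t)).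
move: h1; lra.
Qed.

(** An injective continuous map of a compact interval is a homeomorphism onto
    its image. *)
Lemma phi_inv_uc e : 0 < e -> exists2 d, 0 < d & forall s t, 0 <= s <= 1 -> 0 <= t <= 1 ->
  `|phi s - phi t| < d -> `|s - t| < e.
Proof.
move=> e0; apply: contrapT => no.
have [||s0 [t0 [s0I t0I H]]] := @pair_cluster (fun d s t => `|phi s - phi t| < d /\ e <= `|s - t|).
- move=> d d0; apply: contrapT => nod; apply: no; exists d => // s t sI tI st.
  by rewrite ltNge; apply/negP => h; apply: nod; exists s, t.
- by move=> d d' s t dd' [h1 h2]; split=> //; exact: lt_le_trans dd'.
have st0 : s0 = t0.
  apply: phi_inj => //; apply/eqP; rewrite -subr_eq0 -normr_le0.
  apply/ler_addgt0Pl => d d0; rewrite addr0.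
  have d3 : 0 < d / 3 by rewrite divr_gt0.
  have [d1 d10 H1] := phi_cvg s0 d3; have [d2 d20 H2] := phi_cvg t0 d3.
  pose d' := Num.min (d / 3) (Num.min d1 d2).
  have d'0 : 0 < d' by rewrite !lt_min d3 d10.
  have [s [t [_ _ [h1 _] h2 h3]]] := H d' d'0.
  move: h1 h2 h3; rewrite !lt_min => /and3P[h1 _ _] /and3P[_ /H1 h2 _] /and3P[_ _ /H2 h3].
  have -> : phi s0 - phi t0 = - (phi s - phi s0) + ((phi s - phi t) + (phi t - phi t0)).
    by rewrite opprB !subrKA.
  rewrite (le_trans (ler_normD _ _)) // normrN.
  have := ler_normD (phi s - phi t) (phi t - phi t0); move: h1 h2 h3.
  by clear; lra.
have [s [t [_ _ [_ h1] h2 h3]]] := H (e / 3) (divr_gt0 e0 (ltr0Sn _ _)).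
have := ler_distD s0 s t; rewrite (distrC s0) st0 in h2 *.
move: h1 h2 h3; clear -e0; lra.
Qed.

Lemma phi_bounded : exists2 B, 1 <= B & forall t, `|phi t| <= B.
Proof.
have [d d0 H] := phi_uc ltr01.
pose N := (Num.truncn d^-1).+1.
have dN : N%:R^-1 < d.
  by rewrite -[ltRHS]invrK ltf_pV2 ?posrE ?invr_gt0 ?ltr0n // truncnS_gt.
exists (1 + `|phi 0| + N%:R); first by rewrite -addrA lerDl addr_ge0.
move=> t0; have [t tI <-] := phiT t0.
have : forall k : nat, (k <= N)%N -> `|phi (t * k%:R / N%:R)| <= `|phi 0| + k%:R.
  elim=> [|k IH] kN; first by rewrite mulr0 mul0r addr0.
  have Nk : k%:R <= N%:R :> R by rewrite ler_nat ltnW.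
  have Nk1 : k.+1%:R <= N%:R :> R by rewrite ler_nat.
  have N0 : 0 < N%:R :> R by rewrite ltr0n.
  have tk j : (j%:R <= N%:R :> R) -> 0 <= t * j%:R / N%:R <= 1.
    case/andP: tI => t0' t1' jN; rewrite -mulrA mulr_ge0 ?divr_ge0 ?ler0n //=.
    have : j%:R / N%:R <= 1 :> R by rewrite ler_pdivrMr // mul1r.
    have : 0 <= j%:R / N%:R :> R by rewrite divr_ge0 // ler0n.
    by move: t1' t0'; clear; move: (_ / _) => z; nra.
  have dist : `|t * k.+1%:R / N%:R - t * k%:R / N%:R| < d.
    have -> : t * k.+1%:R / N%:R - t * k%:R / N%:R = t * N%:R^-1 by rewrite -natr1; ring.
    case/andP: tI => t0' t1'.
    rewrite ger0_norm ?mulr_ge0 ?invr_ge0 ?ler0n //; apply: le_lt_trans dN.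
    by rewrite -[leRHS]mul1r ler_wpM2r ?invr_ge0 ?ler0n.
  have h := H _ _ (tk _ Nk1) (tk _ Nk) dist.
  have := IH (ltnW kN); have := ler_normD (phi (t * k.+1%:R / N%:R) - phi (t * k%:R / N%:R)) (phi (t * k%:R / N%:R)).
  move: h; rewrite subrK -natr1; clear; lra.
move=> /(_ N (leqnn _)); rewrite mulfK ?pnatr_eq0 // => /le_trans; apply.
by rewrite lerD2r lerDr.
Qed.

Lemma positive_distance (g : affine R) :
  (forall s t, 0 <= s <= 1 -> 0 <= t <= 1 -> aff_app g (phi s) <> phi t) ->
  exists2 d, 0 < d & forall s t, 0 <= s <= 1 -> 0 <= t <= 1 -> d <= `|aff_app g (phi s) - phi t|.
Proof.
move=> gne; apply: contrapT => no.
have [||s0 [t0 [s0I t0I H]]] := @pair_cluster (fun d s t => `|aff_app g (phi s) - phi t| < d).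
- move=> d d0; apply: contrapT => nod; apply: no; exists d => // s t sI tI.
  by rewrite leNgt; apply/negP => h; apply: nod; exists s, t.
- by move=> d d' s t dd' h; exact: lt_le_trans dd'.
apply: (gne s0 t0) => //; apply/eqP; rewrite -subr_eq0 -normr_le0.
apply/ler_addgt0Pl => d d0; rewrite addr0.
have d3 : 0 < d / 3 by rewrite divr_gt0.
pose C := 2 * `|g : field R| + 1.
have C0 : 0 < C by rewrite ltr_wpDl // mulr_ge0.
have [d1 d10 H1] := phi_cvg s0 (divr_gt0 d3 C0); have [d2 d20 H2] := phi_cvg t0 d3.
pose d' := Num.min (d / 3) (Num.min d1 d2).
have d'0 : 0 < d' by rewrite !lt_min d3 d10.
have [s [t [_ _ h1 h2 h3]]] := H d' d'0.
move: h1 h2 h3; rewrite !lt_min => /and3P[h1 _ _] /and3P[_ /H1 h2 _] /and3P[_ _ /H2 h3].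
have h2' : `|aff_app g (phi s) - aff_app g (phi s0)| <= d / 3.
  rewrite (le_trans (aff_app_lip g _ _)) //.
  move: h2; rewrite ltr_pdivlMr // => /ltW; apply: le_trans.
  by rewrite mulrC ler_wpM2l // lerDl.
have -> : aff_app g (phi s0) - phi t0 = - (aff_app g (phi s) - aff_app g (phi s0)) +
    ((aff_app g (phi s) - phi t) + (phi t - phi t0)).
  by rewrite opprB !subrKA.
rewrite (le_trans (ler_normD _ _)) // normrN.
have := ler_normD (aff_app g (phi s) - phi t) (phi t - phi t0); move: h1 h2' h3.
by clear; lra.
Qed.

Definition increasing01 (a : R -> R) := forall s t, 0 <= s -> s < t -> t <= 1 -> a s < a t.
Definition decreasing01 (a : R -> R) := forall s t, 0 <= s -> s < t -> t <= 1 -> a t < a s.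

(** The parameter map is continuous because [phi] is a homeomorphism onto the
    arc, and an injective continuous function on an interval is strictly
    monotone. *)
Lemma induced_parameter_map (S : affine R) : aff_nondegenerate S ->
  (forall t, exists2 s, 0 <= s <= 1 & phi s = aff_app S (phi t)) ->
  exists a : R -> R, [/\ continuous a, forall t, 0 <= a t <= 1,
    forall t, phi (a t) = aff_app S (phi t) & increasing01 a \/ decreasing01 a].
Proof.
move=> uS HS.
have /choice[a Ha] : forall t, exists s, 0 <= s <= 1 /\ phi s = aff_app S (phi t).
  by move=> t; have [s sI e] := HS t; exists s.
have ca : continuous a.
  move=> t; apply/cvgrPdist_lt => e e0.
  have [d d0 H] := phi_inv_uc e0.
  pose C := 2 * `|S : field R| + 1.
  have C0 : 0 < C by rewrite ltr_wpDl // mulr_ge0.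
  have [d1 d10 H1] := phi_cvg t (divr_gt0 d0 C0).
  apply/nbhs_ballP; exists d1 => // s; rewrite /ball /= => ts.
  apply: H; [exact: (Ha t).1|exact: (Ha s).1|].
  rewrite (Ha t).2 (Ha s).2 (le_lt_trans (aff_app_lip S _ _)) //.
  move: ts; rewrite distrC => /H1; rewrite distrC ltr_pdivlMr //; apply: le_lt_trans.
  by rewrite mulrC ler_wpM2l // lerDl.
have ia : {in `[0, 1] &, injective a}.
  move=> s t sI tI e; apply: iphi => //; apply: (aff_app_inj2 uS).
  by rewrite -(Ha s).2 -(Ha t).2 e.
exists a; split=> //; [by move=> t; exact: (Ha t).1|by move=> t; exact: (Ha t).2|].
have mem (s t : R) : 0 <= s -> s < t -> t <= 1 -> s \in `[0, 1] /\ t \in `[0, 1].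
  move=> s0 st t1; rewrite !in_itv /= s0 t1 (le_trans (ltW st)) //=.
  by rewrite (le_trans s0) // ltW.
have ca' : {within `[0, 1], continuous a} by apply: continuous_subspaceT.
case: (itv_continuous_inj_mono ca' ia) => m; [left|right] => s t s0 st t1;
  by have [sI tI] := mem _ _ s0 st t1; apply: m.
Qed.

End Arc.

(** * Sliding displacements and tangent fields *)


Section Slide.
Variable R : realType.
Implicit Types (x y u v : 'cV[R]_2) (Z : field R).

Lemma dot2_le u v : `|dot2 u v| <= 2 * (`|u| * `|v|).
Proof.
rewrite dot2E (le_trans (ler_normD _ _)) // !normrM.
have -> : 2 * (`|u| * `|v|) = `|u| * `|v| + `|u| * `|v| by ring.
by apply: lerD; apply: ler_pM; rewrite ?mx_norm_ge.
Qed.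

Lemma dot2Dr u v x : dot2 u (v + x) = dot2 u v + dot2 u x.
Proof. by rewrite !dot2E !mxE; ring. Qed.

Lemma dot2Br u v x : dot2 u (v - x) = dot2 u v - dot2 u x.
Proof. by rewrite !dot2E !mxE; ring. Qed.

Lemma dot2Zr (a : R) u v : dot2 u (a *: v) = a * dot2 u v.
Proof. by rewrite !dot2E !mxE; ring. Qed.

Lemma sqr_norm_le_dot2 u : `|u| ^+ 2 <= dot2 u u.
Proof.
have d0 : 0 <= dot2 u u by rewrite dot2E -!expr2 addr_ge0 ?sqr_ge0.
suff h : `|u| <= Num.sqrt (dot2 u u).
  by rewrite -[leRHS]sqr_sqrtr // ler_pXn2r ?nnegrE ?sqrtr_ge0.
apply: mx_norm_leP; first exact: sqrtr_ge0.
move=> i j; rewrite ord1 -sqrtr_sqr ler_wsqrtr // dot2E -!expr2.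
have [->|->] : i = 0 \/ i = 1 by case: i => -[|[|]] // ?; [left|right]; apply: val_inj.
  by rewrite lerDl sqr_ge0.
by rewrite lerDr sqr_ge0.
Qed.

(** A vector within a cone around the direction of [u] is controlled by its
    coordinate along [u]. *)
Lemma dot2_ge_cone u c : `|cross u c| <= `|u| / 2 * `|c| -> `|u| / 2 * `|c| <= `|dot2 u c|.
Proof.
have c0 : 0 <= `|u| / 2 * `|c| by rewrite !mulr_ge0 ?invr_ge0.
move=> h; rewrite -ler_sqr ?nnegrE //.
rewrite real_normK ?num_real //.
have -> : dot2 u c ^+ 2 = dot2 u u * dot2 c c - cross u c ^+ 2.
  by rewrite -dot_cross_sqr addrK.
have h1 : cross u c ^+ 2 <= (`|u| / 2 * `|c|) ^+ 2.
  by rewrite -[leLHS]real_normK ?num_real // ler_sqr ?nnegrE.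
have h2 : `|u| ^+ 2 * `|c| ^+ 2 <= dot2 u u * dot2 c c.
  by apply: ler_pM; rewrite ?sqr_ge0 ?sqr_norm_le_dot2.
have h3 : 0 <= `|u| ^+ 2 * `|c| ^+ 2 by rewrite mulr_ge0 ?sqr_ge0.
have e : (`|u| / 2 * `|c|) ^+ 2 = (`|u| ^+ 2 * `|c| ^+ 2) / 4 by field.
by move: h1 h2 h3; rewrite e; clear; lra.
Qed.

(** Iterating the matching of parameters, the point [phi s] moves along the arc
    in steps close to [eps *: X0] until it passes [phi t], and the sum of the
    steps is nearly parallel to [X0]. *)
Lemma slide_up (phi : R -> 'cV[R]_2) (al be : R -> R) Z (X0 : 'cV[R]_2)
    (eps e' eta B s t : R) :
  0 < eps -> X0 <> 0 -> 4 * e' <= `|X0| -> (forall p, `|phi p| <= B) ->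
  increasing01 al -> increasing01 be ->
  (forall p q, 0 <= p <= 1 -> 0 <= q <= 1 -> al q = be p ->
     phi q = phi p + aff_app Z (phi p) /\ `|p - q| < eta) ->
  0 <= s -> s < t -> t <= 1 ->
  (forall p, s <= p <= t -> exists2 q, 0 <= q <= 1 & al q = be p) ->
  (forall p, s <= p <= t -> `|aff_app Z (phi p) - eps *: X0| <= eps * e') ->
  al s < be s ->
  exists k v q, [/\ `|v - X0| <= e', 0 <= q <= 1, `|q - t| < eta & phi q - phi s = k *: v].
Proof.
move=> eps0 X00 e'X bphi mal mbe rel s0 st t1 exh near sup.
apply: contrapT => noQ.
have X0gt : 0 < `|X0| by rewrite normr_gt0; apply/eqP.
have e'0 : 0 <= e'.
  have := near s; rewrite lexx (ltW st) => /(_ isT) /(le_trans (normr_ge0 _)).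
  by rewrite pmulr_rge0.
(* After j steps the average step, divided by eps, is some v near X0. *)
have iter (j : nat) : exists p v, [/\ s <= p < t, al p < be p, `|v - X0| <= e'
    & phi p - phi s = (j%:R * eps) *: v].
  elim: j => [|j [p [v [/andP[sp pt] ap vX pv]]]].
    exists s, X0; split; rewrite ?lexx //; first by rewrite subrr normr0.
    by rewrite mul0r scale0r subrr.
  have pI : s <= p <= t by rewrite sp ltW.
  have pI1 : 0 <= p <= 1 by rewrite (le_trans s0) //= (le_trans (ltW pt)).
  have [q qI aq] := exh p pI.
  have [pq dpq] := rel _ _ pI1 qI aq.
  have ltpq : p < q.
    rewrite ltNge; apply/negP; rewrite le_eqVlt => /orP[/eqP e|qp].
      by move: ap; rewrite -aq e ltxx.
    have /andP[q0 _] := qI; have /andP[_ p1] := pI1.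
    by have := mal _ _ q0 qp p1; rewrite aq => /(lt_trans ap); rewrite ltxx.
  pose w := eps^-1 *: aff_app Z (phi p).
  have wX : `|w - X0| <= e'.
    have -> : w - X0 = eps^-1 *: (aff_app Z (phi p) - eps *: X0).
      by rewrite scalerBr scalerA mulVf ?gt_eqF // scale1r.
    by rewrite normrZ normfV gtr0_norm // ler_pdivrMl // near.
  pose v' := j.+1%:R^-1 *: (j%:R *: v + w).
  have jn0 : j.+1%:R != 0 :> R by rewrite pnatr_eq0.
  have v'X : `|v' - X0| <= e'.
    have -> : v' - X0 = j.+1%:R^-1 *: (j%:R *: (v - X0) + (w - X0)).
      rewrite /v' -{1}[X0](scalerK jn0) -scalerBr; congr (_ *: _).
      by rewrite scalerBr -natr1 scalerDl scale1r opprD addrACA.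
    rewrite normrZ normfV normr_nat ler_pdivrMl ?ltr0n //.
    rewrite (le_trans (ler_normD _ _)) // normrZ normr_nat -natr1 mulrDl mul1r.
    by apply: lerD => //; rewrite ler_wpM2l.
  have qv' : phi q - phi s = (j.+1%:R * eps) *: v'.
    rewrite pq addrAC pv /v' scalerA mulrAC divff // mul1r scalerDr scalerA.
    by rewrite (mulrC eps) /w scalerA divff ?gt_eqF // scale1r.
  have [tq|qt] := leP t q.
    exfalso; apply: noQ; exists (j.+1%:R * eps), v', q; split=> //.
    rewrite ger0_norm ?subr_ge0 //; apply: le_lt_trans dpq.
    by rewrite distrC gtr0_norm ?subr_gt0 // lerD2l lerN2 ltW.
  exists q, v'; split=> //; first by rewrite qt (le_trans sp) // ltW.
  have /andP[p0 _] := pI1; have /andP[_ q1] := qI.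
  by rewrite aq; apply: mbe.
(* The progress along X0 is at least j * eps * |X0|^2 / 2, but the arc is
   bounded. *)
pose A := 4 * (`|X0| * B) / (eps * (`|X0| ^+ 2 / 2)).
have [p [v [_ _ vX pv]]] := iter (Num.truncn A).+1.
have den0 : 0 < eps * (`|X0| ^+ 2 / 2) by rewrite mulr_gt0 // divr_gt0 // exprn_gt0.
have : 4 * (`|X0| * B) < (Num.truncn A).+1%:R * (eps * (`|X0| ^+ 2 / 2)).
  by rewrite -ltr_pdivrMr // truncnS_gt.
apply/negP; rewrite -leNgt.
have ub : `|dot2 X0 (phi p - phi s)| <= 4 * (`|X0| * B).
  rewrite (le_trans (dot2_le _ _)) //.
  have h : `|phi p - phi s| <= B + B.
    by rewrite (le_trans (ler_normB _ _)) // lerD.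
  have -> : 4 * (`|X0| * B) = 2 * (`|X0| * (B + B)) by ring.
  by rewrite ler_pM2l // ler_wpM2l.
apply: le_trans ub; apply: le_trans (ler_norm _).
rewrite pv dot2Zr -mulrA ler_wpM2l ?ler0n // ler_wpM2l ?(ltW eps0) //.
have -> : v = X0 + (v - X0) by rewrite addrC subrK.
rewrite dot2Dr.
have h1 := sqr_norm_le_dot2 X0.
have h2 : - (`|X0| ^+ 2 / 2) <= dot2 X0 (v - X0).
  rewrite lerNl (le_trans (ler_norm _)) // normrN (le_trans (dot2_le _ _)) //.
  have : `|v - X0| <= `|X0| / 4.
    by rewrite (le_trans vX) // ler_pdivlMr // mulrC.
  move=> h; rewrite -ler_pdivlMl // (le_trans (ler_wpM2l (ltW X0gt) h)) //.
  by rewrite expr2; lra.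
by move: h1 h2; clear; lra.
Qed.

Lemma ivt_le (f : R -> R) (a b v : R) : continuous f -> a <= b ->
  f a <= v <= f b -> exists2 c, a <= c <= b & f c = v.
Proof.
move=> cf ab /andP[h1 h2].
have [|c cI fc] := @IVT R f a b v ab (continuous_subspaceT cf).
  by rewrite ge_min le_max h1 h2 orbT.
by exists c => //; move: cI; rewrite in_itv.
Qed.

Lemma ivt_ge (f : R -> R) (a b v : R) : continuous f -> a <= b ->
  f b <= v <= f a -> exists2 c, a <= c <= b & f c = v.
Proof.
move=> cf ab /andP[h1 h2].
have [|c cI fc] := @IVT R f a b v ab (continuous_subspaceT cf).
  by rewrite ge_min le_max h1 h2 orbT.
by exists c => //; move: cI; rewrite in_itv.
Qed.

Lemma increasing01_le (a : R -> R) (s t : R) : increasing01 a ->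
  0 <= s -> s <= t -> t <= 1 -> a s <= a t.
Proof.
by move=> ma s0; rewrite le_eqVlt => /orP[/eqP ->//|st t1]; rewrite ltW // ma.
Qed.

Lemma increasing01_lt (a : R -> R) (s t : R) : increasing01 a ->
  0 <= t -> s <= 1 -> a s < a t -> s < t.
Proof.
move=> ma t0 s1 h; rewrite ltNge; apply/negP => ts.
by have := increasing01_le ma t0 ts s1; rewrite leNgt h.
Qed.

(** An unmatched parameter lies beyond the range of [al], and by continuity a
    parameter before or after it is matched with an end point; since matched
    parameters are close, it lies near that end point. *)
Lemma window_matching (al be : R -> R) (eta : R) :
  continuous al -> continuous be -> increasing01 al -> increasing01 be ->
  (forall p q, 0 <= p <= 1 -> 0 <= q <= 1 -> al q = be p -> `|p - q| < eta) ->
  (exists p q, [/\ 0 <= p <= 1, 0 <= q <= 1 & al q = be p]) ->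
  forall p, 0 <= p -> p <= 1 -> eta <= p -> p <= 1 - eta ->
  exists2 q, 0 <= q <= 1 & al q = be p.
Proof.
move=> cal cbe mal mbe close [p' [q' [/andP[p'0 p'1] /andP[q'0 q'1] e]]] p p0 p1 etap p1eta.
have I0 : 0 <= (0 : R) <= 1 by rewrite lexx ler01.
have I1 : 0 <= (1 : R) <= 1 by rewrite ler01 lexx.
have [h0|h0] := leP (al 0) (be p); last first.
  have h : be p < be p' by rewrite -e (lt_le_trans h0) // increasing01_le.
  have pp' := increasing01_lt mbe p'0 p1 h.
  have [|p2 /andP[h1 h2] e2] := @ivt_le be p p' (al 0) cbe (ltW pp').
    by rewrite (ltW h0) -e increasing01_le.
  have p2I : 0 <= p2 <= 1 by rewrite (le_trans p0) //= (le_trans h2).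
  have := close _ _ p2I I0 (esym e2); rewrite subr0 ger0_norm ?(le_trans p0) //.
  by move/(le_lt_trans h1)/(le_lt_trans etap); rewrite ltxx.
have [h1|h1] := leP (be p) (al 1).
  by apply: ivt_le => //; rewrite h0 h1.
have h : be p' < be p by rewrite -e (le_lt_trans _ h1) // increasing01_le.
have pp' := increasing01_lt mbe p0 p'1 h.
have [|p2 /andP[h2 h3] e2] := @ivt_le be p' p (al 1) cbe (ltW pp').
  by rewrite (ltW h1) -e increasing01_le.
have p21 : p2 <= 1 by exact: le_trans p1.
have p2I : 0 <= p2 <= 1 by rewrite (le_trans p'0) //= p21.
have := close _ _ p2I I1 (esym e2); rewrite distrC ger0_norm ?subr_ge0 //.
by move: h3 p1eta; clear; lra.
Qed.

(** The displacement has no fixed point on the subarc, so all its parameters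
    move in the same direction. *)
Lemma slide_along (phi : R -> 'cV[R]_2) (al be : R -> R) Z (X0 : 'cV[R]_2)
    (eps e' eta B s t : R) :
  0 < eps -> 0 < eta -> X0 <> 0 -> 4 * e' <= `|X0| -> (forall p, `|phi p| <= B) ->
  continuous al -> continuous be ->
  increasing01 al -> increasing01 be ->
  (forall p q, 0 <= p <= 1 -> 0 <= q <= 1 -> al q = be p ->
     phi q = phi p + aff_app Z (phi p) /\ `|p - q| < eta) ->
  0 <= s -> s < t -> t <= 1 ->
  (forall p, s <= p <= t -> exists2 q, 0 <= q <= 1 & al q = be p) ->
  (forall p, s <= p <= t -> `|aff_app Z (phi p) - eps *: X0| <= eps * e') ->
  exists k v p q, [/\ `|v - X0| <= e', 0 <= p <= 1 /\ 0 <= q <= 1, `|p - s| < eta,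
    `|q - t| < eta & phi q - phi p = k *: v].
Proof.
move=> eps0 eta0 X00 e'X bphi cal cbe mal mbe rel s0 st t1 exh near.
have X0gt : 0 < `|X0| by rewrite normr_gt0; apply/eqP.
have nofix p : s <= p <= t -> al p <> be p.
  move=> pI e.
  have pI1 : 0 <= p <= 1.
    by case/andP: pI => sp pt; rewrite (le_trans s0) //= (le_trans pt).
  have [] := rel p p pI1 pI1 e; rewrite -[LHS]addr0 => /addrI Z0 _.
  have := near p pI; rewrite -Z0 sub0r normrN normrZ gtr0_norm // ler_pM2l //.
  by move: e'X X0gt; clear; lra.
have tI : 0 <= t <= 1 by rewrite t1 (le_trans s0) // ltW.
have sI : 0 <= s <= 1 by rewrite s0 (le_trans (ltW st)).
case: (ltgtP (al s) (be s)) => [sup|sdown|/nofix[]]; last by rewrite lexx ltW.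
  have [k [v [q [vX qI qt e]]]] :=
    slide_up eps0 X00 e'X bphi mal mbe rel s0 st t1 exh near sup.
  by exists k, v, s, q; split=> //; rewrite subrr normr0.
have tdown : be t < al t.
  rewrite ltNge; apply/negP => h.
  have cd : continuous (be \- al) by move=> x; apply: cvgB; [exact: cbe|exact: cal].
  have [|p pI /eqP] := @ivt_le _ s t 0 cd (ltW st).
    by rewrite /= subr_ge0 h subr_le0 ltW.
  by rewrite /= subr_eq0 eq_sym => /eqP/(nofix _ pI).
(* Reversing the parameter turns downward motion into upward motion. *)
have flip (p : R) : 0 <= p <= 1 -> 0 <= 1 - p <= 1 by clear; lra.
have m1 (a : R -> R) : increasing01 a -> increasing01 (fun p => - a (1 - p)).
  by move=> ma p q p0 pq q1; rewrite ltrN2; apply: ma; lra.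
have inw (p : R) : 1 - t <= p <= 1 - s -> s <= 1 - p <= t by clear; lra.
have [||||||||k [v [q [vX qI qt e]]]] :=
    @slide_up (fun p => phi (1 - p)) (fun p => - al (1 - p)) (fun p => - be (1 - p))
    Z X0 eps e' eta B (1 - t) (1 - s) eps0 X00 e'X _ (m1 _ mal) (m1 _ mbe).
- by move=> p; exact: bphi.
- move=> p q pI qI /oppr_inj e.
  have [-> h] := rel _ _ (flip _ pI) (flip _ qI) e; split=> //.
  by move: h; rewrite -normrN; congr (`|_| < _); ring.
- by rewrite subr_ge0.
- by rewrite ltrD2l ltrN2.
- by rewrite lerBlDr lerDl.
- move=> p /inw/exh[q qI e]; exists (1 - q); first exact: flip.
  by rewrite opprB addrC subrK e.
- by move=> p /inw/near.
- by rewrite opprB addrC subrK ltrN2.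
exists (- k), v, (1 - q), t; split=> //.
- by split=> //; exact: flip.
- by move: qt; rewrite -normrN; congr (`|_| < _); ring.
- by rewrite subrr normr0.
- by rewrite scaleNr -e opprB subKr.
Qed.

End Slide.

Section Increments.
Variable R : realType.

Lemma le0_of_small_multiples (x k : R) : (forall e, 0 < e -> x <= e * k) -> x <= 0.
Proof.
move=> h; rewrite leNgt; apply/negP => x0.
have k0 : 0 < `|k| + 1 by rewrite ltr_wpDl.
have := h _ (divr_gt0 x0 (mulr_gt0 (ltr0Sn R 1) k0)).
have : x / (2 * (`|k| + 1)) * k <= x / (2 * (`|k| + 1)) * (`|k| + 1).
  rewrite ler_pM2l ?divr_gt0 ?mulr_gt0 //.
  by rewrite (le_trans (ler_norm k)) // lerDl.
have -> : x / (2 * (`|k| + 1)) * (`|k| + 1) = x / 2 by field; rewrite gt_eqF.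
by move: x0; clear; lra.
Qed.

Lemma increment_le_of_local (F K : R -> R) (a b d e : R) : 0 < d ->
  (forall s t, a <= s -> s <= t -> t <= b -> K s <= K t) ->
  (forall s t, a <= s -> s <= t -> t <= b -> t - s < d -> `|F t - F s| <= e * (K t - K s)) ->
  a <= b -> `|F b - F a| <= e * (K b - K a).
Proof.
move=> d0 mK loc ab.
have d20 : 0 < d / 2 by rewrite divr_gt0.
have H (n : nat) t : a <= t -> t <= b -> t - a <= n%:R * (d / 2) ->
    `|F t - F a| <= e * (K t - K a).
  elim: n t => [|n IH] t at_ tb.
    rewrite mul0r subr_le0 => ta.
    have -> : t = a by apply/eqP; rewrite eq_le ta.
    by rewrite !subrr normr0 mulr0.
  rewrite -natr1 => tn.
  have [h|h] := ltP (t - a) d; first exact: loc.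
  have h1 : a <= t - d / 2 by move: h d20; clear; lra.
  have h2 : t - d / 2 <= t by move: d20; clear; lra.
  have h3 : t - d / 2 - a <= n%:R * (d / 2) by move: tn; clear; lra.
  have i1 := IH _ h1 (le_trans h2 tb) h3.
  have h4 : t - (t - d / 2) < d by move: d0; clear; lra.
  have i2 := loc _ _ h1 h2 tb h4.
  have -> : F t - F a = (F t - F (t - d / 2)) + (F (t - d / 2) - F a) by ring.
  rewrite (le_trans (ler_normD _ _)) //.
  by rewrite (le_trans (lerD i2 i1)) // -mulrDr subrKA.
apply: (H (Num.truncn ((b - a) / (d / 2))).+1) => //.
by rewrite -ler_pdivrMr // ltW // truncnS_gt.
Qed.

End Increments.

Section Tangent.
Variable R : realType.
Variable phi : R -> 'cV[R]_2.
Hypothesis cphi : continuous phi.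
Hypothesis iphi : {in `[0, 1] &, injective phi}.
Hypothesis phiT : forall t, exists2 s, 0 <= s <= 1 & phi s = phi t.
Implicit Types (X Z : field R).

(** Tangency in the strong sense: where [X] does not vanish, all short chords
    point along [X]. The condition is linear in [X], is preserved by pull-backs
    and limits, and is void where [X] vanishes. *)
Definition tangent_field X := forall e, 0 < e -> exists2 d, 0 < d &
  forall s t, 0 <= s <= 1 -> 0 <= t <= 1 -> `|s - t| < d ->
  `|cross (aff_app X (phi s)) (phi t - phi s)| <= e * `|phi t - phi s|.

Lemma tangent_fieldZ (a : R) X : tangent_field X -> tangent_field (a *: X).
Proof.
move=> tX e e0.
have C0 : 0 < `|a| + 1 by rewrite ltr_wpDl.
have [d d0 H] := tX _ (divr_gt0 e0 C0); exists d => // s t sI tI st.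
rewrite aff_appZf crossZl normrM.
apply: le_trans (ler_wpM2l (normr_ge0 a) (H s t sI tI st)) _.
rewrite mulrA ler_wpM2r // mulrCA -[leRHS]mulr1 ler_pM2l //.
by rewrite ler_pdivrMr // mul1r lerDl.
Qed.

Lemma tangent_field_closed X :
  (forall e, 0 < e -> exists2 X', tangent_field X' & `|X' - X| < e) -> tangent_field X.
Proof.
move=> cl e e0; have [B B1 bphi] := phi_bounded cphi phiT.
have C0 : 0 < 4 * (2 * B + 1) by move: B1; lra.
have [X' tX' XX'] := cl _ (divr_gt0 e0 C0).
have [d d0 H] := tX' _ (divr_gt0 e0 (ltr0Sn R 1)); exists d => // s t sI tI st.
have -> : aff_app X (phi s) = aff_app X' (phi s) - aff_app (X' - X) (phi s).
  by rewrite -aff_appBf opprB addrC subrK.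
rewrite crossBl (le_trans (ler_normB _ _)) //.
have := H s t sI tI st; have : `|cross (aff_app (X' - X) (phi s)) (phi t - phi s)| <=
    e / 2 * `|phi t - phi s|.
  rewrite (le_trans (cross_le _ _)) // mulrA ler_wpM2r //.
  have h : `|aff_app (X' - X) (phi s)| <= e / (4 * (2 * B + 1)) * (2 * B + 1).
    rewrite (le_trans (aff_app_le _ _)) //; apply: ler_pM; rewrite ?addr_ge0 ?mulr_ge0 //.
      exact: ltW.
    by rewrite lerD2r ler_pM2l.
  have -> : e / 2 = 2 * (e / (4 * (2 * B + 1)) * (2 * B + 1)).
    by field; move: B1; lra.
  by rewrite ler_pM2l.
lra.
Qed.

Lemma tangent_field_pull X (S : affine R) : aff_nondegenerate S ->
  (forall t, exists2 s, 0 <= s <= 1 & phi s = aff_app S (phi t)) ->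
  tangent_field X -> tangent_field (pull S X).
Proof.
move=> uS HS tX e e0.
have [a [ca aI aS _]] := induced_parameter_map cphi iphi uS HS.
have dS : 0 < `|\det S.1|.
  by rewrite normr_gt0 -unitfE -unitmxE.
pose C := 2 * `|S.1| + 1.
have C0 : 0 < C by rewrite ltr_wpDl // mulr_ge0.
have e'0 : 0 < e * `|\det S.1| / C by rewrite divr_gt0 // mulr_gt0.
have [d' d'0 H] := tX _ e'0.
have [d1 d10 H1] := phi_inv_uc cphi iphi d'0.
have [d d0 H2] := phi_uc cphi (divr_gt0 d10 C0).
exists d => // s t sI tI st.
rewrite -(ler_pM2l dS) -normrM -cross_mul pull_app mulmxA mulmxV // mul1mx -aS.
have SB : S.1 *m (phi t - phi s) = phi (a t) - phi (a s) by rewrite !aS aff_appB.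
have SL : `|phi (a t) - phi (a s)| <= C * `|phi t - phi s|.
  rewrite -SB (le_trans (mulmx_le _ _)) // mulrA ler_wpM2r // /C.
  by rewrite lerDl.
rewrite SB.
have h : `|a s - a t| < d'.
  apply: H1 => //; rewrite distrC (le_lt_trans SL) //.
  by have := H2 _ _ sI tI st; rewrite distrC ltr_pdivlMr // mulrC.
apply: le_trans (H _ _ (aI s) (aI t) h) _.
apply: (le_trans (ler_wpM2l (ltW e'0) SL)).
rewrite le_eqVlt; apply/orP; left; apply/eqP; field.
by rewrite gt_eqF.
Qed.

(** Near [t0] the coordinate along [X] is a monotone parameter of the arc, and
    the increments of the Hamiltonian are negligible compared with those of
    this coordinate. *)
Lemma tangent_field_ham_const X t0 : tangent_field X -> \tr X.1 = 0 ->
  0 <= t0 <= 1 -> aff_app X (phi t0) <> 0 ->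
  exists2 d, 0 < d & forall s t, 0 <= s <= 1 -> 0 <= t <= 1 ->
    `|s - t0| <= d -> `|t - t0| <= d -> ham X (phi s) = ham X (phi t).
Proof.
move=> tX trX t0I /eqP X0n0; pose X0 := aff_app X (phi t0).
have X00 : 0 < `|X0| by rewrite normr_gt0.
pose m := `|X0| / 2.
have m0 : 0 < m by rewrite divr_gt0.
have [d1 d10 H1] := tX _ (divr_gt0 m0 (ltr0Sn R 1)).
have C0 : 0 < 2 * `|X| + 1 by rewrite ltr_wpDl // mulr_ge0.
have [d2 d20 H2] := phi_cvg cphi t0 (divr_gt0 (divr_gt0 m0 (ltr0Sn R 3)) C0).
pose d := Num.min (d1 / 3) (d2 / 2).
have d0 : 0 < d by rewrite lt_min !divr_gt0.
have dd1 : d <= d1 / 3 by rewrite ge_min lexx.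
have dd2 : d <= d2 / 2 by rewrite ge_min lexx orbT.
have cone s t : 0 <= s <= 1 -> 0 <= t <= 1 -> `|s - t0| <= d -> `|t - t0| <= d ->
    m * `|phi t - phi s| <= `|dot2 X0 (phi t) - dot2 X0 (phi s)|.
  move=> sI tI sd td; rewrite -dot2Br; apply: dot2_ge_cone.
  have st : `|s - t| < d1.
    have := ler_distD t0 s t; rewrite (distrC t0 t).
    by move: sd td dd1 d10; lra.
  have -> : X0 = aff_app X (phi s) - (aff_app X (phi s) - X0) by rewrite subKr.
  rewrite crossBl subKr (le_trans (ler_normB _ _)) //.
  have h1 := H1 s t sI tI st.
  have h2 : `|aff_app X (phi s) - X0| <= m / 4.
    rewrite (le_trans (aff_app_lip X _ _)) //.
    have : `|s - t0| < d2 by move: sd dd2 d20; lra.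
    move/H2; rewrite ltr_pdivlMr // => /ltW; apply: le_trans.
    by rewrite mulrC ler_wpM2l // lerDl.
  have h3 : `|cross (aff_app X (phi s) - X0) (phi t - phi s)| <= m / 2 * `|phi t - phi s|.
    rewrite (le_trans (cross_le _ _)) // mulrA ler_wpM2r //.
    by move: h2; lra.
  apply: le_trans (lerD h1 h3) _.
  by rewrite -mulrDl -splitr.
pose a := Num.max 0 (t0 - d); pose b := Num.min 1 (t0 + d).
have /andP[t0ge t0le] := t0I.
have memE s : a <= s -> s <= b -> 0 <= s <= 1 /\ `|s - t0| <= d.
  rewrite ge_max le_min => /andP[h1 h2] /andP[h3 h4]; rewrite h1 h3; split=> //.
  by rewrite ler_norml; move: h2 h4; lra.
have memI s : 0 <= s <= 1 -> `|s - t0| <= d -> a <= s /\ s <= b.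
  case/andP=> h1 h2; rewrite ler_norml => /andP[h3 h4].
  by rewrite ge_max le_min h1 h2 /=; split; move: h3 h4; lra.
pose K t := dot2 X0 (phi t).
have cK : {within `[a, b], continuous K}.
  by apply: continuous_subspaceT; exact: dot_phi_continuous.
have iK : {in `[a, b] &, injective K}.
  move=> s t; rewrite !in_itv /= => /andP[sa sb] /andP[ta tb] e.
  have [sI sd] := memE _ sa sb; have [tI td] := memE _ ta tb.
  have := cone _ _ sI tI sd td; rewrite -/(K s) -/(K t) e subrr normr0.
  rewrite pmulr_rle0 // normr_le0 subr_eq0 => /eqP h.
  by apply: (phi_inj iphi).
have locH (e : R) : 0 < e -> exists2 d', 0 < d' & forall s t, a <= s -> s <= t -> t <= b ->
    t - s < d' -> `|ham X (phi t) - ham X (phi s)| <= e * `|K t - K s|.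
  move=> e0.
  have em0 : 0 < e * m by rewrite mulr_gt0.
  have C'0 : 0 < 4 * (`|X| + 1) by rewrite mulr_gt0 // ltr_wpDl.
  have [d3 d30 H3] := tX _ (divr_gt0 em0 (ltr0Sn R 1)).
  have [d4 d40 H4] := phi_uc cphi (divr_gt0 em0 C'0).
  exists (Num.min d3 d4); first by rewrite lt_min d30.
  move=> s t sa st tb; rewrite lt_min => /andP[h3 h4].
  have [sI sd] := memE _ sa (le_trans st tb); have [tI td] := memE _ (le_trans sa st) tb.
  have st' : `|s - t| = t - s by rewrite distrC ger0_norm // subr_ge0.
  rewrite -st' in h3 h4.
  have i3 := H3 _ _ sI tI h3; have i4 := H4 _ _ sI tI h4.
  apply: (@le_trans _ _ (e * (m * `|phi t - phi s|))); last first.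
    by rewrite ler_pM2l //; exact: cone.
  rewrite ham_diff // (le_trans (ler_normD _ _)) //.
  have i5 : `|2^-1 * cross (X.1 *m (phi t - phi s)) (phi t - phi s)| <=
      e * m / 2 * `|phi t - phi s|.
    rewrite normrM gtr0_norm ?invr_gt0 // ler_pdivrMl //.
    rewrite (le_trans (cross_le _ _)) // ler_pM2l // ler_wpM2r //.
    rewrite (le_trans (mulmx_le _ _)) //.
    move: i4; rewrite distrC ltr_pdivlMr // => /ltW i4.
    rewrite ler_pdivlMr //; apply: le_trans i4.
    have -> : 2 * (`|X.1| * `|phi t - phi s|) * 2 = `|phi t - phi s| * (4 * `|X.1|) by ring.
    by rewrite ler_wpM2l // ler_pM2l // (le_trans (field_norm1 X)) // lerDl.
  apply: le_trans (lerD i3 i5) _.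
  by rewrite le_eqVlt; apply/orP; left; apply/eqP; field.
have const s t : a <= s -> s <= t -> t <= b -> ham X (phi s) = ham X (phi t).
  move=> sa st tb; apply/eqP; rewrite eq_sym -subr_eq0 -normr_le0.
  have mem u v : s <= u -> u <= v -> v <= t -> u \in `[a, b] /\ v \in `[a, b].
    move=> su uv vt; rewrite !in_itv /= (le_trans sa su) (le_trans uv (le_trans vt tb)).
    by rewrite (le_trans sa (le_trans su uv)) (le_trans vt tb).
  case: (itv_continuous_inj_mono cK iK) => [/ltW_homo_in mK|/ltW_nhomo_in mK].
  - apply: (@le0_of_small_multiples _ _ (K t - K s)) => e /locH[d' d'0 Hd'].
    have mK' u v : s <= u -> u <= v -> v <= t -> K u <= K v.
      by move=> su uv vt; have [ui vi] := mem _ _ su uv vt; apply: mK.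
    apply: (@increment_le_of_local _ (fun t => ham X (phi t)) K s t d' e) => //.
    move=> u v su uv vt dv.
    have := Hd' _ _ (le_trans sa su) uv (le_trans vt tb) dv.
    by rewrite [`|K v - K u|]ger0_norm ?subr_ge0 ?mK'.
  - apply: (@le0_of_small_multiples _ _ (- K t - - K s)) => e /locH[d' d'0 Hd'].
    have mK' u v : s <= u -> u <= v -> v <= t -> - K u <= - K v.
      by move=> su uv vt; have [ui vi] := mem _ _ su uv vt; rewrite lerN2; apply: mK.
    apply: (@increment_le_of_local _ (fun t => ham X (phi t)) (fun t => - K t) s t d' e) => //.
    move=> u v su uv vt dv.
    have := Hd' _ _ (le_trans sa su) uv (le_trans vt tb) dv.
    have -> : `|K v - K u| = - K v - - K u; last by [].
    rewrite -normrN ger0_norm; first by ring.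
    by rewrite opprB subr_ge0 -lerN2 mK'.
exists d => // s t sI tI sd td.
have [sa sb] := memI _ sI sd; have [ta tb] := memI _ tI td.
by have [st|/ltW ts] := leP s t; [|symmetry]; apply: const.
Qed.

(** At a point where [X] is not small, displacements close to multiples of [X]
    slide one end of a short chord to the other. *)
Lemma tangent_field_of_slides X :
  (forall e, 0 < e -> exists (eps : R) Z (al be : R -> R),
     [/\ 0 < eps, `|Z - eps *: X| <= eps * e, continuous al /\ continuous be,
         increasing01 al /\ increasing01 be &
         (forall p q, 0 <= p <= 1 -> 0 <= q <= 1 -> al q = be p ->
            phi q = phi p + aff_app Z (phi p) /\ `|p - q| < e) /\
         exists p q, [/\ 0 <= p <= 1, 0 <= q <= 1 & al q = be p]]) ->
  tangent_field X.
Proof.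
move=> Hf e0 e00; have [B B1 bphi] := phi_bounded cphi phiT.
pose e' := e0 / 16.
have e'0 : 0 < e' by rewrite divr_gt0.
have C0 : 0 < 2 * `|X| + 1 by rewrite ltr_wpDl // mulr_ge0.
have e'20 : 0 < e' / 2 by rewrite divr_gt0.
have [d d0 Hd] := phi_uc cphi (divr_gt0 e'20 C0).
exists d => // s t sI tI st.
pose X0 := aff_app X (phi s); rewrite -/X0.
have [small|big] := leP `|X0| (e0 / 2).
  rewrite (le_trans (cross_le _ _)) // mulrA ler_wpM2r //.
  by move: small; lra.
have [->|sneqt] := eqVneq s t.
  by rewrite subrr /cross !mxE !mulr0 subrr normr0 mulr_ge0 // ltW.
have X00 : X0 <> 0 by move=> X00; move: big; rewrite X00 normr0; lra.
have e'X : 4 * e' <= `|X0| by rewrite /e'; move: big; lra.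
have XX0 p : 0 <= p <= 1 -> `|p - s| < d -> `|aff_app X (phi p) - X0| <= e' / 2.
  move=> pI ps; rewrite (le_trans (aff_app_lip X _ _)) //.
  have := Hd _ _ pI sI ps; rewrite ltr_pdivlMr // => /ltW; apply: le_trans.
  by rewrite mulrC ler_wpM2l // lerDl.
pose c := phi t - phi s.
have c0 : 0 < `|c|.
  rewrite normr_gt0 subr_eq0; apply/eqP => /(phi_inj iphi tI sI) ts.
  by move: sneqt; rewrite ts eqxx.
(* The parameters are moved away from the end points, where the matching may
   fail, at the cost of an error w. *)
have key w : 0 < w -> exists k v c', [/\ `|v - X0| <= e', c' = k *: v & `|c' - c| <= w].
  move=> w0.
  have w20 : 0 < w / 2 by rewrite divr_gt0.
  have [d1 d10 Hd1] := phi_uc cphi w20.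
  have B0 : 0 < 2 * B + 1 by move: B1; lra.
  pose l := Num.min s t; pose r := Num.max s t.
  have lr : 0 < r - l.
    by rewrite /l /r; case: (ltgtP s t) sneqt => // h _; rewrite subr_gt0.
  pose eta := Num.min (Num.min (d1 / 2) ((r - l) / 4)) (e' / 2 / (2 * B + 1)).
  have eta0 : 0 < eta by rewrite !lt_min !divr_gt0.
  have [eta1 eta2 eta3] : [/\ eta <= d1 / 2, eta <= (r - l) / 4 & eta <= e' / 2 / (2 * B + 1)].
    by split; rewrite !ge_min lexx ?orbT.
  have [eps [Z [al [be [eps0 ZX [cal cbe] [mal mbe] [rel ex]]]]]] := Hf _ eta0.
  have [l0 r1] : 0 <= l /\ r <= 1.
    by case/andP: sI => ? ?; case/andP: tI => ? ?; split; rewrite ?le_min ?ge_max; apply/andP.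
  have inlr p : l <= p <= r -> `|p - s| < d.
    move: st; rewrite /l /r ltr_norml => /andP[h1 h2].
    by case: (leP s t) => h /andP[h3 h4]; rewrite ltr_norml; apply/andP; split; lra.
  have near p : l <= p <= r -> `|aff_app Z (phi p) - eps *: X0| <= eps * e'.
    move=> pI.
    have pI1 : 0 <= p <= 1 by case/andP: pI => h1 h2; rewrite (le_trans l0) //= (le_trans h2).
    have -> : aff_app Z (phi p) - eps *: X0 =
        aff_app (Z - eps *: X) (phi p) + eps *: (aff_app X (phi p) - X0).
      by rewrite -aff_appBf aff_appZf scalerBr subrKA.
    rewrite (le_trans (ler_normD _ _)) //.
    have -> : eps * e' = eps * (e' / 2) + eps * (e' / 2) by rewrite -mulrDr -splitr.
    apply: lerD; last by rewrite normrZ gtr0_norm // ler_pM2l // XX0 // inlr.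
    rewrite (le_trans (aff_app_le _ _)) //.
    apply: (@le_trans _ _ (eps * eta * (2 * B + 1))).
      by apply: ler_pM => //; rewrite ?addr_ge0 ?mulr_ge0 // lerD2r ler_pM2l.
    by rewrite -mulrA ler_pM2l // -ler_pdivlMr.
  pose l' := Num.max l eta; pose r' := Num.min r (1 - eta).
  have ll' : l <= l' by rewrite le_max lexx.
  have r'r : r' <= r by rewrite ge_min lexx.
  have etal' : eta <= l' by rewrite le_max lexx orbT.
  have r'eta : r' <= 1 - eta by rewrite ge_min lexx orbT.
  have l'l : l' <= l + eta by rewrite ge_max lerDl lerDr l0 ltW.
  have rr' : r - eta <= r' by rewrite le_min gerBl (ltW eta0) lerD2r r1.
  have l'r' : l' < r' by move: l'l rr' eta2 lr; lra.
  have r'1 : r' <= 1 by exact: le_trans r1.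
  have l'0 : 0 <= l' by exact: le_trans ll'.
  have [||k [v [p [q [vX [pI qI] pl qr e]]]]] := @slide_along R phi al be Z X0 eps e' eta B l' r'
    eps0 eta0 X00 e'X bphi cal cbe mal mbe rel l'0 l'r' r'1.
  - move=> p /andP[p1 p2]; apply: (@window_matching _ al be eta) => //.
    + by move=> p' q' p'I q'I /(rel _ _ p'I q'I)[].
    + exact: le_trans p1.
    + exact: le_trans r'1.
    + exact: le_trans p1.
    + exact: le_trans r'eta.
  - by move=> p /andP[p1 p2]; apply: near; rewrite (le_trans ll') // (le_trans p2).
  have lI : 0 <= l <= 1 by rewrite l0 (le_trans _ r1) // -subr_ge0 ltW.
  have rI : 0 <= r <= 1 by rewrite r1 (le_trans l0) // -subr_ge0 ltW.
  have pl1 : `|p - l| < d1.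
    have := ler_distD l' p l; rewrite [`|l' - l|]ger0_norm ?subr_ge0 //.
    by move: pl l'l eta1; lra.
  have qr1 : `|q - r| < d1.
    have := ler_distD r' q r; rewrite [`|r' - r|]distrC [`|r - r'|]ger0_norm ?subr_ge0 //.
    by move: qr rr' eta1; lra.
  have hp := Hd1 _ _ pI lI pl1; have hq := Hd1 _ _ qI rI qr1.
  have fin : `|(phi q - phi p) - (phi r - phi l)| <= w.
    have -> : (phi q - phi p) - (phi r - phi l) = (phi q - phi r) - (phi p - phi l).
      by rewrite !opprB addrACA [RHS]addrACA; congr (_ + _); rewrite addrC.
    by rewrite (le_trans (ler_normB _ _)) //; move: hp hq; lra.
  move: fin; rewrite /l /r; case: (leP s t) => _ fin.
    by exists k, v, (phi q - phi p).
  exists (- k), v, (- (phi q - phi p)); split=> //; first by rewrite e scaleNr.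
  by move: fin; rewrite (opprB (phi s)) -/c => fin; rewrite -normrN opprD !opprK.
have D0 : 0 < e0 / 2 + 2 * `|X0| by rewrite ltr_wpDr ?mulr_ge0 // divr_gt0.
have [k [v [c' [vX c'E c'c]]]] := key _ (divr_gt0 (mulr_gt0 (divr_gt0 e00 (ltr0Sn R 1)) c0) D0).
have h1 : `|cross X0 c'| <= e0 / 2 * `|c'|.
  rewrite c'E crossZr normrM normrZ mulrCA ler_wpM2l //.
  have -> : cross X0 v = cross X0 (v - X0) by rewrite crossBr crossvv subr0.
  rewrite (le_trans (cross_le _ _)) //.
  have hv : `|X0| / 2 <= `|v|.
    have := ler_normB v (v - X0); rewrite subKr.
    by move: vX e'X normr_ge0; rewrite /e' => vX e'X _; lra.
  apply: (@le_trans _ _ (2 * (`|X0| * e'))); first by rewrite ler_pM2l // ler_wpM2l.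
  apply: (@le_trans _ _ (e0 / 2 * (`|X0| / 2))); first by rewrite /e'; nra.
  by rewrite ler_wpM2l // divr_ge0 // ltW.
have -> : cross X0 (phi t - phi s) = cross X0 c' - cross X0 (c' - c).
  by rewrite -crossBr subKr.
rewrite -/c (le_trans (ler_normB _ _)) //.
have h2 : `|cross X0 (c' - c)| <= 2 * (`|X0| * `|c' - c|) := cross_le _ _.
have h3 : `|c'| <= `|c| + `|c' - c| by rewrite -{1}[c'](subrK c) addrC ler_normD.
move: c'c; rewrite ler_pdivlMr // => c'c.
have h4 : e0 / 2 * `|c'| <= e0 / 2 * (`|c| + `|c' - c|).
  by rewrite ler_wpM2l // divr_ge0 // ltW.
have : e0 / 2 * `|c| + `|c' - c| * (e0 / 2 + 2 * `|X0|) <= e0 * `|c|.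
  by move: c'c; lra.
apply: le_trans; apply: le_trans (lerD (le_trans h1 h4) h2) _.
by rewrite le_eqVlt; apply/orP; left; apply/eqP; ring.
Qed.

End Tangent.

(** * Caps cannot be pushed off themselves *)


Section Crossing.
Variable R : realType.

Lemma last_crossing (h : R -> R) (a b c : R) : continuous h -> a <= b ->
  h a < c -> c < h b ->
  exists s, [/\ a <= s, s < b, h s = c & forall x, s < x -> x <= b -> c < h x].
Proof.
move=> ch ab hac chb.
pose A := [set x | a <= x <= b /\ h x <= c].
have Aa : A a by split; rewrite ?lexx ?ab // ltW.
have Aub : ubound A b by move=> x [/andP[]].
have supA : has_sup A by split; [exists a|exists b].
pose s := sup A.
have as_ : a <= s by apply: ub_le_sup => //; exists b.
have sb : s <= b by apply: ge_sup => //; exists a.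
have above x : s < x -> x <= b -> c < h x.
  move=> sx xb; rewrite ltNge; apply/negP => hx.
  have : x <= s by apply: ub_le_sup; [exists b|split; rewrite ?xb ?(le_trans as_ (ltW sx))].
  by rewrite leNgt sx.
have hsc : h s <= c.
  rewrite leNgt; apply/negP => chs.
  have e0 : 0 < h s - c by rewrite subr_gt0.
  have /cvgrPdist_lt/(_ _ e0)/nbhs_ballP[d d0 Hd] := ch s.
  have [x [/andP[ax xb] hx] sx] := sup_adherent d0 supA.
  have xs : x <= s by apply: ub_le_sup; [exists b|split; rewrite ?ax].
  have := Hd x; rewrite /ball /= ger0_norm ?subr_ge0 // => /(_ _)/ltr_normlW.
  move: sx; rewrite -/s => sx; have sxd : s - x < d by lra.
  by move=> /(_ sxd); lra.
have sltb : s < b.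
  by rewrite lt_neqAle sb andbT; apply/eqP => e; move: hsc; rewrite e leNgt chb.
exists s; split=> //; apply/eqP; rewrite eq_le hsc leNgt; apply/negP => hs.
have e0 : 0 < c - h s by rewrite subr_gt0.
have /cvgrPdist_lt/(_ _ e0)/nbhs_ballP[d d0 Hd] := ch s.
pose x := Num.min b (s + d / 2).
have sx : s < x by rewrite lt_min sltb ltrDl divr_gt0.
have xb : x <= b by rewrite ge_min lexx.
have xd : x <= s + d / 2 by rewrite ge_min lexx orbT.
have := Hd x; rewrite /ball /= distrC ger0_norm ?subr_ge0 ?(ltW sx) //.
have xd' : x - s < d by move: d0 xd; rewrite /=; clear; lra.
move=> /(_ xd'); rewrite distrC => /ltr_normlW.
by have := above x sx xb; clear; lra.
Qed.

Lemma first_crossing (h : R -> R) (a b c : R) : continuous h -> a <= b ->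
  h b < c -> c < h a ->
  exists s, [/\ a < s, s <= b, h s = c & forall x, a <= x -> x < s -> c < h x].
Proof.
move=> ch ab hbc cha.
have ch' : continuous (fun x => h (- x)).
  move=> x; apply: (@cvg_comp _ _ _ (fun y : R => - y) h _ (nbhs (- x))).
    exact: opp_continuous.
  exact: ch.
have [|||s [bs sa hs Hs]] := @last_crossing (fun x => h (- x)) (- b) (- a) c ch'.
- by rewrite lerN2.
- by rewrite opprK.
- by rewrite opprK.
exists (- s); split=> //; first by rewrite ltrNr.
  by rewrite lerNl.
by move=> x ax xs; have := Hs (- x); rewrite opprK; apply; rewrite ?lerN2 // ltrNr.
Qed.

Implicit Types (X Y Z : field R).

Lemma ham_lip Y (B : R) x y : \tr Y.1 = 0 -> `|x| <= B -> `|y| <= B ->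
  `|ham Y y - ham Y x| <= `|Y| * (8 * B + 2) * `|y - x|.
Proof.
move=> tY xB yB; rewrite ham_diff // (le_trans (ler_normD _ _)) //.
have h1 : `|cross (aff_app Y x) (y - x)| <= `|Y| * (4 * B + 2) * `|y - x|.
  rewrite (le_trans (cross_le _ _)) // mulrA ler_wpM2r //.
  have := aff_app_le Y x.
  have : `|Y| * (2 * `|x| + 1) <= `|Y| * (2 * B + 1) by rewrite ler_wpM2l // lerD2r ler_pM2l.
  by lra.
have h2 : `|2^-1 * cross (Y.1 *m (y - x)) (y - x)| <= `|Y| * (4 * B) * `|y - x|.
  rewrite normrM gtr0_norm ?invr_gt0 // ler_pdivrMl // (le_trans (cross_le _ _)) //.
  rewrite ler_pM2l // ler_wpM2r // (le_trans (mulmx_le _ _)) //.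
  have -> : `|Y| * (4 * B) = 2 * (`|Y| * (B + B)) by ring.
  rewrite ler_pM2l //; apply: ler_pM => //; first exact: field_norm1.
  by rewrite (le_trans (ler_normB _ _)) // lerD.
apply: le_trans (lerD h1 h2) _.
by rewrite le_eqVlt; apply/orP; left; apply/eqP; ring.
Qed.

Lemma ham_phi_continuous (phi : R -> 'cV[R]_2) Y :
  continuous phi -> continuous (fun t => ham Y (phi t)).
Proof.
move=> cphi; rewrite (_ : (fun t => _) = (fun t => cross Y.2 (phi t) +
    2^-1 * ((Y.1 0 0 * phi t 0 0 + Y.1 0 1 * phi t 1 0) * phi t 1 0 -
            (Y.1 1 0 * phi t 0 0 + Y.1 1 1 * phi t 1 0) * phi t 0 0))); last first.
  by apply/funext => t; rewrite /ham {2}/cross !mulmx2E.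
have cc := coord_phi_continuous cphi.
have lin (a b : R) : continuous (fun t => a * phi t 0 0 + b * phi t 1 0).
  by move=> t; apply: cvgD; apply: cvgM; (try exact: cvg_cst); exact: cc.
move=> t; apply: cvgD; first exact: cross_phi_continuous.
apply: cvgM; first exact: cvg_cst.
by apply: cvgB; apply: cvgM; (try exact: lin); exact: cc.
Qed.

(** The subarc over [a, b] is a cap standing on a level line of an invariant
    function of [id + Z]. The displaced cap stands on the same line, with base
    end points interlaced with those of the cap, so that the two cross. The
    crossing is detected by a parity and persists under perturbation. *)
Lemma cap_crossing (phi : R -> 'cV[R]_2) (X0 : 'cV[R]_2) Y Z (sg a b c : R) :
  continuous phi -> (forall t, exists2 s, 0 <= s <= 1 & phi s = phi t) ->
  \tr Y.1 = 0 -> `|sg| = 1 -> 0 <= a -> a < b -> b <= 1 ->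
  (forall x, ham Y (x + aff_app Z x) = ham Y x) ->
  sg * ham Y (phi a) = c -> sg * ham Y (phi b) = c ->
  (forall p, a < p -> p < b -> c < sg * ham Y (phi p)) ->
  0 < dot2 X0 (aff_app Z (phi a)) < `|dot2 X0 (phi b - phi a)| ->
  0 < dot2 X0 (aff_app Z (phi b)) < `|dot2 X0 (phi b - phi a)| ->
  exists2 eta, 0 < eta & forall Z', `|Z' - Z| < eta -> forall e, 0 < e ->
    exists p q, [/\ a <= p <= b, a <= q <= b,
      `|dot2 X0 (phi q - (phi p + aff_app Z' (phi p)))| < e &
      `|ham Y (phi q) - ham Y (phi p + aff_app Z' (phi p))| < e].
Proof.
move=> cphi phiT tY sg1 a0 ab b1 inv ha hb cap /andP[za0 zaD] /andP[zb0 zbD].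
have [B B1 bphi] := phi_bounded cphi phiT.
pose W1 p q := dot2 X0 (phi q) - dot2 X0 (phi p + aff_app Z (phi p)).
pose W2 p q := sg * ham Y (phi q) - sg * ham Y (phi p).
have aI : a <= a <= b by rewrite lexx ltW.
have bI : a <= b <= b by rewrite lexx ltW.
have W1aa : W1 a a < 0 by rewrite /W1 dot2Dr opprD addNKr oppr_lt0.
have W1bb : W1 b b < 0 by rewrite /W1 dot2Dr opprD addNKr oppr_lt0.
have W1ab : W1 a b = dot2 X0 (phi b - phi a) - dot2 X0 (aff_app Z (phi a)).
  by rewrite /W1 dot2Dr dot2Br opprD addrA.
have W1ba : W1 b a = - dot2 X0 (phi b - phi a) - dot2 X0 (aff_app Z (phi b)).
  by rewrite /W1 dot2Dr dot2Br opprD addrA opprB.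
have prod0 : W1 a b * W1 b a < 0.
  rewrite W1ab W1ba; move: zaD zbD za0 zb0.
  move: (dot2 X0 _) (dot2 X0 (aff_app Z (phi a))) (dot2 X0 (aff_app Z (phi b))) => D u v.
  have [D0|D0] := leP 0 D.
    rewrite ger0_norm // => h1 h2 h3 h4.
    by rewrite pmulr_rlt0 ?subr_gt0 //; move: D0 h4; clear; lra.
  rewrite ltr0_norm // => h1 h2 h3 h4.
  by rewrite nmulr_rlt0; move: h1 h2 h3 h4 D0; clear; lra.
have cG : continuous (fun p => dot2 X0 (phi p + aff_app Z (phi p))).
  have -> : (fun p => dot2 X0 (phi p + aff_app Z (phi p))) =
     (fun p => dot2 X0 (phi p) + (X0 0 0 * (Z.1 0 0 * phi p 0 0 + Z.1 0 1 * phi p 1 0 + Z.2 0 0)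
       + X0 1 0 * (Z.1 1 0 * phi p 0 0 + Z.1 1 1 * phi p 1 0 + Z.2 1 0))).
    by apply/funext => p; rewrite dot2Dr (dot2E X0 (aff_app _ _)) /aff_app !mxE !sum_ord2.
  have lin (u v w z : R) : continuous (fun t => z * (u * phi t 0 0 + v * phi t 1 0 + w)).
    move=> t; apply: cvgM; first exact: cvg_cst.
    apply: cvgD; last exact: cvg_cst.
    by apply: cvgD; apply: cvgM; (try exact: cvg_cst); exact: (coord_phi_continuous cphi).
  move=> p; apply: cvgD; first exact: (dot_phi_continuous cphi).
  by apply: cvgD; exact: lin.
have edge (k : R -> R) : continuous k -> k a != 0 -> k b != 0 ->
    exists2 mu, 0 < mu & forall p, a <= p <= b -> mu <= `|k p| \/ mu <= sg * ham Y (phi p) - c.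
  move=> ck ka kb.
  pose f p := Num.max `|k p| (sg * ham Y (phi p) - c).
  have cf : {within `[a, b], continuous f}.
    apply: continuous_subspaceT => p.
    apply: (@continuous_max R _ (fun p => `|k p|) (fun p => sg * ham Y (phi p) - c)).
      by apply: cvg_norm; exact: ck.
    apply: cvgB; last exact: cvg_cst.
    by apply: cvgM; [exact: cvg_cst|exact: ham_phi_continuous].
  have [p0 p0I min0] := EVT_min (ltW ab) cf.
  exists (f p0).
    rewrite lt_max normr_gt0; have : a <= p0 <= b by move: p0I; rewrite in_itv.
    rewrite !le_eqVlt => /andP[/orP[/eqP <-|h1] /orP[/eqP ->|h2]]; rewrite ?ka ?kb //.
    by rewrite subr_gt0 cap ?orbT.
  move=> p pI; have := min0 p; rewrite in_itv => /(_ pI).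
  by rewrite {2}/f le_max => /orP.
have [W1ab0 W1ba0] : W1 a b != 0 /\ W1 b a != 0.
  by split; apply/eqP => h0; move: prod0; rewrite h0 ?mul0r ?mulr0 ltxx.
have cK := @dot_phi_continuous R phi cphi X0.
have [mu1 mu10 E1] := edge (W1 a) (fun q => cvgB (cK q) (cvg_cst _)) (ltr0_neq0 W1aa) W1ab0.
have [mu2 mu20 E2] := edge (W1 b) (fun q => cvgB (cK q) (cvg_cst _)) W1ba0 (ltr0_neq0 W1bb).
have [mu3 mu30 E3] := edge (W1^~ a) (fun q => cvgB (cvg_cst _) (cG q)) (ltr0_neq0 W1aa) W1ba0.
have [mu4 mu40 E4] := edge (W1^~ b) (fun q => cvgB (cvg_cst _) (cG q)) W1ab0 (ltr0_neq0 W1bb).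
(* On each edge of the square one of the parameters is an end point of the
   base, and the level function of the other one has a sign; mu bounds the
   difference map away from the forbidden half-axes. *)
pose mu := Num.min (Num.min mu1 mu2) (Num.min mu3 mu4).
have mu0 : 0 < mu by rewrite !lt_min mu10 mu20 mu30.
have [muA muB muC muD] : [/\ mu <= mu1, mu <= mu2, mu <= mu3 & mu <= mu4].
  by split; rewrite !ge_min lexx ?orbT.
have EU p q : p = a \/ p = b -> a <= q <= b -> mu <= `|W1 p q| \/ mu <= W2 p q.
  move=> pab qI; have -> : W2 p q = sg * ham Y (phi q) - c.
    by case: pab => ->; rewrite /W2 ?ha ?hb.
  case: pab => ->; [case: (E1 q qI)|case: (E2 q qI)] => h; [left|right|left|right];
    exact: le_trans h.
have EL p q : q = a \/ q = b -> a <= p <= b -> mu <= `|W1 p q| \/ W2 p q <= - mu.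
  move=> qab pI; have -> : W2 p q = - (sg * ham Y (phi p) - c).
    by case: qab => ->; rewrite /W2 ?ha ?hb opprB.
  rewrite lerN2.
  case: qab => ->; [case: (E3 p pI)|case: (E4 p pI)] => h; [left|right|left|right];
    exact: le_trans h.
pose B2 := B + (`|Z| + 1) * (2 * B + 1).
pose L := `|Y| * (8 * B2 + 2) + 2 * `|X0| + 1.
have B20 : 0 <= B2 by rewrite /B2 addr_ge0 ?mulr_ge0 ?addr_ge0 //; move: B1; clear; lra.
have LY : 0 <= `|Y| * (8 * B2 + 2) by rewrite mulr_ge0 // addr_ge0 // mulr_ge0.
have L0 : 0 < L by rewrite ltr_wpDl // addr_ge0 // mulr_ge0.
have L1 : `|Y| * (8 * B2 + 2) <= L by rewrite /L -addrA lerDl addr_ge0 // mulr_ge0.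
have L2 : 2 * `|X0| <= L by rewrite /L addrAC lerDr addr_ge0.
have K0 : 0 < 2 * B + 1 by move: B1; clear; lra.
have lipK x y : `|dot2 X0 x - dot2 X0 y| <= L * `|x - y|.
  by rewrite -dot2Br (le_trans (dot2_le _ _)) // mulrA ler_wpM2r.
have lipF x y : `|x| <= B2 -> `|y| <= B2 -> `|sg * ham Y x - sg * ham Y y| <= L * `|x - y|.
  move=> xB yB; rewrite -mulrBr normrM sg1 mul1r.
  by rewrite (le_trans (ham_lip tY yB xB)) // ler_wpM2r.
have phiB2 p : `|phi p| <= B2.
  by rewrite (le_trans (bphi p)) // lerDl mulr_ge0 ?(ltW K0) // addr_ge0.
have movedB2 Z' p : `|Z' - Z| <= 1 -> `|phi p + aff_app Z' (phi p)| <= B2.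
  move=> h; rewrite (le_trans (ler_normD _ _)) // lerD // (le_trans (aff_app_le _ _)) //.
  apply: ler_pM; rewrite ?addr_ge0 ?mulr_ge0 // ?lerD2r ?ler_pM2l //.
  by rewrite -{1}[Z'](subrK Z) (le_trans (ler_normD _ _)) // addrC lerD2l.
pose eta := Num.min 1 (mu / 2 / (L * (2 * B + 1))).
have LK0 : 0 < L * (2 * B + 1) by rewrite mulr_gt0.
exists eta; first by rewrite lt_min ltr01 !divr_gt0.
move=> Z'; rewrite lt_min => /andP[/ltW Z'1].
rewrite ltr_pdivlMr // => Z'mu e e0.
pose V1 p q := dot2 X0 (phi q) - dot2 X0 (phi p + aff_app Z' (phi p)).
pose V2 p q := sg * ham Y (phi q) - sg * ham Y (phi p + aff_app Z' (phi p)).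
have moved p : `|(phi p + aff_app Z (phi p)) - (phi p + aff_app Z' (phi p))| <=
    `|Z' - Z| * (2 * B + 1).
  rewrite opprD addrACA subrr add0r distrC aff_appBf (le_trans (aff_app_le _ _)) //.
  by rewrite ler_wpM2l // lerD2r ler_pM2l.
have moved' p : L * `|(phi p + aff_app Z (phi p)) - (phi p + aff_app Z' (phi p))| <= mu / 2.
  by apply: le_trans (ltW Z'mu); rewrite mulrCA ler_pM2l.
have ZZ1 : `|Z - Z| <= 1 by rewrite subrr normr0.
have V1W p q : `|V1 p q - W1 p q| <= mu / 2.
  by rewrite /V1 /W1 opprB addrC subrKA (le_trans _ (moved' p)) //.
have V2W p q : `|V2 p q - W2 p q| <= mu / 2.
  rewrite /V2 /W2 -(inv (phi p)) opprB addrC subrKA (le_trans _ (moved' p)) //.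
  by apply: lipF; exact: movedB2.
have mu20' : 0 < mu / 2 by rewrite divr_gt0.
have near1 u v : `|u - v| <= mu / 2 -> mu <= `|v| -> mu / 2 <= `|u|.
  move=> h1 h2; have := ler_normB u (u - v); rewrite subKr.
  by move: h1 h2; clear; lra.
have corner p q : (p = a \/ p = b) -> (q = a \/ q = b) -> mu <= `|W1 p q|.
  move=> pab qab; have qI : a <= q <= b by case: qab => ->.
  have [//|] := EU p q pab qI.
  have -> : W2 p q = 0 by case: pab => ->; case: qab => ->; rewrite /W2 ?ha ?hb subrr.
  by rewrite leNgt mu0.
have neg p q : (p = a \/ p = b) -> (q = a \/ q = b) -> W1 p q < 0 -> V1 p q < 0.
  move=> pab qab; have := V1W p q; have := corner p q pab qab.
  move=> h1 h2 h3; move: h1; rewrite ltr0_norm //; move: h2; rewrite ler_norml.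
  by move=> /andP[_ h4]; move: h4 mu0; clear; lra.
have pos p q : (p = a \/ p = b) -> (q = a \/ q = b) -> 0 < W1 p q -> 0 < V1 p q.
  move=> pab qab; have := V1W p q; have := corner p q pab qab.
  move=> h1 h2 h3; move: h1; rewrite gtr0_norm //; move: h2; rewrite ler_norml.
  by move=> /andP[h4 _]; move: h4 mu0; clear; lra.
have LL0 : 0 < 2 * (L * (1 + (1 + 2 * `|Z'|))).
  by rewrite mulr_gt0 // mulr_gt0 // addr_gt0 // ltr_wpDr // mulr_ge0.
have [||||||p [q [pI qI h1 h2]]] := @odd_boundary_zero R a b V1 V2 (mu / 2) ab mu20' _ _ _ _ _ _ e e0.
- move=> e1 e10; have [d d0 Hd] := phi_uc cphi (divr_gt0 e10 LL0).
  exists d => // p p' q q' pI p'I qI q'I pp qq.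
  have inI r : a <= r <= b -> 0 <= r <= 1.
    by move=> /andP[r1 r2]; rewrite (le_trans a0 r1) (le_trans r2 b1).
  have := Hd _ _ (inI _ pI) (inI _ p'I) pp; rewrite ltr_pdivlMr // => dp.
  have := Hd _ _ (inI _ qI) (inI _ q'I) qq; rewrite ltr_pdivlMr // => dq.
  have gp : `|(phi p + aff_app Z' (phi p)) - (phi p' + aff_app Z' (phi p'))| <=
      (1 + 2 * `|Z'|) * `|phi p - phi p'|.
    rewrite opprD addrACA (le_trans (ler_normD _ _)) // mulrDl mul1r lerD2l.
    exact: aff_app_lip.
  have tot : L * `|phi q - phi q'| + L * ((1 + 2 * `|Z'|) * `|phi p - phi p'|) < e1.
    have n1 := normr_ge0 (phi p - phi p'); have n2 := normr_ge0 (phi q - phi q').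
    have n3 := normr_ge0 Z'.
    have : L * `|phi q - phi q'| <= (L * (1 + (1 + 2 * `|Z'|))) * `|phi q - phi q'|.
      by rewrite ler_wpM2r // ler_peMr ?(ltW L0) // lerDl; move: n3; clear; lra.
    have : L * ((1 + 2 * `|Z'|) * `|phi p - phi p'|) <=
        (L * (1 + (1 + 2 * `|Z'|))) * `|phi p - phi p'|.
      by rewrite -mulrA ler_pM2l // ler_wpM2r // lerDr.
    by move: dp dq; clear; lra.
  have four (u v u' v' : R) : `|(u - v) - (u' - v')| <= `|u - u'| + `|v - v'|.
    have -> : (u - v) - (u' - v') = (u - u') - (v - v') by ring.
    exact: ler_normB.
  have gp' : L * `|(phi p + aff_app Z' (phi p)) - (phi p' + aff_app Z' (phi p'))| <=
      L * ((1 + 2 * `|Z'|) * `|phi p - phi p'|) by rewrite ler_pM2l.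
  split; apply: le_lt_trans tot; apply: le_trans (four _ _ _ _) _; apply: lerD.
  + exact: lipK.
  + exact: le_trans (lipK _ _) gp'.
  + exact: lipF.
  + by apply: le_trans (lipF _ _ _ _) gp'; exact: movedB2.
- move=> p q pab qI; case: (EU p q pab qI) => h.
    by left; apply: near1 (V1W p q) h.
  by right; have := V2W p q; rewrite ler_norml => /andP[h1 _]; move: h1 h; clear; lra.
- move=> p q qab pI; case: (EL p q qab pI) => h.
    by left; apply: near1 (V1W p q) h.
  by right; have := V2W p q; rewrite ler_norml => /andP[_ h1]; move: h1 h; clear; lra.
- by apply: neg => //; left.
- by apply: neg => //; right.
- have ra : a = a \/ a = b by left.
  have rb : b = a \/ b = b by right.
  move: prod0; case: (ltgtP (W1 a b) 0) W1ab0 => // h _.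
    rewrite nmulr_rlt0 // => h'.
    by rewrite nmulr_rlt0; [exact: pos|exact: neg].
  by rewrite pmulr_rlt0 // => h'; rewrite pmulr_rlt0; [exact: neg|exact: pos].
exists p, q; split=> //; first by rewrite dot2Br.
by move: h2; rewrite /V2 -mulrBr normrM sg1 mul1r.
Qed.

End Crossing.

(** * Limits of displacing fields *)


Section Displaced.
Variable R : realType.
Implicit Types (X Y Z : field R).

Lemma monotone_of_no_bump (f : R -> R) (a b : R) :
  (forall s t u, a <= s -> s < t -> t < u -> u <= b ->
     (f t <= f s \/ f t <= f u) /\ (f s <= f t \/ f u <= f t)) ->
  (forall s t, a <= s -> s <= t -> t <= b -> f s <= f t) \/
  (forall s t, a <= s -> s <= t -> t <= b -> f t <= f s).
Proof.
wlog ab : f / f a <= f b.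
  move=> wl nb; have [ab|/ltW ba] := leP (f a) (f b); first exact: wl.
  have [||h|h] := wl (fun x => - f x).
  - by rewrite lerN2.
  - move=> s t u sa st tu ub; rewrite !lerN2.
    by have [h1 h2] := nb s t u sa st tu ub.
  - by right=> s t sa st tb; rewrite -lerN2; exact: h.
  - by left=> s t sa st tb; rewrite -lerN2; exact: h.
move=> nb; left.
have bet x : a <= x -> x <= b -> f a <= f x /\ f x <= f b.
  rewrite le_eqVlt => /orP[/eqP <-|ax]; first by [].
  rewrite le_eqVlt => /orP[/eqP ->|xb]; first by [].
  by have [[h1|h1] [h2|h2]] := nb a x b (lexx _) ax xb (lexx _); split=> //;
    first [exact: le_trans ab | exact: le_trans h2 | exact: le_trans h1 _].
move=> s t sa st tb; have [fat _] := bet t (le_trans sa st) tb.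
move: sa st; rewrite le_eqVlt => /orP[/eqP <- //|sa].
rewrite le_eqVlt => /orP[/eqP -> //|st].
have [[h|//] _] := nb a s t (lexx _) sa st tb.
exact: le_trans fat.
Qed.

(** Disjointness of the arc and its image is lost in a limit of maps; this
    condition is not. *)
Definition displaced (phi : R -> 'cV[R]_2) Z := forall e, 0 < e ->
  exists2 Z', `|Z' - Z| < e & forall p q, 0 <= p <= 1 -> 0 <= q <= 1 ->
    phi p + aff_app Z' (phi p) <> phi q.

Lemma hamZ (a : R) Z x : ham (a *: Z) x = a * ham Z x.
Proof. by rewrite /ham /= -scalemxAl !crossZl; ring. Qed.

Lemma hamB Y X x : ham Y x - ham X x = ham (Y - X) x.
Proof. by rewrite /ham /= mulmxBl !crossBl; ring. Qed.

Lemma ham_le Z x (B : R) : 1 <= B -> `|x| <= B -> `|ham Z x| <= `|Z| * (4 * B ^+ 2).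
Proof.
move=> B1 xB; rewrite /ham (le_trans (ler_normD _ _)) //.
have B0 : 0 <= B by exact: le_trans B1.
have BB : B <= B ^+ 2 by rewrite expr2 ler_peMr.
have h1 : `|cross Z.2 x| <= `|Z| * (2 * B ^+ 2).
  rewrite (le_trans (cross_le _ _)) // mulrCA; apply: ler_pM; rewrite ?mulr_ge0 ?field_norm2 //.
  by rewrite ler_pM2l // (le_trans xB).
have h2 : `|2^-1 * cross (Z.1 *m x) x| <= `|Z| * (2 * B ^+ 2).
  rewrite normrM gtr0_norm ?invr_gt0 // ler_pdivrMl // (le_trans (cross_le _ _)) //.
  rewrite ler_pM2l //; have -> : `|Z| * (2 * B ^+ 2) = (2 * (`|Z| * B)) * B by ring.
  apply: ler_pM => //; rewrite (le_trans (mulmx_le _ _)) // ler_pM2l //.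
  by apply: ler_pM => //; exact: field_norm1.
by apply: le_trans (lerD h1 h2) _; rewrite -mulrDr; apply: ler_wpM2l => //; clear; lra.
Qed.

(** The differential of the Hamiltonian of [Y] is the cross product with [Y];
    its variation over a ball of radius [r] and the quadratic remainder are
    both of order [r]. *)
Lemma ham_almost_linear X (x0 : 'cV[R]_2) : aff_app X x0 <> 0 ->
  exists r e, [/\ 0 < r, 0 < e, r <= 1, `|X| * r <= `|aff_app X x0| / 16 &
    forall Y x y, \tr Y.1 = 0 -> `|Y - X| <= e -> `|x - x0| <= r -> `|y - x0| <= r ->
    `|ham Y y - ham Y x - cross (aff_app X x0) (y - x)| <= `|aff_app X x0| / 4 * `|y - x|].
Proof.
move=> /eqP Xn0; set X0 := aff_app X x0.
have X00 : 0 < `|X0| by rewrite normr_gt0.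
have C0 : 0 < 2 * `|x0| + 3 by rewrite ltr_wpDl // mulr_ge0.
have D0 : 0 < `|X| + 1 by rewrite ltr_wpDl.
pose e := Num.min 1 (`|X0| / (16 * (2 * `|x0| + 3))).
pose r := Num.min 1 (`|X0| / (64 * (`|X| + 1))).
have e0 : 0 < e by rewrite lt_min ltr01 divr_gt0 // mulr_gt0.
have r0 : 0 < r by rewrite lt_min ltr01 divr_gt0 // mulr_gt0.
have r1 : r <= 1 by rewrite ge_min lexx.
have e1 : e <= 1 by rewrite ge_min lexx.
have e2 : e * (16 * (2 * `|x0| + 3)) <= `|X0|.
  by rewrite -ler_pdivlMr ?mulr_gt0 // ge_min lexx orbT.
have r2 : r * (64 * (`|X| + 1)) <= `|X0|.
  by rewrite -ler_pdivlMr ?mulr_gt0 // ge_min lexx orbT.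
have Xr0 : 0 <= `|X| * r by rewrite mulr_ge0 // ltW.
exists r, e; split=> //.
  by rewrite ler_pdivlMr //; move: r2 Xr0 r0; clear; lra.
move=> Y x y tY YX xr yr; rewrite ham_diff //.
have -> : cross (aff_app Y x) (y - x) + 2^-1 * cross (Y.1 *m (y - x)) (y - x) -
   cross X0 (y - x) = cross (aff_app Y x - X0) (y - x) +
   2^-1 * cross (Y.1 *m (y - x)) (y - x) by rewrite crossBl; ring.
have Yn : `|Y| <= `|X| + 1.
  rewrite -[Y](subrK X) (le_trans (ler_normD _ _)) // addrC lerD2l.
  exact: le_trans e1.
have xn : `|x| <= `|x0| + 1.
  rewrite -[x](subrK x0) (le_trans (ler_normD _ _)) // addrC lerD2l.
  exact: le_trans r1.
have dn : `|y - x| <= r + r.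
  have -> : y - x = (y - x0) - (x - x0) by rewrite opprB subrKA.
  by rewrite (le_trans (ler_normB _ _)) // lerD.
have YX0 : `|aff_app Y x - X0| <= e * (2 * `|x0| + 3) + 2 * (`|X| * r).
  have -> : aff_app Y x - X0 = aff_app (Y - X) x + (aff_app X x - aff_app X x0).
    by rewrite -aff_appBf subrKA.
  rewrite (le_trans (ler_normD _ _)) // lerD //.
    rewrite (le_trans (aff_app_le _ _)) //; apply: ler_pM; rewrite ?addr_ge0 ?mulr_ge0 //.
    by move: xn; clear; lra.
  rewrite (le_trans (aff_app_lip _ _ _)) // -mulrA ler_pM2l //.
  by rewrite ler_wpM2l.
rewrite (le_trans (ler_normD _ _)) //.
have h1 : `|cross (aff_app Y x - X0) (y - x)| <=
    2 * (e * (2 * `|x0| + 3) + 2 * (`|X| * r)) * `|y - x|.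
  by rewrite (le_trans (cross_le _ _)) // mulrA ler_wpM2r // ler_pM2l.
have h2 : `|2^-1 * cross (Y.1 *m (y - x)) (y - x)| <= 2 * ((`|X| + 1) * (r + r)) * `|y - x|.
  rewrite normrM gtr0_norm ?invr_gt0 // ler_pdivrMl // (le_trans (cross_le _ _)) //.
  rewrite ler_pM2l // ler_wpM2r // (le_trans (mulmx_le _ _)) // ler_pM2l //.
  by apply: ler_pM => //; exact: le_trans (field_norm1 Y) Yn.
apply: le_trans (lerD h1 h2) _; rewrite -mulrDl ler_wpM2r //.
rewrite ler_pdivlMr //.
by move: e2 r2 r0 Xr0; clear; lra.
Qed.

(** If the level function hardly changes along [d], then [d] lies in the cone
    around [X0]. *)
Lemma ham_dot_separation (X0 d : 'cV[R]_2) (h e : R) : X0 <> 0 ->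
  `|h - cross X0 d| <= `|X0| / 4 * `|d| -> `|h| <= e -> 4 * e <= `|X0| / 2 * `|d| ->
  `|X0| / 2 * `|d| <= `|dot2 X0 d|.
Proof.
move=> X00 h1 h2 h3; apply: dot2_ge_cone.
have := ler_normB h (h - cross X0 d); rewrite subKr => h4.
have h5 : 0 <= `|X0| * `|d| by rewrite mulr_ge0.
by move: h1 h2 h3 h4 h5; clear; lra.
Qed.

(** The correction term of the generator is quadratic in the displacement. *)
Lemma flow_generator_near X Z (l e : R) : 0 < l -> `|Z - l *: X| <= l * e -> e <= 1 ->
  `|l^-1 *: flow_generator Z - X| <= e + l * (`|X| + 1) ^+ 2.
Proof.
move=> l0 ZX e1.
have Zn : `|Z| <= l * (`|X| + 1).
  rewrite -[Z](subrK (l *: X)) (le_trans (ler_normD _ _)) // normrZ gtr0_norm //.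
  by rewrite mulrDr mulr1 addrC lerD2l (le_trans ZX) // ler_piMr // ltW.
have -> : l^-1 *: flow_generator Z - X = l^-1 *: (Z - l *: X)
    - (0, l^-1 *: (2^-1 *: (Z.1 *m Z.2))).
  apply: injective_projections => /=.
    rewrite -[RHS]/(_ - 0) subr0 scalerBr (scalerA _ l) mulVf ?gt_eqF //.
    by rewrite scale1r.
  by rewrite !scalerBr (scalerA _ l) mulVf ?gt_eqF // scale1r addrAC.
rewrite (le_trans (ler_normB _ _)) // lerD //.
  by rewrite normrZ normfV gtr0_norm // ler_pdivrMl.
rewrite aff_norm_le /= normr0; apply/andP; split.
  by rewrite mulr_ge0 ?sqr_ge0 // ltW.
rewrite !normrZ !normfV gtr0_norm // gtr0_norm //.
rewrite ler_pdivrMl // ler_pdivrMl // (le_trans (mulmx_le _ _)) // ler_pM2l //.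
have -> : l * (l * (`|X| + 1) ^+ 2) = (l * (`|X| + 1)) * (l * (`|X| + 1)) by ring.
by apply: ler_pM => //; [exact: le_trans (field_norm1 Z) Zn|exact: le_trans (field_norm2 Z) Zn].
Qed.

Lemma exists_small (cs : seq R) : all (fun c => 0 < c) cs ->
  exists2 e, 0 < e & all (fun c => e <= c) cs.
Proof.
elim: cs => [|c cs IH] /=; first by exists 1.
move=> /andP[c0 /IH[e e0 He]]; exists (Num.min c e); first by rewrite lt_min c0.
rewrite ge_min lexx /=; apply: sub_all He => x; apply: le_trans.
by rewrite ge_min lexx orbT.
Qed.

(** A bump of the Hamiltonian of [X] is a bump for the Hamiltonians of all
    nearby fields, and contains a cap whose base is long compared with the
    displacement; [cap_crossing] then contradicts that the arc can be displaced.
    The sign [sg] treats bumps above and below at once. *)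
Lemma no_bump (phi : R -> 'cV[R]_2) X t0 :
  continuous phi -> {in `[0, 1] &, injective phi} ->
  (forall t, exists2 s, 0 <= s <= 1 & phi s = phi t) ->
  0 <= t0 <= 1 -> aff_app X (phi t0) <> 0 ->
  (forall e, 0 < e -> exists Z (l : R), [/\ nilpotent_field Z, displaced phi Z,
     0 < l < e & `|Z - l *: X| <= l * e]) ->
  exists2 d, 0 < d & forall sg s t u, `|sg| = 1 ->
    0 <= s -> s < t -> t < u -> u <= 1 -> `|s - t0| <= d -> `|u - t0| <= d ->
    sg * ham X (phi s) < sg * ham X (phi t) ->
    sg * ham X (phi u) < sg * ham X (phi t) -> False.
Proof.
move=> cphi iphi phiT t0I Xn0 HZ.
have [B B1 bphi] := phi_bounded cphi phiT.
have [r [e1 [r0 e10 r1 Xr linear]]] := ham_almost_linear Xn0.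
set X0 := aff_app X (phi t0) in Xr linear Xn0 *.
have X00 : 0 < `|X0| by rewrite normr_gt0; apply/eqP.
have [d' d'0 Hd'] := phi_cvg cphi t0 (divr_gt0 r0 (ltr0Sn R 1)).
exists (d' / 2); first by rewrite divr_gt0.
move=> sg s t u sg1 s0 st tu u1 sd ud bump1 bump2.
have win p : s <= p -> p <= u -> [/\ 0 <= p <= 1 & `|phi p - phi t0| <= r / 2].
  move=> sp pu; split; first by rewrite (le_trans s0 sp) (le_trans pu u1).
  apply/ltW/Hd'; move: sd ud; rewrite ltr_norml !ler_norml.
  by move=> /andP[h1 h2] /andP[h3 h4]; apply/andP; split;
    move: h1 h2 h3 h4 sp pu d'0; clear; lra.
have winr p : s <= p -> p <= u -> `|phi p - phi t0| <= r.
  by move=> sp pu; have [_ h] := win p sp pu; rewrite (le_trans h) // ler_pdivrMr //;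
    move: r0; clear; lra.
(* A quarter of the height of the bump. *)
pose k := Num.min (sg * ham X (phi t) - sg * ham X (phi s))
  (sg * ham X (phi t) - sg * ham X (phi u)) / 4.
have k0 : 0 < k by rewrite divr_gt0 // lt_min !subr_gt0 bump1 bump2.
have k4 : 4 * k = Num.min (sg * ham X (phi t) - sg * ham X (phi s))
  (sg * ham X (phi t) - sg * ham X (phi u)) by rewrite /k; field.
have k1 : 4 * k <= sg * ham X (phi t) - sg * ham X (phi s).
  by rewrite k4 ge_min lexx.
have k2 : 4 * k <= sg * ham X (phi t) - sg * ham X (phi u).
  by rewrite k4 ge_min lexx orbT.
have CB0 : 0 < 4 * B ^+ 2 by rewrite mulr_gt0 // exprn_gt0 // (lt_le_trans ltr01).
have L0 : 0 < 3 * `|X0| by rewrite mulr_gt0.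
have [tau tau0 Htau] := phi_uc cphi (divr_gt0 k0 L0).
have [rho rho0 Hrho] := phi_inv_uc cphi iphi tau0.
have B0 : 0 < 2 * B + 1 by move: B1; clear; lra.
have Q0 : 0 < (`|X| + 1) ^+ 2 by rewrite exprn_gt0 // ltr_wpDl.
have D0 : 0 < `|X| + 1 by rewrite ltr_wpDl.
have [|e e0 /and5P[ee1 eek ee2 ee3 /and4P[ee4 ee5 ee6 _]]] := @exists_small
  [:: e1 / 2; k / (4 * B ^+ 2) / 2; e1 / 2 / (`|X| + 1) ^+ 2; k / (4 * B ^+ 2) / 2 / (`|X| + 1) ^+ 2;
     1 ; `|X0| / 16 / (2 * B + 1); Num.min (rho / (6 * `|X0|)) (r / 4 / (2 * B + 1) / (`|X| + 1))].
  rewrite /= ltr01 !lt_min; do ?(apply/andP; split) => //;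
    by do ?(apply: divr_gt0 => //); exact: mulr_gt0.
move: ee6; rewrite le_min => /andP[ee6 ee7].
have [Z [l [nZ dZ /andP[l0 le_] ZX]]] := HZ e e0.
pose Y : field R := l^-1 *: flow_generator Z.
have tY : \tr Y.1 = 0.
  by case: nZ => tZ _; rewrite /Y /= linearZ /= tZ mulr0.
have YXn : `|Y - X| <= e + e * (`|X| + 1) ^+ 2.
  apply: le_trans (flow_generator_near l0 ZX ee4) _.
  by rewrite lerD2l ler_pM2r // ltW.
have YXe1 : `|Y - X| <= e1.
  by apply: le_trans YXn _; move: ee1 ee2; rewrite (ler_pdivlMr _ _ Q0); clear; lra.
have YXk : `|Y - X| * (4 * B ^+ 2) <= k.
  rewrite -ler_pdivlMr //; apply: le_trans YXn _.
  by move: eek ee3; rewrite (ler_pdivlMr _ _ Q0); clear; lra.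
pose F p := sg * ham Y (phi p).
have FX p : `|F p - sg * ham X (phi p)| <= k.
  rewrite /F -mulrBr normrM sg1 mul1r hamB (le_trans _ YXk) //.
  exact: ham_le.
have Ft_s : F s < F t - k.
  have := FX s; have := FX t; rewrite !ler_norml => /andP[h1 h2] /andP[h3 h4].
  by move: h1 h2 h3 h4 k1 k0; clear; lra.
have Ft_u : F u < F t - k.
  have := FX u; have := FX t; rewrite !ler_norml => /andP[h1 h2] /andP[h3 h4].
  by move: h1 h2 h3 h4 k2 k0; clear; lra.
have cF : continuous F.
  by move=> p; apply: cvgM; [exact: cvg_cst|exact: ham_phi_continuous].
have Ftk : F t - k < F t by rewrite ltrBlDr ltrDl.
have [a [sa at_ Fa abovea]] := last_crossing cF (ltW st) Ft_s Ftk.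
have [b [tb bu Fb aboveb]] := first_crossing cF (ltW tu) Ft_u Ftk.
have ab : a < b by exact: lt_trans tb.
have au : a <= u by rewrite (le_trans (ltW at_)) // ltW.
have sb : s <= b by rewrite (le_trans (ltW st)) // ltW.
have su : s <= u by rewrite ltW // (lt_trans st).
have aI := (win a sa au).1; have bI := (win b sb bu).1.
have tI := (win t (ltW st) (ltW tu)).1.
have lin p q : s <= p -> p <= u -> s <= q -> q <= u ->
    `|(ham Y (phi q) - ham Y (phi p)) - cross X0 (phi q - phi p)| <= `|X0| / 4 * `|phi q - phi p|.
  by move=> sp pu sq qu; apply: linear => //; exact: winr.
(* The level drops by k from t to a, which takes a definite parameter time and
   bounds the base of the cap from below. *)
have tau_le : tau <= t - a.
  rewrite leNgt; apply/negP => h.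
  have ta : `|t - a| < tau by rewrite ger0_norm // subr_ge0 ltW.
  have := Htau _ _ tI aI ta; rewrite ltr_pdivlMr // => h1.
  have h2 := lin a t sa au (ltW st) (ltW tu).
  have h3 : `|ham Y (phi t) - ham Y (phi a)| = k.
    have -> : ham Y (phi t) - ham Y (phi a) = sg * (F t - F a).
      rewrite /F -mulrBr mulrA -expr2 -[sg ^+ 2]real_normK ?num_real // sg1 expr1n.
      by rewrite mul1r.
    by rewrite normrM sg1 mul1r Fa opprB addrC subrK gtr0_norm.
  have h4 := cross_le X0 (phi t - phi a).
  have := ler_normD (ham Y (phi t) - ham Y (phi a) - cross X0 (phi t - phi a)) (cross X0 (phi t - phi a)).
  rewrite subrK h3 => h5.
  have h6 : 0 <= `|X0| * `|phi t - phi a| by rewrite mulr_ge0.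
  by move: h1 h2 h4 h5 h6; clear; lra.
have base : rho <= `|phi b - phi a|.
  rewrite leNgt; apply/negP => /(Hrho _ _ bI aI); rewrite gtr0_norm ?subr_gt0 //.
  by move: tau_le tb; clear; lra.
have base0 : 0 < `|phi b - phi a| by exact: lt_le_trans base.
have hamab : ham Y (phi b) - ham Y (phi a) = 0.
  have : sg * (ham Y (phi b) - ham Y (phi a)) = 0.
    by rewrite mulrBr -/(F b) -/(F a) Fa Fb subrr.
  move/eqP; rewrite mulf_eq0 => /orP[/eqP sg0|/eqP //].
  by move: sg1 => /eqP; rewrite sg0 normr0 eq_sym oner_eq0.
have dotab : `|X0| / 2 * rho <= `|dot2 X0 (phi b - phi a)|.
  apply: (@le_trans _ _ (`|X0| / 2 * `|phi b - phi a|)).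
    by rewrite ler_wpM2l // divr_ge0.
  apply: (ham_dot_separation (e := 0) Xn0 (lin a b sa au sb bu)).
    by rewrite hamab normr0.
  by rewrite mulr0 mulr_ge0 // divr_ge0.
have Zp p : s <= p -> p <= u -> `|aff_app Z (phi p) - l *: X0| <= l * (3 / 16 * `|X0|).
  move=> sp pu; have [_ pr] := win p sp pu.
  have -> : aff_app Z (phi p) - l *: X0 = aff_app (Z - l *: X) (phi p) +
      l *: (aff_app X (phi p) - X0).
    by rewrite -aff_appBf aff_appZf scalerBr subrKA.
  have h1 : `|aff_app (Z - l *: X) (phi p)| <= l * (`|X0| / 16).
    rewrite (le_trans (aff_app_le _ _)) //.
    apply: (@le_trans _ _ (l * e * (2 * B + 1))).
      by apply: ler_pM => //; rewrite ?addr_ge0 ?mulr_ge0 // lerD2r ler_pM2l.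
    by rewrite -mulrA ler_pM2l // -ler_pdivlMr.
  have h2 : `|l *: (aff_app X (phi p) - X0)| <= l * (`|X0| / 16).
    rewrite normrZ gtr0_norm // ler_pM2l // (le_trans (aff_app_lip _ _ _)) //.
    apply: le_trans Xr; rewrite -mulrA mulrCA ler_wpM2l //.
    by move: pr; rewrite ler_pdivlMr // mulrC.
  rewrite (le_trans (ler_normD _ _)) // (le_trans (lerD h1 h2)) //.
  by rewrite -mulrDr ler_pM2l //; move: X00; clear; lra.
have dotZ p : s <= p -> p <= u -> 0 < dot2 X0 (aff_app Z (phi p)) < `|X0| / 2 * rho.
  move=> sp pu; have h := Zp p sp pu.
  have -> : aff_app Z (phi p) = l *: X0 + (aff_app Z (phi p) - l *: X0) by rewrite addrC subrK.
  rewrite dot2Dr dot2Zr.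
  have h1 := sqr_norm_le_dot2 X0.
  have h2 : `|dot2 X0 (aff_app Z (phi p) - l *: X0)| <= l * (3 / 8 * `|X0| ^+ 2).
    rewrite (le_trans (dot2_le _ _)) //.
    have -> : l * (3 / 8 * `|X0| ^+ 2) = 2 * (`|X0| * (l * (3 / 16 * `|X0|))) by field.
    by rewrite ler_pM2l // ler_pM2l.
  have h3 : dot2 X0 X0 <= 2 * `|X0| ^+ 2.
    by rewrite expr2 (le_trans (ler_norm _)) // dot2_le.
  have h4 : l * `|X0| ^+ 2 <= l * dot2 X0 X0 by rewrite ler_pM2l.
  have h5 : l * dot2 X0 X0 <= l * (2 * `|X0| ^+ 2) by rewrite ler_pM2l.
  have h6 : 0 < l * `|X0| ^+ 2 by rewrite mulr_gt0 // exprn_gt0.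
  have h7 : l * (6 * `|X0|) * `|X0| < rho * `|X0|.
    rewrite ltr_pM2r // -ltr_pdivlMr ?mulr_gt0 //; exact: lt_le_trans ee6.
  move: h2; rewrite ler_norml => /andP[h8 h9].
  apply/andP; split; first by move: h4 h6 h8; clear; lra.
  by move: h5 h6 h7 h9; rewrite expr2; clear; lra.
have inv x : ham Y (x + aff_app Z x) = ham Y x.
  by rewrite /Y !hamZ ham_flow_invariant.
have [|||eta eta0 Heta] := @cap_crossing R phi X0 Y Z sg a b (F t - k) cphi phiT tY sg1
  (le_trans s0 sa) ab (le_trans bu u1) inv Fa Fb _.
- move=> p ap pb; have [pt|tp] := leP p t; first exact: abovea.
  by apply: aboveb => //; exact: ltW.
- by have /andP[-> h] := dotZ a sa au; exact: lt_le_trans dotab.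
- by have /andP[-> h] := dotZ b sb bu; exact: lt_le_trans dotab.
have rB0 : 0 < r / 4 / (2 * B + 1) by do ?apply: divr_gt0.
have [|Z' Z'Z off] := dZ (Num.min eta (r / 4 / (2 * B + 1))); first by rewrite lt_min eta0.
move: Z'Z; rewrite lt_min => /andP[Z'eta Z'r].
have Zn : `|Z| <= r / 4 / (2 * B + 1).
  rewrite -[Z](subrK (l *: X)) (le_trans (ler_normD _ _)) // normrZ gtr0_norm //.
  apply: (@le_trans _ _ (l * (`|X| + 1))).
    by rewrite mulrDr mulr1 addrC lerD2l (le_trans ZX) // ler_piMr // ltW.
  by rewrite -ler_pdivlMr // (le_trans (ltW le_)).
have Z'n : `|Z'| * (2 * B + 1) <= r / 2.
  rewrite -[Z'](subrK Z) -ler_pdivlMr // (le_trans (ler_normD _ _)) //.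
  have -> : r / 2 / (2 * B + 1) = r / 4 / (2 * B + 1) + r / 4 / (2 * B + 1).
    by field; rewrite gt_eqF.
  by rewrite lerD // ltW.
have moved p : s <= p -> p <= u -> `|phi p + aff_app Z' (phi p) - phi t0| <= r.
  move=> sp pu; have [_ pr] := win p sp pu.
  rewrite addrAC (le_trans (ler_normD _ _)) // [leRHS]splitr lerD //.
  rewrite (le_trans (aff_app_le _ _)) //; apply: le_trans Z'n.
  by rewrite ler_wpM2l // lerD2r ler_pM2l.
have gE x : aff_app (1%:M + Z'.1, Z'.2) x = x + aff_app Z' x.
  by rewrite /aff_app /= mulmxDl mul1mx addrA.
have [|d d0 Hd] := @positive_distance R phi cphi (1%:M + Z'.1, Z'.2).
  by move=> p q pI qI; rewrite gE; exact: off.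
have eps0 : 0 < `|X0| / 8 * d by rewrite mulr_gt0 // divr_gt0.
have [p [q [/andP[ap pb] /andP[aq qb] h1 h2]]] := Heta Z' Z'eta _ eps0.
have [sp pu] : s <= p /\ p <= u by rewrite (le_trans sa ap) (le_trans pb bu).
have [sq qu] : s <= q /\ q <= u by rewrite (le_trans sa aq) (le_trans qb bu).
have := Hd p q (win p sp pu).1 (win q sq qu).1; rewrite gE distrC => h3.
have h4 := linear Y _ _ tY YXe1 (moved p sp pu) (winr q sq qu).
have h5 : `|X0| / 2 * `|phi q - (phi p + aff_app Z' (phi p))| <=
    `|dot2 X0 (phi q - (phi p + aff_app Z' (phi p)))|.
  apply: (ham_dot_separation Xn0 h4 (ltW h2)).
  have -> : 4 * (`|X0| / 8 * d) = `|X0| / 2 * d by field.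
  by rewrite ler_wpM2l // divr_ge0.
have h6 : `|X0| / 2 * d <= `|X0| / 2 * `|phi q - (phi p + aff_app Z' (phi p))|.
  by rewrite ler_wpM2l // divr_ge0.
have h7 : 0 < `|X0| * d by rewrite mulr_gt0.
by move: h1 h5 h6 h7; clear; lra.
Qed.

(** A field that is a limit of displacing directions crosses the arc in one
    direction only, so its Hamiltonian is monotone along the arc. *)
Lemma displaced_ham_monotone (phi : R -> 'cV[R]_2) X t0 :
  continuous phi -> {in `[0, 1] &, injective phi} ->
  (forall t, exists2 s, 0 <= s <= 1 & phi s = phi t) ->
  0 <= t0 <= 1 -> aff_app X (phi t0) <> 0 ->
  (forall e, 0 < e -> exists Z (l : R), [/\ nilpotent_field Z, displaced phi Z,
     0 < l < e & `|Z - l *: X| <= l * e]) ->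
  exists2 d, 0 < d & exists a b, [/\
    forall t, 0 <= t <= 1 -> `|t - t0| <= d -> a <= t <= b &
    (forall s t, a <= s -> s <= t -> t <= b -> ham X (phi s) <= ham X (phi t)) \/
    (forall s t, a <= s -> s <= t -> t <= b -> ham X (phi t) <= ham X (phi s))].
Proof.
move=> cphi iphi phiT t0I Xn0 HZ.
have [d d0 nb] := no_bump cphi iphi phiT t0I Xn0 HZ.
have /andP[t00 t01] := t0I.
exists d => //; exists (Num.max 0 (t0 - d)), (Num.min 1 (t0 + d)); split.
  move=> t /andP[h1 h2]; rewrite ler_norml ge_max le_min h1 h2 /=.
  by move=> /andP[h3 h4]; apply/andP; split; move: h3 h4; clear; lra.
apply: monotone_of_no_bump => s t u; rewrite ge_max => /andP[s0 sd] st tu.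
rewrite le_min => /andP[u1 ud].
have su : s < u by exact: lt_trans tu.
have sd' : `|s - t0| <= d by rewrite ler_norml; move: sd su ud; clear; lra.
have ud' : `|u - t0| <= d by rewrite ler_norml; move: sd su ud; clear; lra.
have n1 := @nb 1 s t u (normr1 _) s0 st tu u1 sd' ud'.
have n2 := @nb (- 1) s t u (normrN1 _) s0 st tu u1 sd' ud'.
rewrite !mul1r in n1; rewrite !mulN1r !ltrN2 in n2.
split.
  have [h|h] := leP (ham X (phi t)) (ham X (phi s)); first by left.
  by right; rewrite leNgt; apply/negP => /(n1 h).
have [h|h] := leP (ham X (phi s)) (ham X (phi t)); first by left.
by right; rewrite leNgt; apply/negP => /(n2 h).
Qed.

End Displaced.

(** * Words and blow-ups *)


Section Norm2.
Variable R : realType.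

Lemma norm_le_norm2 (x : 'cV[R]_2) : `|x| <= norm2 x.
Proof.
have d0 : 0 <= dot2 x x by rewrite dot2E -!expr2 addr_ge0 ?sqr_ge0.
rewrite -ler_sqr ?nnegrE ?sqrtr_ge0 // /norm2 sqr_sqrtr //.
exact: sqr_norm_le_dot2.
Qed.

Lemma norm2_le (x : 'cV[R]_2) : norm2 x <= 2 * `|x|.
Proof.
have d0 : 0 <= dot2 x x by rewrite dot2E -!expr2 addr_ge0 ?sqr_ge0.
rewrite -ler_sqr ?nnegrE ?sqrtr_ge0 ?mulr_ge0 // /norm2 sqr_sqrtr //.
rewrite (le_trans (ler_norm _)) // (le_trans (dot2_le _ _)) //.
have h : 0 <= `|x| * `|x| by rewrite mulr_ge0.
by rewrite expr2; move: h; clear; lra.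
Qed.

End Norm2.

Section Words.
Variables (R : realType) (m : nat) (S : 'I_m -> affine R).
Hypothesis hnondeg : forall i, aff_nondegenerate (S i).
Hypothesis hcontr : forall i, aff_contracting (S i).
Implicit Types (Z : field R) (w : seq 'I_m).

Lemma aff_comp_nondegenerate (f g : affine R) : aff_nondegenerate f ->
  aff_nondegenerate g -> aff_nondegenerate (aff_comp f g).
Proof. by move=> uf ug; rewrite /aff_nondegenerate /aff_comp /= unitmx_mul; apply/andP. Qed.

Lemma word_nondegenerate w : aff_nondegenerate (word_map S w).
Proof.
elim: w => [|i w IH] /=; first by rewrite /aff_nondegenerate unitmx1.
exact: aff_comp_nondegenerate.
Qed.

Lemma aff_comp_id (f : affine R) : aff_comp f (aff_id R) = f.
Proof. by case: f => A b; rewrite /aff_comp /= mulmx1 mulmx0 add0r. Qed.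

Lemma aff_comp_assoc (f g h : affine R) :
  aff_comp f (aff_comp g h) = aff_comp (aff_comp f g) h.
Proof. by rewrite /aff_comp /= !mulmxA mulmxDr addrA mulmxA. Qed.

Lemma aff_id_comp (f : affine R) : aff_comp (aff_id R) f = f.
Proof. by case: f => A b; rewrite /aff_comp /= !mul1mx addr0. Qed.

Lemma word_map_rcons w i : word_map S (rcons w i) = aff_comp (word_map S w) (S i).
Proof.
elim: w => [|j w IH] /=; first by rewrite aff_comp_id aff_id_comp.
by rewrite IH aff_comp_assoc.
Qed.

(** A word contracts at least like the corresponding power of the weakest
    contraction among the letters. *)
Lemma common_contraction : exists2 q : R, 0 <= q < 1 & forall w x y,
  norm2 (aff_app (word_map S w) x - aff_app (word_map S w) y) <=
  q ^+ size w * norm2 (x - y).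
Proof.
have /choice[q Hq] : forall i, exists q : R, 0 <= q < 1 /\
    forall x y, norm2 (aff_app (S i) x - aff_app (S i) y) <= q * norm2 (x - y).
  by move=> i; have [q qI Hq] := hcontr i; exists q.
pose Q := \big[Num.max/0]_i q i.
have Q0 : 0 <= Q by apply: bigmax_ge_id.
have Q1 : Q < 1 by apply/bigmax_ltP; split=> // i _; have [/andP[]] := Hq i.
exists Q; first by rewrite Q0.
elim=> [|i w IH] x y /=; first by rewrite expr0 mul1r !aff_id_app.
rewrite !aff_comp_app (le_trans ((Hq i).2 _ _)) // exprS -mulrA.
have qQ : q i <= Q by apply: le_bigmax.
apply: (@le_trans _ _ (Q * norm2 (aff_app (word_map S w) x - aff_app (word_map S w) y))).
  by rewrite ler_wpM2r ?sqrtr_ge0.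
by rewrite ler_wpM2l.
Qed.

Lemma exp_small (q e : R) : 0 <= q < 1 -> 0 < e ->
  exists l0, forall l, (l0 <= l)%N -> q ^+ l < e.
Proof.
move=> /andP[q0 q1] e0.
have /cvgrPdist_lt/(_ e e0)[l0 _ H] := @cvg_expr R q ltac:(by rewrite ger0_norm).
by exists l0 => l /H; rewrite sub0r normrN ger0_norm ?exprn_ge0.
Qed.

Lemma pull_le (f : affine R) : exists2 C, 0 <= C & forall Z, `|pull f Z| <= C * `|Z|.
Proof.
pose a := `|invmx f.1|; pose b := `|f.1|; pose c := `|f.2|.
have [a0 b0 c0] : [/\ 0 <= a, 0 <= b & 0 <= c] by split; exact: normr_ge0.
have c10 : 0 <= 2 * c + 1 by rewrite addr_ge0 ?mulr_ge0.
exists (4 * a * b + 2 * a * (2 * c + 1)).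
  by rewrite addr_ge0 // !mulr_ge0.
move=> Z; rewrite aff_norm_le /pull /=; apply/andP; split.
- have h : `|invmx f.1 *m Z.1 *m f.1| <= 4 * a * b * `|Z|.
    rewrite (le_trans (mulmx_le _ _)) //.
    have -> : 4 * a * b * `|Z| = 2 * (2 * (a * `|Z|) * b) by ring.
    rewrite ler_pM2l // ler_wpM2r // (le_trans (mulmx_le _ _)) // ler_pM2l //.
    by rewrite ler_wpM2l // field_norm1.
  apply: le_trans h _; rewrite ler_wpM2r // lerDl.
  by rewrite !mulr_ge0.
- have h : `|invmx f.1 *m (Z.1 *m f.2 + Z.2)| <= 2 * a * (2 * c + 1) * `|Z|.
    rewrite (le_trans (mulmx_le _ _)) // -!mulrA ler_pM2l // ler_wpM2l //.
    by have := aff_app_le Z f.2; rewrite /aff_app mulrC.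
  apply: le_trans h _; rewrite ler_wpM2r // lerDr.
  by rewrite !mulr_ge0.
Qed.

Lemma letters_pull_le : exists2 C, 1 <= C & forall i Z, `|pull (S i) Z| <= C * `|Z|.
Proof.
have /choice[C HC] : forall i, exists C : R, 0 <= C /\ forall Z, `|pull (S i) Z| <= C * `|Z|.
  by move=> i; have [C C0 H] := pull_le (S i); exists C.
exists (Num.max 1 (\big[Num.max/0]_i C i)); first by rewrite le_max lexx.
move=> i Z; rewrite (le_trans ((HC i).2 Z)) // ler_wpM2r // le_max.
by apply/orP; right; apply: le_bigmax.
Qed.

Variable phi : R -> 'cV[R]_2.
Hypothesis cphi : continuous phi.
Hypothesis iphi : {in `[0, 1] &, injective phi}.
Hypothesis phiT : forall t, exists2 s, 0 <= s <= 1 & phi s = phi t.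
Hypothesis attr : forall x, (exists2 t, 0 <= t <= 1 & x = phi t) <->
  exists i, exists2 t, 0 <= t <= 1 & x = aff_app (S i) (phi t).

Lemma word_self w t : exists2 s, 0 <= s <= 1 & phi s = aff_app (word_map S w) (phi t).
Proof.
elim: w => [|i w [s sI e]] /=; first by have [s sI e] := phiT t; exists s; rewrite ?aff_id_app.
rewrite aff_comp_app -e.
have [|s' s'I e'] := (attr (aff_app (S i) (phi s))).2; first by exists i, s.
by exists s'.
Qed.

(** Following preimages of the point in the pieces of the arc produces the
    prefixes [w l] of an infinite word. *)
Lemma point_address t0 : 0 <= t0 <= 1 ->
  exists (w : nat -> seq 'I_m) (i : nat -> 'I_m) (t : nat -> R),
  [/\ w 0%N = [::], forall l, w l.+1 = rcons (w l) (i l), forall l, size (w l) = l &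
   forall l, 0 <= t l <= 1 /\ aff_app (word_map S (w l)) (phi (t l)) = phi t0].
Proof.
move=> t0I.
have /choice[nxt Hn] : forall t, exists p : 'I_m * R, 0 <= t <= 1 ->
    0 <= p.2 <= 1 /\ phi t = aff_app (S p.1) (phi p.2).
  move=> t; have [tI|ntI] := pselect (0 <= t <= 1).
    have [|i [s sI e]] := (attr (phi t)).1; first by exists t.
    by exists (i, s).
  have [|i [s sI e]] := (attr (phi t0)).1; first by exists t0.
  by exists (i, s) => /ntI.
pose t l := iter l (fun t => (nxt t).2) t0.
have tI l : 0 <= t l <= 1.
  by elim: l => [//|l IH]; rewrite /t iterS -/(t l); have [] := Hn _ IH.
exists (fun l => mkseq (fun k => (nxt (t k)).1) l), (fun l => (nxt (t l)).1), t.
split=> //.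
- by move=> l; rewrite -cats1 /mkseq -addn1 iotaD map_cat.
- by move=> l; rewrite size_mkseq.
move=> l; split; first exact: tI.
elim: l => [|l IH]; first by rewrite aff_id_app.
rewrite (_ : mkseq _ _ = rcons (mkseq (fun k => (nxt (t k)).1) l) (nxt (t l)).1); last first.
  by rewrite -cats1 /mkseq -addn1 iotaD map_cat.
rewrite word_map_rcons aff_comp_app.
by have [_ <-] := Hn _ (tI l).
Qed.

Section Address.
Variables (t0 : R) (w : nat -> seq 'I_m) (i : nat -> 'I_m) (t : nat -> R).
Hypothesis t0I : 0 <= t0 <= 1.
Hypothesis w0 : w 0%N = [::].
Hypothesis wS : forall l, w l.+1 = rcons (w l) (i l).
Hypothesis wsize : forall l, size (w l) = l.
Hypothesis wt : forall l, 0 <= t l <= 1 /\ aff_app (word_map S (w l)) (phi (t l)) = phi t0.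

Lemma address_pieces_shrink e : 0 < e -> exists l0, forall l, (l0 <= l)%N -> forall s p,
  0 <= s <= 1 -> phi s = aff_app (word_map S (w l)) (phi p) -> `|s - t0| < e.
Proof.
move=> e0; have [d d0 Hd] := phi_inv_uc cphi iphi e0.
have [B B1 bphi] := phi_bounded cphi phiT.
have [q qI Hq] := common_contraction.
have B0 : 0 < 4 * B by rewrite mulr_gt0 // (lt_le_trans ltr01).
have [l0 Hl0] := exp_small qI (divr_gt0 d0 B0).
exists l0 => l /Hl0 ql s p sI e1.
have [s0I ws0] := wt l.
apply: Hd => //; rewrite e1 -ws0 (le_lt_trans (norm_le_norm2 _)) //.
rewrite (le_lt_trans (Hq _ _ _)) // wsize.
have h : norm2 (phi p - phi (t l)) <= 4 * B.
  rewrite (le_trans (norm2_le _)) //.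
  have := ler_normB (phi p) (phi (t l)); have := bphi p; have := bphi (t l).
  by lra.
move: ql; rewrite ltr_pdivlMr //; apply: le_lt_trans.
by rewrite ler_wpM2l // exprn_ge0 //; case/andP: qI.
Qed.

(** The value of the pulled back field at the preimage of the point is the
    image of a fixed non-zero vector under the inverse of a strong contraction. *)
Lemma address_pull_unbounded Z : aff_app Z (phi t0) <> 0 -> forall M,
  exists l, M <= `|pull (word_map S (w l)) Z|.
Proof.
move=> /eqP Z0 M; have [B B1 bphi] := phi_bounded cphi phiT.
have [q qI Hq] := common_contraction.
have B0 : 0 < 2 * B + 1 by lra.
have M0 : 0 < `|M| + 1 by rewrite ltr_wpDl.
have v0 : 0 < `|aff_app Z (phi t0)| by rewrite normr_gt0.
have e0 : 0 < `|aff_app Z (phi t0)| / (2 * ((`|M| + 1) * (2 * B + 1))).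
  by rewrite divr_gt0 // !mulr_gt0.
have [l0 /(_ l0 (leqnn _))] := exp_small qI e0.
rewrite ltr_pdivlMr ?mulr_gt0 // => ql.
exists l0; rewrite leNgt; apply/negP => h.
have [tI wt0] := wt l0.
pose u := aff_app (pull (word_map S (w l0)) Z) (phi (t l0)).
have uS := word_nondegenerate (w l0).
have uE : aff_app (word_map S (w l0)) (phi (t l0) + u) -
    aff_app (word_map S (w l0)) (phi (t l0)) = aff_app Z (phi t0).
  by rewrite aff_appB addrC addKr /u pull_app wt0 mulmxA mulmxV // mul1mx.
have := Hq (w l0) (phi (t l0) + u) (phi (t l0)); rewrite uE wsize addrC addKr => h1.
have un : `|u| <= `|M| * (2 * B + 1).
  rewrite (le_trans (aff_app_le _ _)) //; apply: ler_pM => //.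
  - by rewrite addr_ge0 ?mulr_ge0.
  - by rewrite (le_trans (ltW h)) // ler_norm.
  - by rewrite lerD2r ler_pM2l.
have q0 : 0 <= q ^+ l0 by rewrite exprn_ge0 //; case/andP: qI.
have h2 : `|aff_app Z (phi t0)| <= q ^+ l0 * (2 * (`|M| * (2 * B + 1))).
  rewrite (le_trans (norm_le_norm2 _)) // (le_trans h1) // ler_wpM2l //.
  by rewrite (le_trans (norm2_le _)) // ler_pM2l.
have h3 : q ^+ l0 * (2 * (`|M| * (2 * B + 1))) <= q ^+ l0 * (2 * ((`|M| + 1) * (2 * B + 1))).
  by rewrite ler_wpM2l // ler_pM2l // ler_pM2r // lerDl.
by have := le_lt_trans (le_trans h2 h3) ql; rewrite ltxx.
Qed.

Lemma address_pull_step (C : R) Z l : (forall i Z, `|pull (S i) Z| <= C * `|Z|) ->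
  `|pull (word_map S (w l.+1)) Z| <= C * `|pull (word_map S (w l)) Z|.
Proof.
move=> HC; rewrite wS word_map_rcons pull_comp //.
exact: word_nondegenerate.
Qed.

Lemma address_pull_bound (C : R) Z l : 0 <= C -> (forall i Z, `|pull (S i) Z| <= C * `|Z|) ->
  `|pull (word_map S (w l)) Z| <= C ^+ l * `|Z|.
Proof.
move=> C0 HC; elim: l => [|l IH].
  rewrite w0 /= expr0 mul1r /pull /= mulmx1 mulmx0 add0r.
  have -> : invmx (1%:M : 'M[R]_2) = 1%:M by rewrite invmx1.
  by rewrite !mul1mx; case: Z.
rewrite exprS -mulrA (le_trans (address_pull_step _ _ HC)) //.
by rewrite ler_wpM2l.
Qed.

(** One more letter multiplies the pull-back by at most [C], so that at the
    first depth where its size reaches [a] it is at most [C * a]; for a small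
    field this depth is large. *)
Lemma address_first_exceed (C a : R) (l0 : nat) Z : 1 <= C -> 0 < a ->
  (forall i Z, `|pull (S i) Z| <= C * `|Z|) ->
  aff_app Z (phi t0) <> 0 -> C ^+ l0 * `|Z| < a ->
  exists l, [/\ (l0 < l)%N, a <= `|pull (word_map S (w l)) Z| &
    `|pull (word_map S (w l)) Z| <= C * a].
Proof.
move=> C1 a0 HC Z0 small.
have C0 : 0 <= C by exact: le_trans C1.
have ex : exists l, a <= `|pull (word_map S (w l)) Z|.
  exact: address_pull_unbounded.
have [l al minl] := ex_minnP ex.
have l0l : (l0 < l)%N.
  rewrite ltnNge; apply/negP => ll0; move: al.
  rewrite leNgt (le_lt_trans (address_pull_bound _ _ C0 HC)) //.
  apply: le_lt_trans small; rewrite ler_wpM2r //.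
  by rewrite ler_weXn2l.
exists l; split=> //.
case: l l0l al minl => // l _ _ minl.
apply: (le_trans (address_pull_step _ _ HC)); rewrite ler_wpM2l //.
by rewrite leNgt; apply/negP => /ltW /minl; rewrite ltnn.
Qed.

End Address.

(** This turns local information on the arc into global information. *)
Lemma piece_near (t0 e : R) : 0 <= t0 <= 1 -> 0 < e ->
  exists v, forall s p, 0 <= s <= 1 -> phi s = aff_app (word_map S v) (phi p) ->
  `|s - t0| < e.
Proof.
move=> t0I e0; have [w [i [t [w0 wS wsize wt]]]] := point_address t0I.
have [l0 H] := address_pieces_shrink t0I wsize wt e0.
by exists (w l0); exact: H.
Qed.

End Words.

(** * Arcs that are attractors *)


Section Limits.
Variable R : realType.
Implicit Types (X Z : field R).

Lemma eq0_of_small (x k : R) : (forall e, 0 < e -> `|x| <= e * k) -> x = 0.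
Proof. by move=> h; apply/eqP; rewrite -normr_le0; exact: le0_of_small_multiples h. Qed.

Lemma limit_unit_field X : (forall e, 0 < e -> exists2 Z, `|Z| = 1 & `|Z - X| < e) ->
  X <> 0.
Proof.
move=> h X0; have [Z Z1] := h 1 ltr01.
by rewrite X0 subr0 Z1 ltxx.
Qed.

Lemma nilpotent_limit X : (forall e, 0 < e -> exists Z,
    [/\ `|Z| <= 1, `|\tr Z.1| <= e, `|\det Z.1| <= e & `|Z - X| < e]) ->
  nilpotent_field X.
Proof.
move=> h; split.
- apply: (@eq0_of_small _ 3) => e /h[Z [_ tZ _ ZX]].
  have -> : \tr X.1 = \tr Z.1 - \tr (Z - X).1 by rewrite /= linearB subKr.
  rewrite (le_trans (ler_normB _ _)) //.
  have : `|\tr (Z - X).1| <= 2 * `|Z - X|.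
    rewrite trace2E (le_trans (ler_normD _ _)) // mulr_natl mulr2n.
    by apply: lerD; apply: le_trans (mx_norm_ge _ _ _) (field_norm1 _).
  by move: tZ ZX; clear; lra.
- apply: (@eq0_of_small _ (2 * `|X| + 3)) => e /h[Z [Z1 _ dZ ZX]].
  have entry (A : field R) i j : `|A.1 i j| <= `|A|.
    exact: le_trans (mx_norm_ge _ _ _) (field_norm1 _).
  have prod (a b c d : 'I_2) : `|Z.1 a b * Z.1 c d - X.1 a b * X.1 c d| <= e * (`|X| + 1).
    have -> : Z.1 a b * Z.1 c d - X.1 a b * X.1 c d =
        (Z - X).1 a b * Z.1 c d + X.1 a b * (Z - X).1 c d by rewrite /= !mxE; ring.
    rewrite (le_trans (ler_normD _ _)) // !normrM.
    have h1 : `|(Z - X).1 a b| * `|Z.1 c d| <= e * 1.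
      by apply: ler_pM => //; [apply: ltW (le_lt_trans (entry _ _ _) ZX)|exact: le_trans (entry _ _ _) Z1].
    have h2 : `|X.1 a b| * `|(Z - X).1 c d| <= `|X| * e.
      by apply: ler_pM => //; apply: ltW (le_lt_trans (entry _ _ _) ZX).
    by move: h1 h2; clear; lra.
  have -> : \det X.1 = \det Z.1 - ((Z.1 0 0 * Z.1 1 1 - X.1 0 0 * X.1 1 1)
      - (Z.1 0 1 * Z.1 1 0 - X.1 0 1 * X.1 1 0)) by rewrite !det2E; ring.
  rewrite (le_trans (ler_normB _ _)) //.
  have h1 := prod 0 0 1 1; have h2 := prod 0 1 1 0.
  have := ler_normB (Z.1 0 0 * Z.1 1 1 - X.1 0 0 * X.1 1 1) (Z.1 0 1 * Z.1 1 0 - X.1 0 1 * X.1 1 0).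
  by move: h1 h2 dZ; clear; lra.
Qed.

Lemma trace_field_le Z : `|\tr Z.1| <= 2 * `|Z|.
Proof.
rewrite trace2E (le_trans (ler_normD _ _)) // mulr_natl mulr2n.
by apply: lerD; apply: le_trans (mx_norm_ge _ _ _) (field_norm1 _).
Qed.

Lemma det_field_le Z : `|\det Z.1| <= 2 * `|Z| ^+ 2.
Proof.
rewrite det2E (le_trans (ler_normB _ _)) // !normrM mulr_natl mulr2n expr2.
by apply: lerD; apply: ler_pM => //; apply: le_trans (mx_norm_ge _ _ _) (field_norm1 _).
Qed.

End Limits.

Section Attractor.
Variables (R : realType) (m : nat) (S : 'I_m -> affine R).
Hypothesis hnondeg : forall i, aff_nondegenerate (S i).
Hypothesis hcontr : forall i, aff_contracting (S i).
Variables (phi : R -> 'cV[R]_2) (a0 a1 : 'cV[R]_2).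
Hypothesis cphi : continuous phi.
Hypothesis iphi : {in `[0, 1] &, injective phi}.
Hypothesis phiT : forall t, exists2 s, 0 <= s <= 1 & phi s = phi t.
Hypothesis attr : forall x, (exists2 t, 0 <= t <= 1 & x = phi t) <->
  exists i, exists2 t, 0 <= t <= 1 & x = aff_app (S i) (phi t).
Let gamma := phi @` `[0, 1]%classic.
Hypothesis arc : jordan_arc gamma a0 a1.
Implicit Types (X Z : field R) (w : seq 'I_m).

Let word_nd := word_nondegenerate hnondeg.
Let wself := word_self phiT attr.

Lemma vanishing_field_segment X : X <> 0 ->
  (forall t, 0 <= t <= 1 -> aff_app X (phi t) = 0) -> parabolic_segment gamma.
Proof.
move=> X0 HX; right.
have row (k : 'I_2) : X.1 k 0 <> 0 \/ X.1 k 1 <> 0 -> is_line_segment gamma.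
  move=> nz; pose b : 'cV[R]_2 := \col_i (if i == 0 then X.1 k 1 else - X.1 k 0).
  apply: (@line_arc_segment R phi cphi iphi b (- X.2 k 0)).
    move=> b0; have := congr1 (fun v : 'cV[R]_2 => v 0 0) b0.
    have := congr1 (fun v : 'cV[R]_2 => v 1 0) b0; rewrite !mxE /= => /eqP.
    by rewrite oppr_eq0 => /eqP e1 e0; case: nz.
  move=> t; rewrite in_itv /= => /HX/(congr1 (fun v : 'cV[R]_2 => v k 0)).
  rewrite /aff_app /cross !mxE sum_ord2 /= => e.
  by rewrite -[LHS](addrK (X.2 k 0)) -[RHS]add0r -e; congr (_ - _); ring.
have [|n00] := pselect (X.1 0 0 <> 0); first by move=> h; apply: (row 0); left.
have [|n01] := pselect (X.1 0 1 <> 0); first by move=> h; apply: (row 0); right.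
have [|n10] := pselect (X.1 1 0 <> 0); first by move=> h; apply: (row 1); left.
have [|n11] := pselect (X.1 1 1 <> 0); first by move=> h; apply: (row 1); right.
exfalso; apply: X0.
have M0 : X.1 = 0 by apply: mx2P; rewrite mxE; apply: contrapT.
have := HX 0; rewrite lexx ler01 => /(_ isT).
by rewrite /aff_app M0 mul0mx add0r => b0; case: X M0 b0 {HX row n00 n01 n10 n11} => M b /= -> ->.
Qed.

Lemma nilpotent_level_parabolic Z c : nilpotent_field Z -> Z <> 0 ->
  (forall t, 0 <= t <= 1 -> ham Z (phi t) = c) -> parabolic_segment gamma.
Proof.
move=> nZ Z0 Hc; apply: (nilpotent_level_arc cphi iphi arc nZ Z0 (c := c)).
by move=> t; rewrite in_itv; exact: Hc.
Qed.

Lemma regular_point X : X <> 0 -> ~ parabolic_segment gamma ->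
  exists2 t, 0 <= t <= 1 & aff_app X (phi t) <> 0.
Proof.
move=> X0 np; apply: contrapT => no; apply: np; apply: (vanishing_field_segment X0).
by move=> t tI; apply: contrapT => h; apply: no; exists t.
Qed.

(** Blowing up a tangent field at a regular point produces a nilpotent tangent
    field: pulling back preserves trace and determinant while the norm tends to
    infinity. *)
Lemma tangent_field_parabolic X : tangent_field phi X -> X <> 0 -> parabolic_segment gamma.
Proof.
move=> tX X0; apply: contrapT => np.
have [t0 t0I Xt0] := regular_point X0 np.
have [w [i [t [w0 wS wsize wt]]]] := point_address attr t0I.
have [||Y HY] := @field_cluster R (fun e Z => [/\ tangent_field phi Z, `|Z| = 1,
    `|\tr Z.1| <= e & `|\det Z.1| <= e]) 1.
- move=> e e0.
  pose M := 1 + `|\tr X.1| / e + `|\det X.1| / e.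
  have tr0 : 0 <= `|\tr X.1| / e by rewrite divr_ge0 // ltW.
  have de0 : 0 <= `|\det X.1| / e by rewrite divr_ge0 // ltW.
  have M1 : 1 <= M by rewrite /M; lra.
  have [l Ml] := address_pull_unbounded hnondeg hcontr cphi phiT wsize wt Xt0 M.
  set P := pull _ X in Ml.
  have P1 : 1 <= `|P| by exact: le_trans Ml.
  have P0 : 0 < `|P| by exact: lt_le_trans P1.
  have n1 : `|(`|P|^-1 : R) *: P| = 1 by rewrite normrZ normfV normr_id mulVf // gt_eqF.
  have iP0 : 0 < `|P|^-1 by rewrite invr_gt0.
  exists (`|P|^-1 *: P); first by rewrite n1.
  split=> //.
  + apply: tangent_fieldZ; apply: (tangent_field_pull cphi iphi (word_nd (w l))) tX.
    exact: wself.
  + rewrite /= linearZ /= normrM gtr0_norm // pull_trace // ler_pdivrMl //.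
    rewrite -ler_pdivrMr // (le_trans _ Ml) // /M; lra.
  + rewrite /= detZ pull_det // normrM normrX gtr0_norm // exprVn ler_pdivrMl ?exprn_gt0 //.
    rewrite -ler_pdivrMr //; apply: (@le_trans _ _ `|P|).
      by rewrite (le_trans _ Ml) // /M; lra.
    by rewrite expr2 ler_peMr // ltW.
- by move=> e e' Z ee' [tZ Z1 h1 h2]; split=> //; exact: le_trans ee'.
have nY : nilpotent_field Y.
  apply: nilpotent_limit => e /HY[Z [Z1 [_ _ h1 h2] ZY]].
  by exists Z; split.
have Y0 : Y <> 0.
  by apply: limit_unit_field => e /HY[Z [_ [_ Z1 _ _] ZY]]; exists Z.
have tY : tangent_field phi Y.
  by apply: (tangent_field_closed cphi phiT) => e /HY[Z [_ [tZ _ _ _] ZY]]; exists Z.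
have [t1 t1I Yt1] := regular_point Y0 np.
have [d d0 Hd] := tangent_field_ham_const cphi iphi tY nY.1 t1I Yt1.
have [v Hv] := piece_near hcontr cphi iphi phiT attr t1I d0.
apply: np; apply: (@nilpotent_level_parabolic (pull (word_map S v) Y)
    (ham (pull (word_map S v) Y) (phi 0))).
- exact: pull_nilpotent.
- by move/pull_eq0 => /(_ (word_nd v)).
move=> s sI.
have [s' s'I es] := wself v s; have [o oI eo] := wself v 0.
have dS : \det (word_map S v).1 != 0 by rewrite -unitfE -unitmxE; exact: word_nd.
apply/eqP; rewrite -subr_eq0 -(mulrI_eq0 _ (mulfI dS)).
rewrite -ham_pull //; last exact: nY.1.
rewrite -es -eo subr_eq0; apply/eqP; apply: Hd => //; apply/ltW.
  exact: Hv es.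
exact: Hv eo.
Qed.

Definition weakly_monotone01 (f : R -> R) :=
  (forall s t, 0 <= s -> s <= t -> t <= 1 -> f s <= f t) \/
  (forall s t, 0 <= s -> s <= t -> t <= 1 -> f t <= f s).

(** The pieces [S_wi] and [S_wj] of the arc are run through in opposite
    directions, which is expressed by the effect on functions that are monotone
    along the arc; near the end point [t0] the arc is moved off itself. *)
Definition turning_displacement (t0 : R) Z := exists wi wj, [/\
  forall x, aff_app (word_map S wj) (x + aff_app Z x) = aff_app (word_map S wi) x,
  forall p q, 0 <= p <= 1 -> 0 <= q <= 1 -> `|p - t0| < 2^-1 -> `|q - t0| < 2^-1 ->
    phi p + aff_app Z (phi p) <> phi q &
  forall G : 'cV[R]_2 -> R, weakly_monotone01 (fun t => G (phi t)) ->
    forall s t, 0 <= s <= 1 -> 0 <= t <= 1 ->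
    (G (aff_app (word_map S wj) (phi s)) - G (aff_app (word_map S wj) (phi t))) *
    (G (aff_app (word_map S wi) (phi s)) - G (aff_app (word_map S wi) (phi t))) <= 0].

(** Zooming in along the address of the end point [t0] until the displacement
    has size comparable to [a]: in the limit the linear part loses its trace
    and its determinant. *)
Lemma displaced_nilpotent_field t0 : 0 <= t0 <= 1 ->
  (forall e, 0 < e -> exists2 Z, `|Z| < e & turning_displacement t0 Z) ->
  forall e, 0 < e -> exists Z, [/\ nilpotent_field Z, displaced phi Z & 0 < `|Z| < e].
Proof.
move=> t0I HZ e e0.
have [C C1 HC] := letters_pull_le S.
have C0 : 0 < C by exact: lt_le_trans C1.
pose a := Num.min (e / 2) 1 / C.
have me0 : 0 < Num.min (e / 2) 1 by rewrite lt_min ltr01 divr_gt0.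
have apos : 0 < a by rewrite divr_gt0.
have Ca : C * a = Num.min (e / 2) 1 by rewrite /a mulrC divfK // gt_eqF.
have Ca1 : C * a <= 1 by rewrite Ca ge_min lexx orbT.
have Cae : C * a < e.
  by rewrite Ca gt_min; apply/orP; left; rewrite ltr_pdivrMr // ltr_pMr // ltr1n.
have [w [i [t [w0 wS wsize wt]]]] := point_address attr t0I.
have half0 : 0 < 2^-1 :> R by rewrite invr_gt0.
have [l0 Hl0] := address_pieces_shrink hcontr cphi iphi phiT t0I wsize wt half0.
have [||Z HZ'] := @field_cluster R (fun e Z => [/\ a <= `|Z|, `|\tr Z.1| <= e,
    `|\det Z.1| <= e & forall p q, 0 <= p <= 1 -> 0 <= q <= 1 ->
    phi p + aff_app Z (phi p) <> phi q]) (C * a).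
- move=> e' e'0.
  have Cl0 : 0 < C ^+ l0 by rewrite exprn_gt0.
  have [d d0 /and4P[d1 d2 d3 _]] := @exists_small R [:: a / C ^+ l0; e' / 2; 1]
    ltac:(by rewrite /= !divr_gt0 // ltr01).
  have [Z Zd [wi [wj [ZS Zoff _]]]] := HZ d d0.
  have Z0 : aff_app Z (phi t0) <> 0.
    move=> e1; apply: (Zoff t0 t0) => //; rewrite ?subrr ?normr0 //.
    by rewrite e1 addr0.
  have small : C ^+ l0 * `|Z| < a.
    by rewrite mulrC -ltr_pdivlMr // (lt_le_trans Zd).
  have [l [l0l al lC]] := address_first_exceed hnondeg hcontr cphi phiT w0 wS wsize wt
    C1 apos HC Z0 small.
  have uS := word_nd (w l).
  have Zn := ltW Zd.
  exists (pull (word_map S (w l)) Z) => //; split=> //.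
  + rewrite pull_trace // (le_trans (trace_field_le Z)) //.
    by rewrite -ler_pdivlMl // mulrC (le_trans Zn).
  + rewrite pull_det // (le_trans (det_field_le Z)) //.
    rewrite -ler_pdivlMl // mulrC; apply: le_trans d2; apply: le_trans Zn.
    by rewrite expr2 ler_piMr // (le_trans (ltW Zd)).
  move=> p q pI qI /(congr1 (aff_app (word_map S (w l)))) e1.
  have [p' p'I ep] := wself (w l) p; have [q' q'I eq'] := wself (w l) q.
  have sl := Hl0 l (ltnW l0l).
  apply: (Zoff p' q' p'I q'I (sl _ _ p'I ep) (sl _ _ q'I eq')).
  rewrite eq' -e1 ep pull_app.
  rewrite -[LHS](subrK (aff_app (word_map S (w l)) (phi p))) -[RHS](subrK (aff_app (word_map S (w l)) (phi p))).
  by congr (_ + _); rewrite aff_appB !(addrC (_ (phi p))) addrK addrC addKr ?mulmxA ?mulmxV ?mul1mx.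
- by move=> e1 e2 Z e12 [h1 h2 h3 h4]; split=> //; exact: le_trans e12.
have nZ : nilpotent_field Z.
  apply: nilpotent_limit => e1 /HZ'[Z' [Z'C [_ h1 h2 _] ZZ']].
  by exists Z'; split=> //; exact: le_trans Ca1.
exists Z; split=> //.
  by move=> e1 /HZ'[Z' [_ [_ _ _ h] ZZ']]; exists Z'.
apply/andP; split.
  have a20 : 0 < a / 2 by rewrite divr_gt0.
  have [Z' [_ [aZ' _ _ _] ZZ']] := HZ' _ a20.
  have := ler_normB Z' (Z' - Z); rewrite subKr => h.
  have := ler_normD (Z' - Z) Z; rewrite subrK.
  by lra.
have g0 : 0 < e - C * a by rewrite subr_gt0.
have [Z' [Z'C _ ZZ']] := HZ' _ g0.
have := ler_normB Z' (Z' - Z); rewrite subKr => h.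
by lra.
Qed.

(** A limit field of the blow-ups at [t0] has a Hamiltonian that is monotone
    along the arc. Carried to the scale of [S_wj], it increases along the arc
    and decreases along the displaced arc or conversely, and the two coincide
    in the limit. *)
Lemma turning_displacement_parabolic t0 : 0 <= t0 <= 1 ->
  (forall e, 0 < e -> exists2 Z, `|Z| < e & turning_displacement t0 Z) ->
  parabolic_segment gamma.
Proof.
move=> t0I HZ; apply: contrapT => np.
have HN := displaced_nilpotent_field t0I HZ.
(* A limit direction X of displacing nilpotent fields. *)
have [||X HX] := @field_cluster R (fun e X => exists Z (l : R), [/\ nilpotent_field Z,
    displaced phi Z, 0 < l < e, Z = l *: X & `|X| = 1]) 1.
- move=> e /HN[Z [nZ dZ /andP[Z0 Ze]]].
  have n1 : `|(`|Z|^-1 : R) *: Z| = 1 by rewrite normrZ normfV normr_id mulVf // gt_eqF.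
  exists (`|Z|^-1 *: Z); first by rewrite n1.
  exists Z, `|Z|; split=> //; first by rewrite Z0.
  by rewrite scalerA divff ?gt_eqF // scale1r.
- move=> e e' Z ee' [Z' [l [h1 h2 /andP[l0 le_] h3 h4]]].
  by exists Z', l; split=> //; rewrite l0 (lt_le_trans le_).
have nX : nilpotent_field X.
  apply: nilpotent_limit => e e0; have [Y [Y1 [Z [l [[tZ dZ] _ /andP[l0 _] ZE _]] YX]]] := HX e e0.
  have YE : Y = l^-1 *: Z by rewrite ZE scalerA mulVf ?gt_eqF // scale1r.
  exists Y; split=> //.
    by rewrite YE /= linearZ /= tZ mulr0 normr0 ltW.
  by rewrite YE /= detZ dZ mulr0 normr0 ltW.
have X0 : X <> 0.
  by apply: limit_unit_field => e /HX[Y [_ [Z [l [_ _ _ _ Y1]]] YX]]; exists Y.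
have [t1 t1I Xt1] := regular_point X0 np.
have [|d d0 [a [b [Hab mono]]]] := @displaced_ham_monotone R phi X t1 cphi iphi phiT t1I Xt1.
  move=> e e0; have [Y [Y1 [Z [l [nZ dZ /andP[l0 le_] ZE _]] YX]]] := HX e e0.
  exists Z, l; split=> //; first by rewrite l0.
  by rewrite ZE -scalerBr normrZ gtr0_norm // ler_pM2l // ltW.
have [v Hv] := piece_near hcontr cphi iphi phiT attr t1I d0.
have [al [cal alI alS malpha]] := induced_parameter_map cphi iphi (word_nd v) (wself v).
have alab s : a <= al s <= b.
  by apply: Hab => //; apply/ltW; apply: (Hv _ s) => //; rewrite alS.
pose X' := pull (word_map S v) X.
have nX' : nilpotent_field X' by exact: pull_nilpotent.
have dv0 : \det (word_map S v).1 != 0 by rewrite -unitfE -unitmxE; exact: word_nd.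
have X'0 : X' <> 0 by move/pull_eq0 => /(_ (word_nd v)).
have monoG : weakly_monotone01 (fun t => \det (word_map S v).1 * ham X' (phi t)).
  have incr s t : ham X (phi (al s)) <= ham X (phi (al t)) ->
      \det (word_map S v).1 * ham X' (phi s) <= \det (word_map S v).1 * ham X' (phi t).
    by rewrite -subr_ge0 !alS ham_pull // ?mulrBr ?subr_ge0 //; exact: nX.1.
  have alw s t : 0 <= s -> s <= t -> t <= 1 ->
      (increasing01 al -> al s <= al t) /\ (decreasing01 al -> al t <= al s).
    move=> s0; rewrite le_eqVlt => /orP[/eqP -> //|st] tt1.
    by split=> h; apply/ltW/h.
  have alb s := proj2 (andP (alab s)); have ala s := proj1 (andP (alab s)).
  case: malpha => mal; case: mono => mo; [left|right|right|left] => s t s0 st tt1;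
    have [h1 h2] := alw _ _ s0 st tt1; apply: incr; apply: mo => //; [exact: h1|exact: h1|exact: h2|exact: h2].
have monoX' : weakly_monotone01 (fun t => ham X' (phi t)).
  have [d1|d1] := ltP 0 (\det (word_map S v).1).
    by case: monoG => mo; [left|right] => s t s0 st tt1;
      have := mo s t s0 st tt1; rewrite ler_pM2l.
  have d2 : \det (word_map S v).1 < 0 by rewrite lt_neqAle dv0.
  by case: monoG => mo; [right|left] => s t s0 st tt1;
    have := mo s t s0 st tt1; rewrite ler_nM2l.
(* A limit Y of the normalised Hamiltonians of X' in the coordinates S_wj. *)
have [||Y HY] := @field_cluster R (fun e Y => [/\ nilpotent_field Y, `|Y| = 1 &
    exists2 Z, `|Z| < e & forall s t, 0 <= s <= 1 -> 0 <= t <= 1 ->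
    (ham Y (phi s) - ham Y (phi t)) * (ham Y (phi s + aff_app Z (phi s)) -
     ham Y (phi t + aff_app Z (phi t))) <= 0]) 1.
- move=> e /HZ[Z Ze [wi [wj [ZS _ HG]]]].
  pose P := pull (word_map S wj) X'.
  have P0 : P <> 0 by move/pull_eq0 => /(_ (word_nd wj)).
  have Pn0 : `|P| != 0 by rewrite normr_eq0; apply/eqP.
  have nP : nilpotent_field P by exact: pull_nilpotent.
  have n1 : `|(`|P|^-1 : R) *: P| = 1 by rewrite normrZ normfV normr_id mulVf.
  exists (`|P|^-1 *: P); first by rewrite n1.
  split=> //.
    by case: nP => tP dP; split; rewrite /= ?linearZ /= ?tP ?mulr0 // detZ dP mulr0.
  exists Z => // s t sI tI.
  have dw0 : \det (word_map S wj).1 != 0 by rewrite -unitfE -unitmxE; exact: word_nd.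
  have := HG (ham X') monoX' s t sI tI.
  rewrite -!ZS !ham_pull //; try exact: nX'.1.
  rewrite -/P !hamZ -!mulrBr.
  move: (ham P _ - ham P _) (ham P _ - ham P _) => y x h.
  have q0 : 0 < (\det (word_map S wj).1) ^+ 2 by rewrite exprn_even_gt0.
  have h' : x * y <= 0.
    rewrite -(pmulr_rle0 _ q0); apply: le_trans h; rewrite le_eqVlt.
    by apply/orP; left; apply/eqP; ring.
  have -> : `|P|^-1 * x * (`|P|^-1 * y) = (`|P|^-1) ^+ 2 * (x * y) by ring.
  by rewrite mulr_ge0_le0 // sqr_ge0.
- move=> e e' Y ee' [h1 h2 [Z Ze h3]]; split=> //.
  by exists Z => //; exact: lt_le_trans ee'.
have nY : nilpotent_field Y.
  apply: nilpotent_limit => e e0; have [Z [Z1 [[tZ dZ] _ _] ZY]] := HY e e0.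
  by exists Z; rewrite tZ dZ normr0; split=> //; exact: ltW.
have Y0 : Y <> 0.
  by apply: limit_unit_field => e /HY[Z [_ [_ Z1 _] ZY]]; exists Z.
apply: np; apply: (@nilpotent_level_parabolic Y (ham Y (phi 0)) nY Y0) => s sI.
have zI : 0 <= (0 : R) <= 1 by rewrite lexx ler01.
apply/eqP; rewrite -subr_eq0; apply/eqP.
have [B B1 bphi] := phi_bounded cphi phiT.
pose B3 := 3 * B + 1.
have B31 : 1 <= B3 by rewrite /B3; lra.
have BB3 : B <= B3 by rewrite /B3; lra.
pose k1 := 2 * (4 * B3 ^+ 2).
pose k2 := k1 + 2 * ((8 * B3 + 2) * (2 * B + 1)).
have k10 : 0 <= k1 by have := sqr_ge0 B3; rewrite /k1; lra.
have k12 : k1 <= k2.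
  by rewrite /k2 lerDl mulr_ge0 // mulr_ge0 //; lra.
(* For a field V near Y the increments x and y of its Hamiltonian along the arc
   and the displaced arc have opposite signs and are both close to the
   increment D for Y. *)
suff small e : 0 < e -> e <= 1 -> `|ham Y (phi s) - ham Y (phi 0)| <= e * k2.
  apply: (@eq0_of_small _ _ k2) => e e0; have [e1|e1] := leP e 1; first exact: small.
  apply: le_trans (small 1 ltr01 (lexx _)) _; rewrite ler_wpM2r ?(ltW e1) //.
  exact: le_trans k12.
move=> e0 e1; have [V [V1 [nV Vn [Z Ze HV]] VY]] := HY e e0.
have nearV x : `|x| <= B3 -> `|ham V x - ham Y x| <= e * (4 * B3 ^+ 2).
  move=> xB; rewrite hamB (le_trans (ham_le _ B31 xB)) // ler_wpM2r ?(ltW VY) //.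
  by have := sqr_ge0 B3; lra.
have phiB3 p : `|phi p| <= B3 by exact: le_trans BB3.
have ZB p : `|aff_app Z (phi p)| <= e * (2 * B + 1).
  rewrite (le_trans (aff_app_le _ _)) //; apply: ler_pM => //; rewrite ?(ltW Ze) //.
    by rewrite addr_ge0 // mulr_ge0.
  by rewrite lerD2r ler_pM2l.
have movB p : `|phi p + aff_app Z (phi p)| <= B3.
  rewrite (le_trans (ler_normD _ _)) //.
  have h : e * (2 * B + 1) <= 2 * B + 1 by rewrite ler_piMl //; lra.
  by have := ZB p; have := bphi p; rewrite /B3; lra.
have moved p : `|ham V (phi p + aff_app Z (phi p)) - ham V (phi p)| <=
    e * ((8 * B3 + 2) * (2 * B + 1)).
  rewrite (le_trans (ham_lip nV.1 (phiB3 p) (movB p))) // Vn mul1r.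
  rewrite (addrC (phi p)) addrK mulrCA ler_wpM2l //; first by lra.
have := HV s 0 sI zI.
set D := ham Y (phi s) - ham Y (phi 0).
set x := ham V (phi s) - ham V (phi 0); set y := _ - ham V (phi 0 + _) => xy.
have xD : `|x - D| <= e * k1.
  have h1 := nearV _ (phiB3 s); have h2 := nearV _ (phiB3 0).
  have -> : x - D = (ham V (phi s) - ham Y (phi s)) - (ham V (phi 0) - ham Y (phi 0)).
    by rewrite /x /D; ring.
  by rewrite (le_trans (ler_normB _ _)) // /k1; lra.
have yx : `|y - x| <= 2 * (e * ((8 * B3 + 2) * (2 * B + 1))).
  have h1 := moved s; have h2 := moved 0.
  have -> : y - x = (ham V (phi s + aff_app Z (phi s)) - ham V (phi s)) -
    (ham V (phi 0 + aff_app Z (phi 0)) - ham V (phi 0)) by rewrite /x /y; ring.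
  by rewrite (le_trans (ler_normB _ _)) //; lra.
have yD : `|y - D| <= e * k2.
  have -> : y - D = (y - x) + (x - D) by ring.
  by rewrite (le_trans (ler_normD _ _)) // /k2; lra.
have {}xD : `|x - D| <= e * k2 by rewrite (le_trans xD) // ler_pM2l.
rewrite leNgt; apply/negP => big.
move: xy; apply/negP; rewrite -ltNge.
have same z : `|z - D| <= e * k2 -> (0 < D -> 0 < z) /\ (D <= 0 -> z < 0).
  move: big; rewrite ler_norml; have [D0|D0] := ltP 0 D.
    by rewrite gtr0_norm // => big /andP[h1 h2]; split=> // _; lra.
  by rewrite ler0_norm // => big /andP[h1 h2]; split=> // _; lra.
have [x1 x2] := same x xD; have [y1 y2] := same y yD.
have [D0|D0] := ltP 0 D; first by rewrite mulr_gt0 ?x1 ?y1.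
by rewrite nmulr_rgt0 ?x2 ?y2.
Qed.

End Attractor.

(** * Classification of small displacements *)


Section Opposite.
Variable R : realType.
Implicit Types (al be F : R -> R).

Lemma opposite_meeting_point al be : continuous al -> continuous be ->
  increasing01 al -> decreasing01 be ->
  (exists p q, [/\ 0 <= p <= 1, 0 <= q <= 1 & al q = be p]) ->
  exists2 z, 0 <= z <= 1 & al z = be z.
Proof.
move=> cal cbe ial dbe [p [q [/andP[p0 p1] /andP[q0 q1] e]]].
have dle s t : 0 <= s -> s <= t -> t <= 1 -> be t <= be s.
  by move=> s0; rewrite le_eqVlt => /orP[/eqP -> //|st t1]; rewrite ltW // dbe.
have cd : continuous (be \- al) by move=> x; apply: cvgB; [exact: cbe|exact: cal].
have [qp|/ltW pq] := leP q p.
  have [|z /andP[qz zp] /eqP] := @ivt_ge _ (be \- al) q p 0 cd qp.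
    by rewrite /= subr_le0 subr_ge0; apply/andP; split; [rewrite -e increasing01_le|rewrite e dle].
  rewrite /= subr_eq0 => /eqP ez; exists z => //.
  by rewrite (le_trans q0 qz) (le_trans zp p1).
have [|z /andP[pz zq] /eqP] := @ivt_ge _ (be \- al) p q 0 cd pq.
  by rewrite /= subr_le0 subr_ge0; apply/andP; split; [rewrite e dle|rewrite -e increasing01_le].
rewrite /= subr_eq0 => /eqP ez; exists z => //.
by rewrite (le_trans p0 pz) (le_trans zq q1).
Qed.

Lemma opposite_no_match al be z p q : increasing01 al -> decreasing01 be ->
  al z = be z -> 0 <= z <= 1 -> 0 <= p <= 1 -> 0 <= q <= 1 ->
  (z < p /\ z < q) \/ (p < z /\ q < z) -> al q <> be p.
Proof.
move=> ial dbe ez /andP[z0 z1] /andP[p0 p1] /andP[q0 q1] [[zp zq]|[pz qz]] e.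
  have h1 := ial _ _ z0 zq q1; have h2 := dbe _ _ z0 zp p1.
  by have := lt_trans h2 (le_lt_trans _ h1); rewrite ez lexx e ltxx => /(_ isT).
have h1 := ial _ _ q0 qz z1; have h2 := dbe _ _ p0 pz z1.
by have := lt_trans h1 (le_lt_trans _ h2); rewrite ez lexx e ltxx => /(_ isT).
Qed.

Lemma opposite_increments F al be s t : weakly_monotone01 F ->
  (forall t, 0 <= al t <= 1) -> (forall t, 0 <= be t <= 1) ->
  (increasing01 al /\ decreasing01 be) \/ (decreasing01 al /\ increasing01 be) ->
  0 <= s <= 1 -> 0 <= t <= 1 ->
  (F (al s) - F (al t)) * (F (be s) - F (be t)) <= 0.
Proof.
move=> mF alI beI opp.
wlog st : s t / s <= t.
  move=> wl sI tI; have [st|/ltW ts] := leP s t; first exact: wl.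
  by rewrite -(opprB (F (al t))) -(opprB (F (be t))) mulrNN; apply: wl.
move=> /andP[s0 _] /andP[_ t1].
move: st; rewrite le_eqVlt => /orP[/eqP ->|st]; first by rewrite subrr mul0r.
have key a b : (forall t, 0 <= a t <= 1) -> (forall t, 0 <= b t <= 1) ->
    a s <= a t -> b t <= b s -> (F (a s) - F (a t)) * (F (b s) - F (b t)) <= 0.
  move=> aI bI ast bst.
  have /andP[a0 _] := aI s; have /andP[_ a1] := aI t.
  have /andP[b0 _] := bI t; have /andP[_ b1] := bI s.
  case: mF => mo.
    by rewrite mulr_le0_ge0 ?subr_le0 ?subr_ge0 ?mo.
  by rewrite mulr_ge0_le0 ?subr_le0 ?subr_ge0 ?mo.
case: opp => -[h1 h2].
  by apply: key => //; apply/ltW; [apply: h1|apply: h2].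
by rewrite mulrC; apply: key => //; apply/ltW; [apply: h2|apply: h1].
Qed.

End Opposite.

Section Classification.
Variables (R : realType) (m : nat) (S : 'I_m -> affine R).
Hypothesis hnondeg : forall i, aff_nondegenerate (S i).
Hypothesis hcontr : forall i, aff_contracting (S i).
Variables (phi : R -> 'cV[R]_2) (a0 a1 : 'cV[R]_2).
Hypothesis cphi : continuous phi.
Hypothesis iphi : {in `[0, 1] &, injective phi}.
Hypothesis phiT : forall t, exists2 s, 0 <= s <= 1 & phi s = phi t.
Hypothesis attr : forall x, (exists2 t, 0 <= t <= 1 & x = phi t) <->
  exists i, exists2 t, 0 <= t <= 1 & x = aff_app (S i) (phi t).
Let gamma := phi @` `[0, 1]%classic.
Hypothesis arc : jordan_arc gamma a0 a1.
Implicit Types (X Z : field R) (w : seq 'I_m).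

(** Here [al] and [be] are the parameter maps of the two pieces, both reversed
    if they are decreasing; [al q = be p] says that the displacement moves
    [phi p] to [phi q]. *)
Definition sliding_displacement (e : R) Z := exists al be : R -> R,
  [/\ continuous al /\ continuous be, increasing01 al /\ increasing01 be,
    forall p q, 0 <= p <= 1 -> 0 <= q <= 1 -> al q = be p ->
      phi q = phi p + aff_app Z (phi p) /\ `|p - q| < e &
    exists p q, [/\ 0 <= p <= 1, 0 <= q <= 1 & al q = be p]].

Lemma sliding_displacement_parabolic :
  (forall e, 0 < e -> exists2 Z, Z <> 0 & `|Z| < e /\ sliding_displacement e Z) ->
  parabolic_segment gamma.
Proof.
move=> HZ.
have [||X HX] := @field_cluster R (fun e X => exists Z (l : R),
    [/\ 0 < l, Z = l *: X, `|X| = 1 & sliding_displacement e Z]) 1.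
- move=> e /HZ[Z Z0 [_ sl]].
  have Zn0 : `|Z| != 0 by rewrite normr_eq0; apply/eqP.
  have n1 : `|(`|Z|^-1 : R) *: Z| = 1 by rewrite normrZ normfV normr_id mulVf.
  exists (`|Z|^-1 *: Z); first by rewrite n1.
  exists Z, `|Z|; split=> //; first by rewrite normr_gt0; apply/eqP.
  by rewrite scalerA divff // scale1r.
- move=> e e' X ee' [Z [l [h1 h2 h3 [al [be [c1 i1 rel ex]]]]]].
  exists Z, l; split=> //; exists al, be; split=> // p q pI qI e1.
  by have [r1 r2] := rel p q pI qI e1; split=> //; exact: lt_le_trans ee'.
apply: (tangent_field_parabolic hnondeg hcontr cphi iphi phiT attr arc (X := X)).
  apply: (tangent_field_of_slides cphi iphi phiT) => e e0.
  have [Y [_ [Z [l [l0 ZE _ [al [be [c1 i1 rel ex]]]]]] YX]] := HX e e0.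
  exists l, Z, al, be; split=> //.
  by rewrite ZE -scalerBr normrZ gtr0_norm // ler_pM2l // ltW.
by apply: limit_unit_field => e /HX[Y [_ [_ [_ [_ _ Y1 _]]] YX]]; exists Y.
Qed.

(** If the parameter maps of the two pieces have opposite directions they agree
    at a parameter [z], and neither side of [z] is met by its own displacement.
    One of the two sides contains half of the interval. *)
Lemma displacement_trichotomy Z wi wj (e : R) :
  (forall x, aff_app (word_map S wj) (x + aff_app Z x) = aff_app (word_map S wi) x) ->
  (exists p q, [/\ 0 <= p <= 1, 0 <= q <= 1 & phi p + aff_app Z (phi p) = phi q]) ->
  (forall p q, 0 <= p <= 1 -> 0 <= q <= 1 -> phi p + aff_app Z (phi p) = phi q ->
     `|p - q| < e) ->
  [\/ sliding_displacement e Z, turning_displacement S phi 1 Z |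
      turning_displacement S phi 0 Z].
Proof.
move=> ZS [p0 [q0 [p0I q0I match0]]] close.
have word_nd := word_nondegenerate hnondeg.
have wself := word_self phiT attr.
have [al [cal alI alS mal]] := induced_parameter_map cphi iphi (word_nd wj) (wself wj).
have [be [cbe beI beS mbe]] := induced_parameter_map cphi iphi (word_nd wi) (wself wi).
have rel p q : al q = be p <-> phi p + aff_app Z (phi p) = phi q.
  split=> [e1|e1].
    by apply: (aff_app_inj2 (word_nd wj)); rewrite ZS -alS e1 beS.
  by apply: (phi_inj iphi) => //; rewrite alS beS -ZS e1.
have oppc (f : R -> R) : continuous f -> continuous (fun t => - f t).
  by move=> cf t; apply: cvgN; exact: cf.
have slide (f g : R -> R) : continuous f -> continuous g -> increasing01 f ->
    increasing01 g -> (forall p q, f q = g p <-> al q = be p) -> sliding_displacement e Z.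
  move=> cf cg mf mg fg; exists f, g; split=> //; last first.
    by exists p0, q0; split=> //; apply/fg/rel.
  by move=> p q pI qI /fg/rel e1; split; [exact/esym|exact: close].
have turn (f g : R -> R) : continuous f -> continuous g -> increasing01 f ->
    decreasing01 g -> (forall p q, f q = g p <-> al q = be p) ->
    (increasing01 al /\ decreasing01 be) \/ (decreasing01 al /\ increasing01 be) ->
    turning_displacement S phi 1 Z \/ turning_displacement S phi 0 Z.
  move=> cf cg mf mg fg opp.
  have [|z zI ez] := opposite_meeting_point cf cg mf mg.
    by exists p0, q0; split=> //; apply/fg/rel.
  have prod G : weakly_monotone01 (fun t => G (phi t)) ->
      forall s t, 0 <= s <= 1 -> 0 <= t <= 1 ->
      (G (aff_app (word_map S wj) (phi s)) - G (aff_app (word_map S wj) (phi t))) *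
      (G (aff_app (word_map S wi) (phi s)) - G (aff_app (word_map S wi) (phi t))) <= 0.
    move=> mG s t sI tI; rewrite -!alS -!beS.
    exact: (opposite_increments mG alI beI opp sI tI).
  have half : (1 : R) - 2^-1 = 2^-1 by lra.
  have [z2|/ltW z2] := leP z 2^-1; [left|right]; exists wi, wj; split=> // p q pI qI.
    rewrite !ltr_norml => /andP[h1 _] /andP[h2 _] /rel/fg.
    by apply: (opposite_no_match mf mg ez zI pI qI); left; split; lra.
  rewrite !subr0 !ltr_norml => /andP[_ h1] /andP[_ h2] /rel/fg.
  by apply: (opposite_no_match mf mg ez zI pI qI); right; split; lra.
have negE p q : - al q = - be p <-> al q = be p by split=> [/oppr_inj|->].
have negi (f : R -> R) : decreasing01 f -> increasing01 (fun t => - f t).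
  by move=> df s t s0 st t1; rewrite ltrN2; exact: df.
have negd (f : R -> R) : increasing01 f -> decreasing01 (fun t => - f t).
  by move=> df s t s0 st t1; rewrite ltrN2; exact: df.
case: mal => mal; case: mbe => mbe.
- by apply: Or31; apply: (slide al be).
- have [h|h] := turn al be cal cbe mal mbe (fun p q => iff_refl _) (or_introl (conj mal mbe)).
    exact: Or32.
  exact: Or33.
- have [h|h] := turn _ _ (oppc _ cal) (oppc _ cbe) (negi _ mal) (negd _ mbe) negE
    (or_intror (conj mal mbe)).
    exact: Or32.
  exact: Or33.
- by apply: Or31; apply: (slide _ _ (oppc _ cal) (oppc _ cbe) (negi _ mal) (negi _ mbe)).
Qed.

End Classification.

Unset Implicit Arguments.

Theorem theorem3 (R : realType) (m : nat) (S : 'I_m -> affine R)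
  (gamma : set 'cV[R]_2) (a0 a1 : 'cV[R]_2)
  (hnondeg : forall i, aff_nondegenerate (S i))
  (hcontr : forall i, aff_contracting (S i))
  (harc : jordan_arc gamma a0 a1)
  (hattr : is_attractor S gamma)
  (hseq : exists f : nat -> affine R,
    [/\ forall n, (assoc_family S `\ aff_id R) (f n),
        f n @[n --> \oo] --> aff_id R &
        forall n, (aff_app (f n) @` gamma) `&` gamma !=set0]) :
  parabolic_segment gamma.
Proof.
have [phi0 [cphi0 iphi0 gE _ _]] := harc.
(* The parametrization is extended to the line by constants, so that it is
   continuous everywhere. *)
pose clamp (t : R) : R := Num.max 0 (Num.min 1 t).
have clampI t : 0 <= clamp t <= 1.
  by rewrite /clamp le_max lexx ge_max ler01 ge_min lexx.
have clampE t : 0 <= t <= 1 -> clamp t = t.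
  by move=> /andP[t0 t1]; rewrite /clamp min_r // max_r.
have clampC t : [\/ clamp t = 0 /\ t <= 0, clamp t = t | clamp t = 1 /\ 1 <= t].
  have [t0|/ltW t0] := leP t 0.
    by apply: Or31; rewrite /clamp min_r ?(le_trans t0) // max_l.
  have [t1|/ltW t1] := leP t 1; first by apply: Or32; rewrite clampE // t0.
  by apply: Or33; rewrite /clamp min_l // max_r.
have clampL s t : `|clamp s - clamp t| <= `|s - t|.
  wlog st : s t / s <= t.
    by move=> wl; case: (leP s t) => [|/ltW] /wl // h; rewrite distrC (distrC s).
  have [cs0 cs1] := andP (clampI s); have [ct0 ct1] := andP (clampI t).
  rewrite distrC (distrC s) [leRHS]ger0_norm ?subr_ge0 // ler_norml.
  by case: (clampC s) => [[e1 h1]|e1|[e1 h1]]; case: (clampC t) => [[e2 h2]|e2|[e2 h2]];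
    rewrite e1 e2 in cs0 cs1 ct0 ct1 *; apply/andP; split; lra.
pose phi t := phi0 (clamp t).
have phiE t : 0 <= t <= 1 -> phi t = phi0 t by move=> tI; rewrite /phi clampE.
have cphi : continuous phi.
  move=> t; apply/cvgrPdist_lt => e e0.
  have cI : `[0, 1]%classic (clamp t) by rewrite /= in_itv /=; exact: clampI.
  have /subspace_continuousP/(_ _ cI)/cvgrPdist_lt/(_ e e0) := cphi0.
  rewrite /prop_near1 /= => /nbhs_ballP[d d0 Hd].
  apply/nbhs_ballP; exists d => // s; rewrite /ball /= => ts.
  apply: Hd; last by rewrite /= in_itv /=; exact: clampI.
  by rewrite /ball /= (le_lt_trans (clampL _ _)).
have iphi : {in `[0, 1] &, injective phi}.
  move=> s t; rewrite !in_itv /= => sI tI; rewrite !phiE //.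
  by apply: iphi0; rewrite in_itv.
have phiT t : exists2 s, 0 <= s <= 1 & phi s = phi t.
  by exists (clamp t); rewrite // /phi clampE.
have gammaP x : gamma x <-> exists2 t, 0 <= t <= 1 & x = phi t.
  rewrite gE; split.
    by case=> t; rewrite /= in_itv /= => tI <-; exists t => //; rewrite phiE.
  by case=> t tI ->; exists t; rewrite /= ?in_itv // phiE.
have gE' : gamma = phi @` `[0, 1]%classic.
  rewrite predeqE => x; split.
    by move=> /gammaP[t tI ->]; exists t; rewrite //= in_itv.
  by case=> t; rewrite /= in_itv /= => tI <-; apply/gammaP; exists t.
have attr x : (exists2 t, 0 <= t <= 1 & x = phi t) <->
    exists i, exists2 t, 0 <= t <= 1 & x = aff_app (S i) (phi t).
  have [_ _ gS] := hattr; split.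
    move=> /gammaP; rewrite gS => -[i _ [y /gammaP[t tI ->] <-]].
    by exists i, t.
  case=> i [t tI ->]; apply/gammaP; rewrite gS; exists i => //.
  by exists (phi t) => //; apply/gammaP; exists t.
rewrite gE' in harc *.
have [f [fF fcvg fmeet]] := hseq.
have [B B1 bphi] := phi_bounded cphi phiT.
have B0 : 0 < 2 * B + 1 by lra.
(* Arbitrarily small non-zero displacements from the given sequence. *)
have tri e : 0 < e -> exists2 Z : field R, Z <> 0 & `|Z| < e /\
    [\/ sliding_displacement phi e Z, turning_displacement S phi 1 Z |
      turning_displacement S phi 0 Z].
  move=> e0; have [d d0 Hd] := phi_inv_uc cphi iphi e0.
  have e10 : 0 < Num.min e (d / (2 * B + 1)) by rewrite lt_min e0 divr_gt0.
  have /cvgrPdist_lt/(_ _ e10)[n _ /(_ n (leqnn n)) small] := fcvg.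
  have [[i [j [u [v [_ fE]]]]] fne] := fF n.
  pose Z : field R := (f n : field R) - (aff_id R : field R).
  have fZ x : aff_app (f n) x = x + aff_app Z x.
    by rewrite /Z -aff_appBf aff_id_app addrC subrK.
  have Zsmall : `|Z| < Num.min e (d / (2 * B + 1)) by rewrite distrC.
  move: Zsmall; rewrite lt_min => /andP[Ze]; rewrite ltr_pdivlMr // => Zd.
  exists Z; first by move=> /eqP; rewrite subr_eq0 => /eqP; exact: fne.
  split=> //.
  apply: (@displacement_trichotomy R m S hnondeg phi cphi iphi phiT attr Z (i :: u) (j :: v)).
  - move=> x; rewrite -fZ fE aff_comp_app.
    have [_ ->] := aff_invK (word_nondegenerate hnondeg (j :: v)).
    by [].
  - have [x [[y gy yx] gx]] := fmeet n.
    have /gammaP[p pI ep] := gy; have /gammaP[q qI eq'] := gx.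
    by exists p, q; split=> //; rewrite -fZ -ep yx.
  - move=> p q pI qI e1; apply: Hd => //.
    rewrite -e1 opprD addrA subrr sub0r normrN (le_lt_trans (aff_app_le _ _)) //.
    apply: le_lt_trans Zd; rewrite ler_wpM2l // lerD2r ler_pM2l //.
have z01 : 0 <= (0 : R) <= 1 by rewrite lexx ler01.
have o01 : 0 <= (1 : R) <= 1 by rewrite ler01 lexx.
have par := @turning_displacement_parabolic R m S hnondeg hcontr phi a0 a1 cphi iphi phiT attr harc.
apply: contrapT => np.
have [e1 e10 no1] : exists2 e, 0 < e &
    forall Z, `|Z| < e -> ~ turning_displacement S phi 1 Z.
  apply: contrapT => no; apply: np; apply: (par 1 o01) => e e0.
  apply: contrapT => noZ; apply: no; exists e => // Z Ze tZ.
  by apply: noZ; exists Z.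
have [e2 e20 no2] : exists2 e, 0 < e &
    forall Z, `|Z| < e -> ~ turning_displacement S phi 0 Z.
  apply: contrapT => no; apply: np; apply: (par 0 z01) => e e0.
  apply: contrapT => noZ; apply: no; exists e => // Z Ze tZ.
  by apply: noZ; exists Z.
apply: np; apply: (sliding_displacement_parabolic hnondeg hcontr cphi iphi phiT attr harc).
move=> e e0.
have [|Z Z0 [Ze]] := tri (Num.min e (Num.min e1 e2)); first by rewrite !lt_min e0 e10.
move: Ze; rewrite !lt_min => /and3P[Ze Ze1 Ze2] [sl|/(no1 _ Ze1)//|/(no2 _ Ze2)//].
exists Z => //; split=> //.
have [al [be [c1 i1 rel ex]]] := sl.
exists al, be; split=> // p q pI qI e3.
have [r1 r2] := rel p q pI qI e3; split=> //.
by move: r2; rewrite lt_min => /andP[].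
Qed.
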